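(* Let $n\ge 4$ and let $K$ be a centrally-symmetric convex body in $\mathbb{R}^n$. For $a\in\{2,3\}$, let $K_a$ be the star-body whose radial function is $\rho_{K_a}=\rho_K^{1/(n-a)}$. Then $K_a$ is an $(n-a)$-Busemann-Petty body. Consequently, for every centrally-symmetric star-body $L\subset\mathbb{R}^n$ satisfying $\mathrm{Vol}(K_a\cap H)\le \mathrm{Vol}(L\cap H)$ for all $H\in G(n,a)$, one has $\mathrm{Vol}(K_a)\le\mathrm{Vol}(L)$.
   Context: All bodies are centrally-symmetric star-bodies $K\subset\mathbb{R}^n$, determined by a continuous radial function $\rho_K(\theta)=\max\{r\ge0: r\theta\in K\}$, $\theta\in S^{n-1}$. $G(n,m)$ is the Grassmannian of $m$-dimensional linear subspaces of $\mathbb{R}^n$, and $\mathrm{Vol}$ denotes Lebesgue measure in the affine hull. The $m$-dimensional spherical Radon transform $R_m:C(S^{n-1})\to C(G(n,m))$ is $R_m(f)(E)=\int_{S^{n-1}\cap E}f\,d\sigma_m$, where $\sigma_m$ is the Haar probability measure on the sphere $S^{n-1}\cap E$. Its dual $R_m^*$ maps signed Borel measures on $G(n,m)$ to signed Borel measures on $S^{n-1}$ via $\int_{S^{n-1}} f\,R_m^*(d\mu)=\int_{G(n,m)}R_m(f)\,d\mu$ for all $f\in C(S^{n-1})$. A star-body $K$ is called a $k$-Busemann-Petty body ($1\le k\le n-1$) if $\rho_K^k\,d\theta = R_{n-k}^*(d\mu)$ as measures on $S^{n-1}$ for some non-negative Borel measure $\mu$ on $G(n,n-k)$ (here $\rho_K^k$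 is identified with the measure having that density with respect to the normalized Haar measure on $S^{n-1}$). *)

(* Defs.v *)
From HB Require Import structures.
From mathcomp Require Import all_boot all_order all_algebra.
From mathcomp Require Import all_classical all_reals all_analysis.
Set Implicit Arguments. Unset Printing Implicit Defensive.
Import Order.TTheory GRing.Theory Num.Theory.
Import numFieldNormedType.Exports.
Local Open Scope classical_set_scope.
Local Open Scope ring_scope.

Section Defs.
Variable R : realType.

Definition dotv n (x y : 'rV[R]_n) : R := (x *m y^T) 0 0.
Definition enorm n (x : 'rV[R]_n) : R := Num.sqrt (dotv x x).
Definition normalize n (x : 'rV[R]_n) : 'rV[R]_n := (enorm x)^-1 *: x.
Definition unitsphere n : set 'rV[R]_n := [set x | enorm x = 1].
Definition unitball n : set 'rV[R]_n := [set x | enorm x <= 1].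

Definition rcons0 n (x : R) (t : 'rV[R]_n) : 'rV[R]_n.+1 :=
  \row_(i < n.+1) (if unlift ord0 i is Some j then t 0 j else x).

(* Lebesgue integral on R^n (iterated one-dimensional Lebesgue integrals,
   which coincides with the n-dimensional Lebesgue integral by Fubini-Tonelli
   for the functions considered here). *)
Fixpoint lebint (n : nat) : ('rV[R]_n -> \bar R) -> \bar R :=
  match n return ('rV[R]_n -> \bar R) -> \bar R with
  | 0 => fun g => g 0
  | m.+1 => fun g =>
      (\int[@lebesgue_measure R]_(x in [set: R]) lebint (fun t => g (rcons0 x t)))%E
  end.

Definition vol n (A : set 'rV[R]_n) : \bar R := lebint (fun x => (\1_A x)%:E).

(* Grassmannian G(n,m): m-dimensional linear subspaces, each represented by
   its orthogonal projection matrix (a bijective encoding). *)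
Definition grass n m : set 'M[R]_n :=
  [set P | P^T = P /\ P *m P = P /\ \rank P = m].

Definition frame n m (P : 'M[R]_n) : 'M[R]_(m, n) :=
  xget 0 [set U : 'M[R]_(m, n) | U *m U^T = 1%:M /\ U^T *m U = P].

(* m-dimensional volume of A /\ E inside E (E = range of P), computed via an
   orthonormal frame of E (independent of the choice of frame). *)
Definition secvol n m (P : 'M[R]_n) (A : set 'rV[R]_n) : \bar R :=
  vol [set y : 'rV[R]_m | A (y *m frame m P)].

(* Integral against the Haar probability measure on S^{n-1} /\ E, where E is
   spanned by the orthonormal rows of U : 'M_(m,n)  (normalized cone measure) *)
Definition sphint n m (U : 'M[R]_(m, n)) (f : 'rV[R]_n -> R) : \bar R :=
  (lebint (fun y : 'rV[R]_m => (\1_(@unitball m) y * f (normalize (y *m U)))%:E)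
   * ((fine (vol (@unitball m)))^-1)%:E)%E.

Definition radon n m (f : 'rV[R]_n -> R) (P : 'M[R]_n) : \bar R :=
  sphint (frame m P) f.

Definition radial n (K : set 'rV[R]_n) (th : 'rV[R]_n) : R :=
  sup [set r | 0 <= r /\ K (r *: th)].

Definition starb n (rho : 'rV[R]_n -> R) : set 'rV[R]_n :=
  [set x | x = 0 \/ enorm x <= rho (normalize x)].

End Defs.
Arguments unitsphere : clear implicits.
Arguments unitball : clear implicits.
Arguments grass : clear implicits.

Notation mxBorel R n := (g_sigma_algebraType (@open 'M[R]_n)).

(* K is a k-Busemann-Petty body: rho_K^k dtheta = R_{n-k}^*(dmu) for some
   non-negative Borel measure mu on G(n,n-k). *)
Definition BPbody (R : realType) (n k : nat) (K : set 'rV[R]_n) : Prop :=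
  exists mu : {measure set (mxBorel R n) -> \bar R},
    mu (~` grass R n (n - k)%N) = 0%E /\
    forall f : 'rV[R]_n -> R, {within unitsphere R n, continuous f} ->
      @sphint R n n (1%:M : 'M[R]_n) (fun th => f th * @radial R n K th ^+ k) =
      (\int[mu]_(P in grass R n (n - k)%N) @radon R n (n - k)%N f P)%E.

(* Main.v *)
(** Write [I f] for the spherical average of [f * rho_K] and [R_a f] for the
   averages of [f] over the [(a-1)]-dimensional great subspheres.  Everything
   follows from one positivity statement: if [R_a f >= 0] on the Grassmannian
   and [a] is 2 or 3, then [I f >= 0].  Given this, Hahn-Banach (a linear
   minorant of [phi |-> inf {I g | R_a g >= phi}]) and the Riesz representation
   theorem on the compact Grassmannian yield the measure [mu]; applied to
   [rho_L^a - rho_{K_a}^a] together with the weighted AM-GM inequality, it also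
   yields the volume comparison.

   Averages over thin slabs show that nonnegative averages over great subspheres
   of some dimension force nonnegative averages in all higher dimensions, which
   reduces positivity to [a = 3] in R^4.  There the Brunn-Minkowski inequality
   gives [vol (K /\ {|<x,xi>| < e}) >= 1/3 vol (K /\ {|<x,xi>| < 3e})].
   For quaternions, [u |-> u xi] parametrizes the sphere in [xi^perp] by S^2 and
   [xi |-> u xi] is orthogonal, which turns the average over [xi] of this
   difference times [R_3 f (xi^perp)] into the average of [f] against
   a convolution of [1_K]; since the coordinates of a uniform point of S^2 are
   uniform (Archimedes), its kernel at [xi] is nonnegative and supported within
   distance [3e] of the line of [xi], so that for [e -> 0] it tends to [rho_K]. *)
Require Import Defs.
From HB Require Import structures.
From mathcomp Require Import all_boot all_order all_algebra.
From mathcomp Require Import all_classical all_reals all_analysis.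
From mathcomp Require Import measurable_realfun ring lra.
Import Order.TTheory GRing.Theory Num.Theory.
Import numFieldNormedType.Exports.
Local Open Scope classical_set_scope.
Local Open Scope ring_scope.
Set Implicit Arguments. Unset Strict Implicit. Unset Printing Implicit Defensive.

(** * Borel sets of matrices *)

(** The constants of the slab inequality have to fit together. The slab of half-width 3e is the slab
    of half-width e plus two mirror-image side slabs of the same thickness; this gives the factor 3.
    On the kernel side, <u,z> is uniform between -|z| and |z| when u is uniform on S^2, so the
    average of 1{|<u,z>| < e} - (1/3) 1{|<u,z>| < 3e} is min(1, e/|z|) - (1/3) min(1, 3e/|z|):
    nonnegative, and exactly zero for |z| >= 3e because the two tails cancel. Such uniformity is
    special to S^2, so xi^perp must have dimension 3, which ties the analytic step to R^4. Larger n
    is reached by cutting: on a four-dimensional subspace f has nonnegative averages over great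
    2-spheres and the section of K is again a symmetric convex body, so f times rho_K has
    nonnegative average there; the slab argument, now applied to this product, carries the sign up
    to R^n. Much of the measure theory has one origin: [lebint] is an iterated integral of a
    possibly signed function, and must be tied to a genuine measure before polar coordinates,
    rotations and Fubini become available. *)

HB.instance Definition _ (R : realType) (m n : nat) :=
  @isMeasurable.Build (sigma_display (@open 'M[R]_(m, n))) 'M[R]_(m, n)
  (<<s @open 'M[R]_(m, n) >>) (@sigma_algebra0 _ setT _)
  (@sigma_algebraC _ _) (@sigma_algebra_bigcup _ setT _).

Arguments rcons0 {R n}. Arguments dotv {R n}. Arguments enorm {R n}. Arguments normalize {R n}.
Arguments lebint {R n}. Arguments vol {R n}. Arguments frame {R n}. Arguments secvol {R n}.
Arguments sphint {R n m}. Arguments radon {R n}. Arguments radial {R n}. Arguments starb {R n}.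

Section pushm.
Context d d' (T1 : measurableType d) (T2 : measurableType d') (R : realType).
Variables (m : {measure set T1 -> \bar R}) (f : T1 -> T2) (mf : measurable_fun setT f).

(** The proof [mf] is an argument so that the measure structure attached below, which needs it, can
    be inferred from the term. *)
Definition pushm (mf : measurable_fun setT f) := pushforward m f.

Let pushm0 : pushm mf set0 = 0%E.
Proof. by rewrite /pushm /pushforward preimage_set0 measure0. Qed.
Let pushm_ge0 A : (0 <= pushm mf A)%E. Proof. exact: measure_ge0. Qed.
Let pushm_sigma : semi_sigma_additive (pushm mf).
Proof.
move=> F mF tF mUF; rewrite /pushm /pushforward preimage_bigcup.
apply: measure_semi_sigma_additive.
- by move=> n; rewrite -[X in measurable X]setTI; exact: mf.
- apply/trivIsetP => /= i j _ _ ij; rewrite -preimage_setI.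
  by move/trivIsetP : tF => /(_ _ _ _ _ ij) ->//; rewrite preimage_set0.
- by rewrite -preimage_bigcup -[X in measurable X]setTI; exact: mf.
Qed.
HB.instance Definition _ := isMeasure.Build _ _ _ (pushm mf) pushm0 pushm_ge0 pushm_sigma.
End pushm.

Section mx_measurable.
Context {R : realType}.

Lemma open_mx_measurable m n (A : set 'M[R]_(m, n)) : open A -> measurable A.
Proof. exact: sub_sigma_algebra. Qed.

Lemma closed_mx_measurable m n (A : set 'M[R]_(m, n)) : closed A -> measurable A.
Proof. by move=> /closed_openC/open_mx_measurable/measurableC; rewrite setCK. Qed.

Lemma compact_mx_measurable m n (A : set 'M[R]_(m, n)) : compact A -> measurable A.
Proof. by move=> /(compact_closed (@norm_hausdorff _ _))/closed_mx_measurable. Qed.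

Lemma open_continuous_mx_measurable m n (D : set 'M[R]_(m, n)) (f : 'M[R]_(m, n) -> R) :
  open D -> {in D, continuous f} -> measurable_fun D f.
Proof.
move=> oD cf; apply: (measurability _ (RGenOpens.measurableE R)).
move=> _ [_ [a [b ->] <-]]; apply: open_mx_measurable.
by apply: (iffLR (continuous_inP f oD) cf); exact: interval_open.
Qed.

Lemma continuous_mx_measurable m n (f : 'M[R]_(m, n) -> R) :
  continuous f -> measurable_fun setT f.
Proof.
by move=> cf; apply: open_continuous_mx_measurable; [exact: openT|move=> x _; exact: cf].
Qed.

Lemma measurable_coord m n i j :
  measurable_fun setT (fun M : 'M[R]_(m, n) => M i j).
Proof. by apply: continuous_mx_measurable; exact: coord_continuous. Qed.

Lemma mx_ballE m n (x y : 'M[R]_(m, n)) e :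
  ball x e y <-> 0 < e /\ forall i j, `|x i j - y i j| < e.
Proof. by split => -[]. Qed.

Lemma exists_natSinv_lt (e : R) : 0 < e -> exists k, k.+1%:R^-1 < e.
Proof.
move=> e0; have [k _ kP] := near_infty_natSinv_lt (PosNum e0).
by exists k; apply: (kP k) => /=.
Qed.

(** An open set is a countable union of balls with rational centre and radius 1/(k+1), and for the
    sup norm a ball is a finite intersection of conditions on single entries. *)
Lemma measurable_mxP d (T : measurableType d) m n (g : T -> 'M[R]_(m, n)) :
  (forall i j, measurable_fun setT (fun x => g x i j)) -> measurable_fun setT g.
Proof.
move=> mg; apply: (@measurability _ _ _ _ _ _ (@open 'M[R]_(m, n))) => //.
move=> _ [W oW <-]; rewrite setTI.
pose c (q : 'M[rat]_(m, n)) : 'M[R]_(m, n) := map_mx ratr q.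
pose B (p : 'M[rat]_(m, n) * nat) := ball (c p.1) (p.2.+1%:R^-1 : R).
have -> : W = \bigcup_(p in [set p | B p `<=` W]) B p.
  apply/seteqP; split => [x Wx|x [p pW /pW]//].
  have /nbhs_ballP[e /= e0 xeW] : nbhs x W by apply: open_nbhs_nbhs.
  have [k ke] := exists_natSinv_lt (divr_gt0 e0 (ltr0Sn _ 1) : 0 < e / 2).
  have k0 : (0 : R) < k.+1%:R^-1 by rewrite invr_gt0 ltr0n.
  have /choice[q1 q1P] : forall p : 'I_m * 'I_n, exists r : rat,
      `|ratr r - x p.1 p.2| < k.+1%:R^-1 :> R.
    move=> p; have : x p.1 p.2 < x p.1 p.2 + k.+1%:R^-1 by rewrite ltrDl.
    move=> /rat_in_itvoo[r]; rewrite in_itv/= => /andP[r1 r2]; exists r.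
    by rewrite ger0_norm ?subr_ge0 ?ltrBlDl// ltW.
  exists (\matrix_(i, j) q1 (i, j), k).
    move=> y /= /mx_ballE[_ yq]; apply: xeW; apply/mx_ballE; split => // i j.
    have := yq i j; have := q1P (i, j); rewrite !mxE/= => H1 H2.
    rewrite (le_lt_trans (ler_distD (ratr (q1 (i, j))) _ _))//.
    rewrite distrC in H1; rewrite (splitr e); apply: ltrD; apply: lt_trans ke => //.
  by apply/mx_ballE; split => // i j; rewrite !mxE/=; exact: (q1P (i, j)).
rewrite preimage_bigcup bigcup_mkcond; apply: countable_bigcupT_measurable => // p.
case: ifPn => // _.
have [k0 k0P] : exists e : R, 0 < e /\ e = p.2.+1%:R^-1 by exists p.2.+1%:R^-1; rewrite invr_gt0.
have -> : g @^-1` B p = \bigcap_(i in [set: 'I_m]) \bigcap_(j in [set: 'I_n])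
    ((fun x => `|c p.1 i j - g x i j|) @^-1` `]-oo, p.2.+1%:R^-1[).
  apply/seteqP; split=> [x /= /mx_ballE[_ H] i _ j _ /=|x /= H]; first by rewrite in_itv/= H.
  apply/mx_ballE; split; first by rewrite invr_gt0.
  by move=> i j; have := H i Logic.I j Logic.I; rewrite /= in_itv.
apply: fin_bigcap_measurable => // i _; apply: fin_bigcap_measurable => // j _.
rewrite -[X in measurable X]setTI; apply: measurableT_comp => //.
by apply: measurable_funB => //; exact: mg.
Qed.

End mx_measurable.

(** * Lebesgue measure on R^n *)

Section vol_measure.
Context {R : realType}.
Local Open Scope ereal_scope.
Local Notation leb := (@lebesgue_measure R).

Definition tail0 n (v : 'rV[R]_n.+1) : 'rV[R]_n := \row_j v 0%R (lift ord0 j).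

Lemma rcons0_0 n x (t : 'rV[R]_n) : rcons0 x t 0%R 0%R = x.
Proof. by rewrite mxE unlift_none. Qed.

Lemma rcons0_lift n x (t : 'rV[R]_n) j : rcons0 x t 0%R (lift ord0 j) = t 0%R j.
Proof. by rewrite mxE liftK. Qed.

Lemma tail0K n x (t : 'rV[R]_n) : tail0 (rcons0 x t) = t.
Proof. by apply/rowP => j; rewrite mxE rcons0_lift. Qed.

Lemma rcons0K n (v : 'rV[R]_n.+1) : rcons0 (v 0%R 0%R) (tail0 v) = v.
Proof.
by apply/rowP => j; rewrite mxE; case: unliftP => [k ->|->]; rewrite ?mxE.
Qed.

Lemma measurable_tail0 n : measurable_fun setT (@tail0 n).
Proof.
apply: measurable_mxP => i j; rewrite /tail0.
under eq_fun do rewrite mxE. exact: measurable_coord.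
Qed.

Lemma measurable_rcons0 n :
  measurable_fun setT (fun p : measurableTypeR R * 'rV[R]_n => rcons0 p.1 p.2).
Proof.
apply: measurable_mxP => i j; under eq_fun do rewrite mxE.
case: unliftP => [k _|_]; last exact: measurable_fst.
by apply: (measurableT_comp (measurable_coord 0%R k)); exact: measurable_snd.
Qed.

Lemma lebint_ge0 n (F : 'rV[R]_n -> \bar R) : (forall x, 0 <= F x) -> 0 <= lebint F.
Proof.
elim: n F => [|n IH] F F0 /=; first exact: F0.
by apply: integral_ge0 => x _; apply: IH.
Qed.

End vol_measure.

Section vol_step.
Context {R : realType} (n : nat) (mu : {sigma_finite_measure set 'rV[R]_n -> \bar R}).
Local Open Scope ereal_scope.
Local Notation leb := (@lebesgue_measure R).

(** The product measure moved to R^(n+1) along [rcons0], so that Tonelli turns its integral into the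
    outermost integral of [lebint]. *)
Definition vol_step := pushm (leb \x mu) (@measurable_rcons0 R n).

HB.instance Definition _ := Measure.on vol_step.

Let vol_step_sigma_finite : sigma_finite setT vol_step.
Proof.
have /sigma_finiteP[F [TF ndF Foo]] := sigma_finiteT mu.
have mF k : measurable (F k) by case: (Foo k).
exists (fun k => [set v : 'rV[R]_n.+1 | (`|v 0%R 0%R| <= k%:R)%R] `&` @tail0 R n @^-1` F k).
  apply/seteqP; split => // v _; have : setT (tail0 v) by [].
  rewrite TF => -[k _ Fk].
  have [k' k'P] : exists k' : nat, (`|v 0%R 0%R| <= k'%:R)%R.
    by exists (Num.truncn `|v 0%R 0%R|).+1; rewrite ltW// truncnS_gt.
  exists (maxn k k') => //; split => /=.
    by rewrite (le_trans k'P)// ler_nat leq_maxr.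
  by move: Fk; apply/subsetPset/ndF/leq_maxl.
move=> k; split.
  apply: measurableI.
    rewrite -[X in measurable X]setTI.
    rewrite (_ : [set v : 'rV[R]_n.+1 | _] = (fun v : 'rV[R]_n.+1 => `|v 0 0|%R) @^-1` `]-oo, k%:R]%classic); last first.
      by apply/seteqP; split => x /=; rewrite in_itv.
    by apply: measurableT_comp => //; exact: measurable_coord.
  by rewrite -[X in measurable X]setTI; apply: measurable_tail0.
rewrite /vol_step /pushm /pushforward.
rewrite (_ : _ @^-1` _ = `[(- k%:R)%R, k%:R%R : R]%classic `*` F k); last first.
  apply/seteqP; split => -[x t] /=; rewrite rcons0_0 tail0K in_itv/= ler_norml => -[//].
have [_ Fkoo] := Foo k.
apply: (@le_lt_trans _ _ (leb `[(- k%:R)%R, k%:R%R : R]%classic * mu (F k))).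
  by rewrite le_eqVlt; apply/orP; left; apply/eqP; apply: product_measure1E => //; exact: measurable_itv.
rewrite lte_mul_pinfty// ?lebesgue_measure_itv/=; case: ifPn => // _; rewrite -EFinD//.
Qed.
HB.instance Definition _ := Measure_isSigmaFinite.Build _ _ _ vol_step vol_step_sigma_finite.

Lemma integral_vol_step (F : 'rV[R]_n.+1 -> \bar R) :
  measurable_fun setT F -> (forall x, 0 <= F x) ->
  \int[vol_step]_x F x = \int[leb]_x \int[mu]_t F (rcons0 x t).
Proof.
move=> mF F0; rewrite ge0_integral_pushforward//; last exact: measurable_rcons0.
rewrite preimage_setT fubini_tonelli1//; last by move=> x /=.
by apply: (measurableT_comp mF); exact: measurable_rcons0.
Qed.

End vol_step.

Section vol_measure2.
Context {R : realType}.
Local Open Scope ereal_scope.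

(** Existential because [vol] is not yet known to be a measure; the measure found here transfers its
    properties to [vol] and is then forgotten. *)
Lemma lebint_rep n : exists mu : {sigma_finite_measure set 'rV[R]_n -> \bar R},
  forall F, measurable_fun setT F -> (forall x, 0 <= F x) -> lebint F = \int[mu]_x F x.
Proof.
elim: n => [|n [mu muE]].
  exists (dirac (0%R : 'rV[R]_0)) => F mF F0 /=.
  by rewrite integral_dirac// diracT mul1e.
exists (vol_step mu) => F mF F0 /=; rewrite integral_vol_step//.
apply: eq_integral => x _; rewrite muE//.
apply: (measurableT_comp mF).
by apply: (measurable_fun_pair2 _ (@measurable_rcons0 R n)).
Qed.

Lemma vol_rep n : exists mu : {sigma_finite_measure set 'rV[R]_n -> \bar R},
  (forall F, measurable_fun setT F -> (forall x, 0 <= F x) -> lebint F = \int[mu]_x F x)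
  /\ forall A, measurable A -> vol A = mu A.
Proof.
have [mu muE] := lebint_rep n; exists mu; split => // A mA.
rewrite /vol muE ?integral_indic ?setIT//.
by apply/measurable_EFinP/measurable_indic.
Qed.

Let vol0 n : @vol R n set0 = 0.
Proof. by have [mu [_ ->//]] := vol_rep n. Qed.
Let vol_ge0 n (A : set 'rV[R]_n) : 0 <= vol A.
Proof. by apply: lebint_ge0 => x; rewrite lee_fin. Qed.
(** [vol] is defined on all sets and is compared with the representing measure on measurable ones
    only, which is all that additivity asks. *)
Let vol_sigma n : semi_sigma_additive (@vol R n).
Proof.
have [mu [_ muE]] := vol_rep n => F mF tF mUF.
rewrite muE// (_ : (fun _ => _) = fun k => \sum_(0 <= i < k) mu (F i)); last first.
  by apply/funext => k; apply: eq_bigr => i _; rewrite muE.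
exact: measure_semi_sigma_additive.
Qed.
HB.instance Definition _ n := isMeasure.Build _ _ _ (@vol R n) (vol0 n) (@vol_ge0 n) (@vol_sigma n).

Let vol_sigma_finite n : sigma_finite setT (@vol R n).
Proof.
have [mu [_ muE]] := vol_rep n; have [F TF Foo] := sigma_finiteT mu.
by exists F => // i; have [mFi Fi] := Foo i; rewrite muE.
Qed.
HB.instance Definition _ n := Measure_isSigmaFinite.Build _ _ _ (@vol R n) (@vol_sigma_finite n).

Lemma lebintE n (F : 'rV[R]_n -> \bar R) : measurable_fun setT F -> (forall x, 0 <= F x) ->
  lebint F = \int[vol]_x F x.
Proof.
move=> mF F0; have [mu [-> // muE]] := vol_rep n.
by apply: eq_measure_integral => A mA _; exact/esym/muE.
Qed.

Lemma integral_volS n (F : 'rV[R]_n.+1 -> \bar R) :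
  measurable_fun setT F -> (forall x, 0 <= F x) ->
  \int[vol]_x F x = \int[@lebesgue_measure R]_x \int[vol]_t F (rcons0 x t).
Proof.
move=> mF F0; rewrite -lebintE//=; apply: eq_integral => x _.
by rewrite lebintE//; apply: (measurableT_comp mF); apply: (measurable_fun_pair2 _ (@measurable_rcons0 R n)).
Qed.

End vol_measure2.

(** * Euclidean geometry of row vectors *)

Section euclid.
Context {R : realType}.

Lemma dotvE n (x y : 'rV[R]_n) : dotv x y = \sum_i x 0 i * y 0 i.
Proof. by rewrite /dotv mxE; apply: eq_bigr => i _; rewrite mxE. Qed.

Lemma dotvC n (x y : 'rV[R]_n) : dotv x y = dotv y x.
Proof. by rewrite !dotvE; apply: eq_bigr => i _; rewrite mulrC. Qed.

Lemma dotvDl n (x y z : 'rV[R]_n) : dotv (x + y) z = dotv x z + dotv y z.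
Proof. by rewrite /dotv mulmxDl mxE. Qed.

Lemma dotvZl n a (x z : 'rV[R]_n) : dotv (a *: x) z = a * dotv x z.
Proof. by rewrite /dotv -scalemxAl mxE. Qed.

Lemma dotvDr n (x y z : 'rV[R]_n) : dotv z (x + y) = dotv z x + dotv z y.
Proof. by rewrite dotvC dotvDl !(dotvC _ z). Qed.

Lemma dotvZr n a (x z : 'rV[R]_n) : dotv z (a *: x) = a * dotv z x.
Proof. by rewrite dotvC dotvZl dotvC. Qed.

Lemma dotvNl n (x z : 'rV[R]_n) : dotv (- x) z = - dotv x z.
Proof. by rewrite -scaleN1r dotvZl mulN1r. Qed.

Lemma dotvNr n (x z : 'rV[R]_n) : dotv z (- x) = - dotv z x.
Proof. by rewrite dotvC dotvNl dotvC. Qed.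

Lemma dotv0l n (x : 'rV[R]_n) : dotv 0 x = 0.
Proof. by rewrite /dotv mul0mx mxE. Qed.

Lemma dotvv_ge0 n (x : 'rV[R]_n) : 0 <= dotv x x.
Proof. by rewrite dotvE sumr_ge0// => i _; rewrite -expr2 sqr_ge0. Qed.

Lemma dotvv_eq0 n (x : 'rV[R]_n) : dotv x x = 0 -> x = 0.
Proof.
rewrite dotvE => /eqP; rewrite psumr_eq0; last by move=> i _; rewrite -expr2 sqr_ge0.
move=> /allP H; apply/rowP => i; rewrite mxE.
by have := H i; rewrite mem_index_enum => /(_ isT); rewrite mulf_eq0 orbb => /eqP.
Qed.

Lemma enorm_ge0 n (x : 'rV[R]_n) : 0 <= enorm x.
Proof. exact: sqrtr_ge0. Qed.

Lemma sqr_enorm n (x : 'rV[R]_n) : enorm x ^+ 2 = dotv x x.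
Proof. by rewrite /enorm sqr_sqrtr// dotvv_ge0. Qed.

Lemma enorm0 n : enorm (0 : 'rV[R]_n) = 0.
Proof. by rewrite /enorm dotv0l sqrtr0. Qed.

Lemma enorm_eq0 n (x : 'rV[R]_n) : (enorm x == 0) = (x == 0).
Proof.
apply/eqP/eqP => [H|->]; last exact: enorm0.
by apply: dotvv_eq0; rewrite -sqr_enorm H expr0n.
Qed.

Lemma enorm_gt0 n (x : 'rV[R]_n) : (0 < enorm x) = (x != 0).
Proof. by rewrite lt_neqAle enorm_ge0 andbT eq_sym enorm_eq0. Qed.

Lemma enormZ n a (x : 'rV[R]_n) : enorm (a *: x) = `|a| * enorm x.
Proof.
by rewrite /enorm dotvZl dotvZr mulrA -expr2 sqrtrM ?sqr_ge0// sqrtr_sqr.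
Qed.

Lemma enormN n (x : 'rV[R]_n) : enorm (- x) = enorm x.
Proof. by rewrite -scaleN1r enormZ normrN1 mul1r. Qed.

Lemma normalize0 n : normalize (0 : 'rV[R]_n) = 0.
Proof. by rewrite /normalize scaler0. Qed.

Lemma enorm_normalize n (x : 'rV[R]_n) : x != 0 -> enorm (normalize x) = 1.
Proof.
move=> x0; rewrite /normalize enormZ ger0_norm ?invr_ge0 ?enorm_ge0//.
by rewrite mulVf// enorm_eq0.
Qed.

Lemma normalize_id n (x : 'rV[R]_n) : enorm x = 1 -> normalize x = x.
Proof. by rewrite /normalize => ->; rewrite invr1 scale1r. Qed.

Lemma normalizeK n (x : 'rV[R]_n) : enorm x *: normalize x = x.
Proof.
have [->|x0] := eqVneq x 0; first by rewrite normalize0 scaler0.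
by rewrite /normalize scalerA divff ?scale1r// enorm_eq0.
Qed.

Lemma normalize_idem n (x : 'rV[R]_n) : normalize (normalize x) = normalize x.
Proof.
have [->|x0] := eqVneq x 0; first by rewrite !normalize0.
by rewrite normalize_id// enorm_normalize.
Qed.

Lemma normalizeZ n a (x : 'rV[R]_n) : 0 < a -> normalize (a *: x) = normalize x.
Proof.
move=> a0; rewrite /normalize enormZ gtr0_norm// scalerA invfM mulrAC mulVf ?mul1r// gt_eqF//.
Qed.

Lemma dotv_le n (x y : 'rV[R]_n) : dotv x y <= enorm x * enorm y.
Proof.
have [x0|x0] := eqVneq x 0; first by rewrite x0 dotv0l enorm0 mul0r.
have [y0|y0] := eqVneq y 0; first by rewrite y0 dotvC dotv0l enorm0 mulr0.
have := dotvv_ge0 (enorm y *: x - enorm x *: y).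
rewrite !(dotvDl, dotvDr, dotvNl, dotvNr, dotvZl, dotvZr) -!sqr_enorm (dotvC y x).
rewrite -enorm_gt0 in x0; rewrite -enorm_gt0 in y0.
move: x0 y0; set a := enorm x; set b := enorm y; set d := dotv x y => x0 y0 H.
have H2 : 0 <= (a * b) * (a * b - d) by lra.
by rewrite pmulr_rge0 ?mulr_gt0// subr_ge0 in H2.
Qed.

Lemma normr_dotv_le n (x y : 'rV[R]_n) : `|dotv x y| <= enorm x * enorm y.
Proof. by rewrite ler_norml dotv_le andbT lerNl -dotvNl -(enormN x) dotv_le. Qed.

Lemma enormD n (x y : 'rV[R]_n) : enorm (x + y) <= enorm x + enorm y.
Proof.
rewrite -(@ler_pXn2r _ 2)// ?nnegrE ?addr_ge0 ?enorm_ge0//.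
rewrite sqr_enorm dotvDl !dotvDr (dotvC y x) -!sqr_enorm.
have := dotv_le x y; set a := enorm x; set b := enorm y; set d := dotv x y => H.
by rewrite sqrrD; lra.
Qed.

Lemma coord_le_enorm n (x : 'rV[R]_n) i : `|x 0 i| <= enorm x.
Proof.
rewrite -(@ler_pXn2r _ 2)// ?nnegrE ?enorm_ge0// sqr_enorm dotvE.
rewrite (bigD1 i)//= -normrX ger0_norm ?sqr_ge0// expr2 lerDl sumr_ge0// => j _.
by rewrite -expr2 sqr_ge0.
Qed.

Lemma enorm_le_coord n (x : 'rV[R]_n) e : (forall i, `|x 0 i| <= e) -> enorm x <= n%:R * e.
Proof.
move=> H; have [e0|e0] := leP 0 e; last first.
  have -> : x = 0.
    by apply/rowP => i; have := H i; move=> /(le_lt_trans)/(_ e0); rewrite normr_lt0.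
  rewrite enorm0; case: n x H => [|n] x H; first by rewrite mul0r.
  by have := H 0 => /(le_lt_trans)/(_ e0); rewrite normr_lt0.
rewrite -(@ler_pXn2r _ 2)// ?nnegrE ?enorm_ge0 ?mulr_ge0// sqr_enorm dotvE.
apply: (@le_trans _ _ (\sum_(i < n) e ^+ 2)).
  apply: ler_sum => i _; rewrite -expr2 -[X in X <= _]ger0_norm ?sqr_ge0// normrX.
  by rewrite lerXn2r ?nnegrE.
rewrite sumr_const card_ord exprMn -[leLHS]mulr_natl ler_wpM2r ?sqr_ge0// -natrX ler_nat.
by case: (n) => // k; rewrite expnS expn1 leq_pmulr.
Qed.

Lemma continuous_mxP (T : topologicalType) m n (g : T -> 'M[R]_(m, n)) :
  (forall i j, continuous (fun x => g x i j)) -> continuous g.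
Proof.
move=> H x; apply/cvgrPdist_lt => e e0.
have : \forall y \near x, forall i j, `|g x i j - g y i j| < e.
  apply: filter_forall => i; apply: filter_forall => j.
  by have /cvgrPdist_lt/(_ e e0) := H i j x.
apply: filterS => y Hy.
rewrite -[X in X < _]/(`|g x - g y|).
have : ball (g x) e (g y) by apply/mx_ballE; split.
by rewrite mx_norm_ball.
Qed.

Lemma continuous_rsum (T : topologicalType) (I : Type) (r : seq I) (F : I -> T -> R) :
  (forall i, continuous (F i)) -> continuous (fun x => \sum_(i <- r) F i x).
Proof.
move=> H x; elim: r => [|a r IH].
  by rewrite (_ : (fun _ => _) = cst 0); [exact: cvg_cst|apply/funext => y; rewrite big_nil].
rewrite (_ : (fun _ => _) = (F a) \+ (fun x => \sum_(i <- r) F i x)); last first.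
  by apply/funext => y; rewrite big_cons.
by apply: cvgD => //; exact: H.
Qed.

Lemma continuous_mulmxr m n p (A : 'M[R]_(n, p)) :
  continuous (fun B : 'M[R]_(m, n) => B *m A).
Proof.
apply: continuous_mxP => i j; under eq_fun do rewrite mxE.
apply: continuous_rsum => k x.
apply: (@continuousM _ _ (fun B : 'M[R]_(m, n) => B i k) (cst (A k j))); last exact: cst_continuous.
exact: coord_continuous.
Qed.

Lemma continuous_enorm n : continuous (@enorm R n).
Proof.
move=> x; rewrite /enorm; apply: (@continuous_comp _ _ _ (fun x : 'rV[R]_n => dotv x x) Num.sqrt); last exact: sqrt_continuous.
rewrite (_ : (fun _ => _) = fun x : 'rV[R]_n => \sum_i x 0 i * x 0 i); last by apply/funext => ?; rewrite dotvE.
apply: continuous_rsum => i y.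
by apply: (@continuousM _ _ (fun B : 'rV[R]_n => B 0 i) (fun B : 'rV[R]_n => B 0 i)); exact: coord_continuous.
Qed.

Lemma measurable_enorm n : measurable_fun setT (@enorm R n).
Proof. by apply: continuous_mx_measurable; exact: continuous_enorm. Qed.

Lemma measurable_dotv n d (T : measurableType d) (f g : T -> 'rV[R]_n) :
  measurable_fun setT f -> measurable_fun setT g -> measurable_fun setT (fun x => dotv (f x) (g x)).
Proof.
move=> mf mg; under eq_fun do rewrite dotvE.
apply: measurable_sum => i; apply: measurable_funM; exact: measurableT_comp (measurable_coord _ _) _.
Qed.

Lemma measurable_mulmx d (T : measurableType d) m n p (f : T -> 'M[R]_(m, n)) (g : T -> 'M[R]_(n, p)) :
  measurable_fun setT f -> measurable_fun setT g -> measurable_fun setT (fun x => f x *m g x).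
Proof.
move=> mf mg; apply: measurable_mxP => i j; under eq_fun do rewrite mxE.
apply: measurable_sum => k; apply: measurable_funM; exact: measurableT_comp (measurable_coord _ _) _.
Qed.

Lemma measurable_mulmxr m n p (A : 'M[R]_(n, p)) :
  measurable_fun setT (fun B : 'M[R]_(m, n) => B *m A).
Proof. exact: measurable_mulmx. Qed.

Lemma measurable_scalerv n d (T : measurableType d) (f : T -> R) (g : T -> 'rV[R]_n) :
  measurable_fun setT f -> measurable_fun setT g -> measurable_fun setT (fun x => f x *: g x).
Proof.
move=> mf mg; apply: measurable_mxP => i j; under eq_fun do rewrite mxE.
by apply: measurable_funM => //; exact: measurableT_comp (measurable_coord _ _) _.
Qed.

Lemma measurable_addv n d (T : measurableType d) (f g : T -> 'rV[R]_n) :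
  measurable_fun setT f -> measurable_fun setT g -> measurable_fun setT (fun x => f x + g x).
Proof.
move=> mf mg; apply: measurable_mxP => i j; under eq_fun do rewrite mxE.
by apply: measurable_funD => //; exact: measurableT_comp (measurable_coord _ _) _.
Qed.

Lemma measurable_normalize n : measurable_fun setT (@normalize R n).
Proof.
rewrite /normalize; under eq_fun do rewrite -powR_inv1 ?enorm_ge0//.
apply: measurable_scalerv => //.
by apply: (measurableT_comp (measurable_powR (- 1))); exact: measurable_enorm.
Qed.

Lemma continuous_normalize n (x : 'rV[R]_n) : x != 0 -> {for x, continuous (@normalize R n)}.
Proof.
move=> x0; apply: (@continuousZ _ _ _ (fun y : 'rV[R]_n => (enorm y)^-1) id); last exact: cvg_id.
by apply: continuousV; [rewrite enorm_eq0|exact: continuous_enorm].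
Qed.

Definition orthogmx n (T : 'M[R]_n) := T *m T^T = 1%:M.

Definition isframe m n (U : 'M[R]_(m, n)) := U *m U^T = 1%:M.

Lemma isframe1 n : isframe (1%:M : 'M[R]_n).
Proof. by rewrite /isframe trmx1 mulmx1. Qed.

Lemma isframeM m n p (U : 'M[R]_(m, n)) (V : 'M[R]_(n, p)) :
  isframe U -> isframe V -> isframe (U *m V).
Proof. by rewrite /isframe trmx_mul !mulmxA => UU VV; rewrite -(mulmxA U) VV mulmx1. Qed.

Lemma dotv_frame m n (U : 'M[R]_(m, n)) x y : isframe U -> dotv (x *m U) (y *m U) = dotv x y.
Proof. by rewrite /dotv trmx_mul mulmxA -(mulmxA x) => ->; rewrite mulmx1. Qed.

Lemma enorm_frame m n (U : 'M[R]_(m, n)) x : isframe U -> enorm (x *m U) = enorm x.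
Proof. by move=> HU; rewrite /enorm dotv_frame. Qed.

Lemma normalize_frame m n (U : 'M[R]_(m, n)) x : isframe U -> normalize (x *m U) = normalize x *m U.
Proof. by move=> HU; rewrite /normalize enorm_frame// scalemxAl. Qed.

Lemma enorm_rcons0 n x (t : 'rV[R]_n) : enorm (rcons0 x t) ^+ 2 = x ^+ 2 + enorm t ^+ 2.
Proof.
rewrite !sqr_enorm !dotvE big_ord_recl mxE unlift_none -expr2; congr (_ + _).
by apply: eq_bigr => i _; rewrite mxE liftK.
Qed.

Lemma measurable_unitball n : measurable (unitball R n).
Proof.
rewrite -[X in measurable X]setTI (_ : unitball R n = @enorm R n @^-1` `]-oo, 1]).
  exact: measurable_enorm.
by apply/seteqP; split => x /=; rewrite in_itv.
Qed.

Lemma mx_norm_le m n (x : 'M[R]_(m, n)) e : 0 <= e ->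
  (forall i j, `|x i j| <= e) -> `|x| <= e.
Proof.
move=> e0 H; rewrite -[X in X <= _]/(mx_norm x) mx_normrE.
by apply: bigmax_le => // -[i j] _; exact: H.
Qed.

Lemma coord_le_mx_norm m n (x : 'M[R]_(m, n)) i j : `|x i j| <= `|x|.
Proof.
rewrite -[X in _ <= X]/(mx_norm x) mx_normrE.
exact: (@le_bigmax _ _ _ _ (fun ij : 'I_m * 'I_n => `|x ij.1 ij.2|) (i, j)).
Qed.

Lemma compact_unitsphere n : compact (unitsphere R n).
Proof.
apply: bounded_closed_compact.
  exists n%:R; split => // M nM x /= x1; apply: le_trans (ltW nM).
  apply: mx_norm_le => // i j; rewrite ord1 (le_trans (coord_le_enorm _ _))// x1.
  by case: (n) j => [[]//|k _]; rewrite ler1n.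
rewrite (_ : unitsphere R n = @enorm R n @^-1` [set 1]); last by apply/seteqP; split.
by apply: closed_comp; [move=> x _; exact: continuous_enorm|exact: closed_eq].
Qed.

End euclid.

(** * Invariance of Lebesgue measure *)

Section affine1.
Context {R : realType}.
Local Open Scope ereal_scope.
Local Notation leb := (@lebesgue_measure R).

Let affine (c a x : R) : R := (c * x + a)%R.
Let measurable_affine c a : measurable_fun [set: measurableTypeR R] (affine c a : _ -> measurableTypeR R).
Proof. by apply: measurable_funD => //; exact: measurable_funM. Qed.

(** The right-hand side is a measure in [A], so by uniqueness of Lebesgue measure half-open
    intervals suffice. *)
Lemma lebesgue_affine (c a : R) (c0 : (0 < c)%R) (A : set (measurableTypeR R)) : measurable A ->
  leb A = c%:E * leb ((fun x => c * x + a)%R @^-1` A).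
Proof.
move=> mA; pose k : {nonneg R} := NngNum (ltW c0).
rewrite (@lebesgue_measure_unique _ (mscale k (pushm leb (measurable_affine c a))))//.
move=> _ [[x y]] _ <-; rewrite -[RHS]/(c%:E * leb (affine c a @^-1` `]x, y]%classic)).
rewrite (_ : affine c a @^-1` _ = `](x - a) / c, (y - a) / c]%classic)%R; last first.
  by apply/seteqP; split => z; rewrite /affine /= !in_itv/= ltr_pdivrMr// ler_pdivlMr// ltrBlDr lerBrDr mulrC.
rewrite !lebesgue_measure_itv/= !lte_fin ltr_pM2r ?invr_gt0// ltrD2r.
case: ifPn => _; last by rewrite mule0.
by rewrite -!EFinD -EFinM -mulrBl mulrC opprB addrA subrK divfK ?gt_eqF.
Qed.

Lemma integral_affine (c a : R) (F : R -> \bar R) : (0 < c)%R -> measurable_fun setT F ->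
  (forall x, 0 <= F x) -> \int[leb]_x F x = c%:E * \int[leb]_x F (c * x + a)%R.
Proof.
move=> c0 mF F0; pose k : {nonneg R} := NngNum (ltW c0).
rewrite (_ : \int[leb]_x F x = \int[mscale k (pushm leb (measurable_affine c a))]_x F x); last first.
  by apply: eq_measure_integral => A mA _; exact: lebesgue_affine.
by rewrite ge0_integral_mscale//= ge0_integral_pushforward.
Qed.

End affine1.

Lemma eq_indic {R : pzRingType} T T' (A : set T) (B : set T') x y :
  (A x <-> B y) -> \1_A x = \1_B y :> R.
Proof.
move=> AB; rewrite !indicE; have [Ax|nAx] := pselect (A x).
  by rewrite !mem_set//; exact/AB.
by rewrite !memNset// => /AB.
Qed.

Section invariance.
Context {R : realType}.
Local Open Scope ereal_scope.

Lemma measurable_rcons0_r n x : measurable_fun setT (@rcons0 R n x).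
Proof. exact: (measurable_fun_pair2 _ (@measurable_rcons0 R n)). Qed.

Lemma ge0_integralZlT d (T : measurableType d) (mu : {measure set T -> \bar R}) (f : T -> \bar R) k :
  measurable_fun setT f -> (forall x, 0 <= f x) -> 0 <= k ->
  \int[mu]_x (k * f x) = k * \int[mu]_x f x.
Proof. by move=> mf f0 k0; rewrite ge0_integralZl. Qed.

Lemma ge0_integralZrT d (T : measurableType d) (mu : {measure set T -> \bar R}) (f : T -> \bar R) k :
  measurable_fun setT f -> (forall x, 0 <= f x) -> 0 <= k ->
  \int[mu]_x (f x * k) = \int[mu]_x f x * k.
Proof. by move=> mf f0 k0; rewrite ge0_integralZr. Qed.

Lemma tonelli d1 d2 (T1 : measurableType d1) (T2 : measurableType d2)
  (m1 : {sigma_finite_measure set T1 -> \bar R}) (m2 : {sigma_finite_measure set T2 -> \bar R})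
  (h : T1 -> T2 -> \bar R) :
  measurable_fun setT (fun p : T1 * T2 => h p.1 p.2) -> (forall x y, 0 <= h x y) ->
  \int[m1]_x \int[m2]_y h x y = \int[m2]_y \int[m1]_x h x y.
Proof.
move=> mh h0; apply: (@fubini_tonelli _ _ _ _ R m1 m2 (fun p => h p.1 p.2)) => //.
Qed.

Lemma measurable_vol_inner n (F : 'rV[R]_n.+1 -> \bar R) :
  measurable_fun setT F -> (forall x, 0 <= F x) ->
  measurable_fun setT (fun x : measurableTypeR R => \int[vol]_t F (rcons0 x t)).
Proof.
move=> mF F0.
apply: (@measurable_fun_fubini_tonelli_F _ _ (measurableTypeR R) _ R vol
    (fun p => F (rcons0 p.1 p.2))) => //.
by apply: (measurableT_comp mF); exact: measurable_rcons0.
Qed.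

Lemma rcons0_affine n (c x : R) (t : 'rV[R]_n) (a : 'rV[R]_n.+1) :
  rcons0 (c * x + a 0 0)%R (c *: t + tail0 a)%R = (c *: rcons0 x t + a)%R.
Proof. by apply/rowP => j; rewrite !mxE; case: unliftP => [k ->|->]; rewrite ?mxE. Qed.

Lemma integral_vol_affine n (c : R) (a : 'rV[R]_n) (F : 'rV[R]_n -> \bar R) :
  (0 < c)%R -> measurable_fun setT F -> (forall x, 0 <= F x) ->
  \int[vol]_x F x = (c ^+ n)%:E * \int[vol]_x F (c *: x + a)%R.
Proof.
elim: n a F => [|n IH] a F c0 mF F0.
  rewrite expr0 mul1e; apply: eq_integral => x _; congr F.
  by apply/rowP => -[].
have maff : measurable_fun setT (fun x : 'rV[R]_n.+1 => c *: x + a)%R.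
  by apply: measurable_addv => //; exact: measurable_scalerv.
have mFa : measurable_fun setT (fun x : 'rV[R]_n.+1 => F (c *: x + a)%R) by exact: (measurableT_comp mF maff).
have E1 := integral_volS mF F0.
have E2 := integral_volS mFa (fun x => F0 _).
have mI : measurable_fun setT (fun x : measurableTypeR R => \int[vol]_t F (rcons0 x t)).
  exact: measurable_vol_inner.
have mJ : measurable_fun setT (fun x : measurableTypeR R => \int[vol]_t F (c *: rcons0 x t + a)%R).
  exact: (measurable_vol_inner mFa (fun x => F0 _)).
have I0 : forall x : R, 0 <= \int[vol]_t F (rcons0 x t).
  by move=> x; apply: integral_ge0 => t _; exact: F0.
have J0 : forall x : R, setT x -> 0 <= \int[vol]_t F (c *: rcons0 x t + a)%R.
  by move=> x _; apply: integral_ge0 => t _; exact: F0.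
have E3 := integral_affine (a 0 0)%R c0 mI I0.
have cn0 : 0 <= (c ^+ n)%:E by rewrite lee_fin exprn_ge0// ltW.
have E4 := ge0_integralZlT (@lebesgue_measure R) mJ (fun x => J0 x Logic.I) cn0.
rewrite E1 E2 E3 exprS EFinM -muleA; congr (_ * _); rewrite -[RHS]E4.
apply: eq_integral => x _.
have E5 := IH (tail0 a) _ c0 (measurableT_comp mF (measurable_rcons0_r (c * x + a 0 0)%R)) (fun t => F0 _).
rewrite [LHS]E5; congr (_ * _); apply: eq_integral => t _; congr F.
exact: rcons0_affine.
Qed.

Lemma integral_vol_shift n (a : 'rV[R]_n) (F : 'rV[R]_n -> \bar R) :
  measurable_fun setT F -> (forall x, 0 <= F x) ->
  \int[vol]_x F (x + a)%R = \int[vol]_x F x.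
Proof.
move=> mF F0; rewrite (@integral_vol_affine n 1 a F)// expr1n mul1e.
by apply: eq_integral => x _; rewrite scale1r.
Qed.

Lemma integral_vol_scale n (c : R) (F : 'rV[R]_n -> \bar R) :
  (0 < c)%R -> measurable_fun setT F -> (forall x, 0 <= F x) ->
  \int[vol]_x F x = (c ^+ n)%:E * \int[vol]_x F (c *: x)%R.
Proof.
move=> c0 mF F0; rewrite (@integral_vol_affine n c 0 F)//; congr (_ * _).
by apply: eq_integral => x _; rewrite addr0.
Qed.

Lemma measureE d (T : measurableType d) (mu : {measure set T -> \bar R}) (A : set T) :
  measurable A -> mu A = \int[mu]_x (\1_A x)%:E.
Proof. by move=> mA; rewrite integral_indic// setIT. Qed.

Lemma measurable_indicE d (T : measurableType d) (A : set T) :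
  measurable A -> measurable_fun setT (fun x => (\1_A x : R)%:E).
Proof. by move=> mA; apply/measurable_EFinP/measurable_indic. Qed.

Lemma measurable_box n (r : R) : measurable [set x : 'rV[R]_n | forall i, (`|x 0 i| <= r)%R].
Proof.
rewrite (_ : [set x | _] = \bigcap_(i in [set: 'I_n]) ((fun x : 'rV[R]_n => `|x 0 i|)%R @^-1` `]-oo, r])).
  apply: fin_bigcap_measurable => // i _; rewrite -[X in measurable X]setTI.
  by apply: measurableT_comp => //; exact: measurable_coord.
apply/seteqP; split => [x H i _|x H i] /=; first by rewrite in_itv/=.
by have := H i Logic.I; rewrite /= in_itv.
Qed.

Lemma vol_box n (r : R) : (0 <= r)%R ->
  vol [set x : 'rV[R]_n | forall i, (`|x 0 i| <= r)%R] = ((2 * r) ^+ n)%:E.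
Proof.
move=> r0; elim: n => [|n IH].
  rewrite /vol/= indicE mem_set ?expr0//= => -[]//.
have mB k := @measurable_box k r.
have H0 k (x : 'rV[R]_k) : 0 <= (\1_[set x : 'rV[R]_k | forall i, (`|x 0 i| <= r)%R] x : R)%:E by rewrite lee_fin.
rewrite (measureE _ (mB _)) (integral_volS (measurable_indicE (mB _)) (H0 _)).
have H1 x : \int[vol]_t (\1_[set x : 'rV[R]_n.+1 | forall i, (`|x 0 i| <= r)%R] (rcons0 x t) : R)%:E =
    ((2 * r) ^+ n)%:E * (\1_(`[(- r)%R, r]%classic) x)%:E.
  rewrite -IH (measureE _ (mB _)) muleC -(ge0_integralZlT _ (measurable_indicE (mB n)))//.
  apply: eq_integral => t _; rewrite -EFinM !indicE -natrM mulnb; congr (_%:R%:E).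
  congr nat_of_bool; apply/idP/andP => [/set_mem/= H|[/set_mem/= H2 /set_mem/= H]].
    split; apply/mem_set => /=; first by have := H 0%R; rewrite rcons0_0 in_itv/= ler_norml.
    by move=> i; have := H (lift ord0 i); rewrite rcons0_lift.
  apply/mem_set => i /=; rewrite mxE; case: unliftP => [k _|_]; first exact: H.
  by move: H2; rewrite in_itv/= ler_norml.
under eq_integral do rewrite H1.
have mI : measurable (`[(- r)%R, r]%classic : set (measurableTypeR R)) by exact: measurable_itv.
have r0' : 0 <= ((2 * r) ^+ n)%:E by rewrite lee_fin exprn_ge0// mulr_ge0.
have I0 (x : measurableTypeR R) : 0 <= (\1_(`[(- r)%R, r]%classic) x : R)%:E by rewrite lee_fin.
rewrite [LHS](ge0_integralZlT (@lebesgue_measure R) (measurable_indicE mI) I0 r0').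
rewrite -(measureE (@lebesgue_measure R) mI) exprSr EFinM; congr (_ * _).
rewrite [LHS](lebesgue_measure_itv `[(- r)%R, r])/= lte_fin.
case: ifPn => [_|]; first by rewrite -EFinD opprK mulr2n mulrDl mul1r.
by rewrite -leNgt => ?; congr EFin; lra.
Qed.

Lemma vol_unitball_lty n : vol (unitball R n) < +oo.
Proof.
apply: (@le_lt_trans _ _ (vol [set x : 'rV[R]_n | forall i, (`|x 0 i| <= 1)%R])); last first.
  by rewrite vol_box// ltry.
apply: le_measure; rewrite ?inE; [exact: measurable_unitball|exact: measurable_box|].
by move=> x /= x1 i; exact: le_trans (coord_le_enorm _ _) x1.
Qed.

Lemma vol_unitball_gt0 n : 0 < vol (unitball R n).
Proof.
pose r : R := (n.+1%:R^-1)%R.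
have r0 : (0 < r)%R by rewrite invr_gt0.
apply: (@lt_le_trans _ _ (vol [set x : 'rV[R]_n | forall i, (`|x 0 i| <= r)%R])).
  by rewrite vol_box ?ltW// lte_fin exprn_gt0// mulr_gt0.
apply: le_measure; rewrite ?inE; [exact: measurable_box|exact: measurable_unitball|].
move=> x /= /enorm_le_coord /le_trans; apply.
by rewrite ler_pdivrMr// mul1r ler_nat.
Qed.

(** Several identities below are proved after multiplication by the volume of the unit ball, which
    is cancelled here. *)
Lemma mulvar_prod (a b : \bar R) : 0 < b -> b < +oo -> forall c, a * b = c * b -> a = c.
Proof.
move=> b0 boo c E; have bf : b \is a fin_num by rewrite ge0_fin_numE// ltW.
have : a * b * (fine b)^-1%:E = c * b * (fine b)^-1%:E by rewrite E.
by rewrite -!muleA -[b](fineK bf) -EFinM divff ?mule1// gt_eqF// fine_gt0// b0 boo.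
Qed.

(* Both sides are computed from the integral of G(y)F(xT+y) over (x,y), using
   only translation invariance; G is the indicator of the ball. *)
Lemma integral_vol_orthogmx n (T : 'M[R]_n) (F : 'rV[R]_n -> \bar R) : orthogmx T ->
  measurable_fun setT F -> (forall x, 0 <= F x) ->
  \int[vol]_x F (x *m T) = \int[vol]_x F x.
Proof.
move=> oT mF F0; pose G (x : 'rV[R]_n) := (\1_(unitball R n) x : R)%:E.
have mG : measurable_fun setT G by apply: measurable_indicE; exact: measurable_unitball.
have G0 x : 0 <= G x by rewrite lee_fin.
have GT x : G (- (x *m T))%R = G x by congr EFin; apply: eq_indic; rewrite /unitball /= enormN enorm_frame.
apply: (mulvar_prod (vol_unitball_gt0 n) (vol_unitball_lty n)).
rewrite !(measureE _ (@measurable_unitball R n)) -/G.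
have mT := @measurable_mulmxr R 1 n n T.
have mFT : measurable_fun setT (fun x : 'rV[R]_n => F (x *m T)) by exact: (measurableT_comp mF mT).
have IF0 : 0 <= \int[vol]_x F (x *m T) by apply: integral_ge0 => x _; exact: F0.
have IG0 : 0 <= \int[vol]_x G x by apply: integral_ge0 => x _; exact: G0.
transitivity (\int[vol]_y \int[vol]_x (G y * F (x *m T + y)%R)).
  rewrite muleC -(ge0_integralZrT _ mG G0 IF0).
  apply: eq_integral => y _.
  rewrite -[LHS](ge0_integralZlT vol mFT (fun x => F0 _) (G0 y)).
  rewrite -(integral_vol_shift (y *m T^T)%R (F := fun x => G y * F (x *m T)))//; last 2 first.
  - exact: measurable_funeM.
  - by move=> x; exact: mule_ge0.
  by apply: eq_integral => x _; rewrite mulmxDl -(mulmxA y) (mulmx1C oT) mulmx1.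
have mxy : measurable_fun setT (fun p : 'rV[R]_n * 'rV[R]_n => p.1 *m T + p.2)%R.
  by apply: measurable_addv => //; exact: (measurableT_comp mT).
pose H (x y : 'rV[R]_n) := G y * F (x *m T + y)%R.
have mH : measurable_fun setT (fun p : 'rV[R]_n * 'rV[R]_n => H p.1 p.2).
  by apply: emeasurable_funM; [exact: measurableT_comp|exact: (measurableT_comp mF)].
rewrite -[LHS](@tonelli _ _ _ _ vol vol H mH); last by move=> x y; exact: mule_ge0.
transitivity (\int[vol]_x \int[vol]_y (G (y - x *m T)%R * F y)).
  apply: eq_integral => x _.
  have mGx : measurable_fun setT (fun y : 'rV[R]_n => G (y - x *m T)%R * F y).
    apply: (emeasurable_funM _ mF); apply: (measurableT_comp mG).
    exact: (measurable_addv (@measurable_id _ _ _) (@measurable_cst _ _ _ _ _ _)).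
  rewrite -[RHS](integral_vol_shift (x *m T)%R mGx (fun y => mule_ge0 (G0 _) (F0 y))).
  by apply: eq_integral => y _; rewrite addrK addrC.
have mxy2 : measurable_fun setT (fun p : 'rV[R]_n * 'rV[R]_n => p.2 - p.1 *m T)%R.
  apply: measurable_addv => //; under eq_fun do rewrite -mulmxN.
  exact: (measurableT_comp (@measurable_mulmxr R 1 n n (- T)%R)).
pose K (x y : 'rV[R]_n) := G (y - x *m T)%R * F y.
have mK : measurable_fun setT (fun p : 'rV[R]_n * 'rV[R]_n => K p.1 p.2).
  by apply: emeasurable_funM; [exact: (measurableT_comp mG)|exact: measurableT_comp].
rewrite [LHS](@tonelli _ _ _ _ vol vol K mK); last by move=> x y; exact: mule_ge0.
rewrite -(ge0_integralZrT _ mF F0 IG0)//.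
apply: eq_integral => y _.
rewrite -[RHS](ge0_integralZlT vol mG G0 (F0 y)).
have mFG : measurable_fun setT (fun x : 'rV[R]_n => F y * G x) by exact: measurable_funeM.
rewrite -[RHS](integral_vol_shift (- y *m T^T)%R mFG (fun x => mule_ge0 (F0 y) (G0 x))).
apply: eq_integral => x _; rewrite /K muleC; congr (_ * _); rewrite -(GT (x + _)%R); congr G.
by rewrite mulmxDl -mulmxA (mulmx1C oT) mulmx1 opprD opprK addrC.
Qed.

End invariance.

(** * Polar coordinates *)

Section polar.
Context {R : realType}.
Local Open Scope ereal_scope.

Lemma vol_unitball_fin n : vol (unitball R n) \is a fin_num.
Proof. by rewrite ge0_fin_numE// vol_unitball_lty. Qed.

Lemma fine_vol_unitball_gt0 n : (0 < fine (vol (unitball R n)))%R.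
Proof. by rewrite fine_gt0// vol_unitball_gt0 vol_unitball_lty. Qed.

Definition ballinv n : {nonneg R} := NngNum (ltW (eqbRL (invr_gt0 _) (fine_vol_unitball_gt0 n))).

(** The normalized cone measure of the sphere, kept as a measure on all of R^n so that no separate
    type of unit vectors is needed. It matches the normalization of [sphint]. *)
Definition sph n := mscale (ballinv n)
  (pushm (mrestr vol (@measurable_unitball R n)) (@measurable_normalize R n)).

Arguments sph n _ : clear implicits.
HB.instance Definition _ n := Measure.on (sph n).

Lemma sphE n A : sph n A = (fine (vol (unitball R n)))^-1%:E * vol (@normalize R n @^-1` A `&` unitball R n).
Proof. by []. Qed.

Let sph_setT n : sph n setT = 1.
Proof.
rewrite sphE preimage_setT setTI -[X in _ * X](fineK (vol_unitball_fin n)) -EFinM mulVf//.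
by rewrite gt_eqF// fine_vol_unitball_gt0.
Qed.
HB.instance Definition _ n := Measure_isProbability.Build _ _ _ (sph n) (sph_setT n).

Definition radii n := pushm vol (@measurable_enorm R n : measurable_fun setT (@enorm R n : _ -> measurableTypeR R)).
Arguments radii n _ : clear implicits.
HB.instance Definition _ n := Measure.on (radii n).

(** Dilation by 2 fixes the origin and multiplies its finite volume by 2^(n+1) > 1. *)
Lemma vol0 n : vol [set (0 : 'rV[R]_n.+1)%R] = 0.
Proof.
have m0 : measurable [set (0 : 'rV[R]_n.+1)%R] by apply: compact_mx_measurable; exact: compact_set1.
have foo : vol [set (0 : 'rV[R]_n.+1)%R] < +oo.
  apply: le_lt_trans (vol_unitball_lty n.+1); apply: le_measure; rewrite ?inE//.
    exact: measurable_unitball.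
  by move=> x ->; rewrite /unitball /= enorm0.
have c0 : (0 < 2 :> R)%R by [].
have ge0 x : 0 <= (\1_[set (0 : 'rV[R]_n.+1)%R] x : R)%:E by rewrite lee_fin.
have := integral_vol_scale c0 (measurable_indicE m0) ge0.
have E (x : 'rV[R]_n.+1) : (\1_[set (0 : 'rV[R]_n.+1)%R] (2%:R *: x)%R : R)%:E = (\1_[set (0 : 'rV[R]_n.+1)%R] x : R)%:E.
  by congr EFin; apply: eq_indic => /=; split => [/eqP|->]; rewrite ?scaler0// scaler_eq0 pnatr_eq0/= => /eqP.
under [X in _ = _ * X]eq_integral do rewrite E.
rewrite -(measureE _ m0) -[X in X = _]mul1e => H; apply/eqP/negPn/negP => v0.
have vp : 0 < vol [set (0 : 'rV[R]_n.+1)%R] by rewrite lt_neqAle eq_sym v0 measure_ge0.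
have [] := mulvar_prod vp foo H.
by apply/eqP; rewrite lt_eqF// exprn_egt1// ltr1n.
Qed.

Definition lrays : set (set (measurableTypeR R)) := [set A | exists r : R, A = `]-oo, r]%classic].

Lemma lrays_measurableE : @measurable _ (measurableTypeR R) = <<s lrays >>.
Proof.
rewrite -[LHS]/((@ocitv R).-sigma.-measurable) RGenOInfty.measurableE.
apply/seteqP; split; apply: smallest_sub; try exact: smallest_sigma_algebra.
- move=> _ [r ->]; rewrite -[X in <<s _ >> X]setCK.
  by apply: sigma_algebraC; apply: sub_sigma_algebra; exists r; rewrite setCitvr.
- move=> _ [r ->]; rewrite -setCitvr; apply: measurableC.
  by apply: sub_sigma_algebra; exists r.
Qed.

(** Left rays are stable under intersection and generate the Borel sets; [radii] is infinite on the
    line but finite on each of them. *)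
Lemma lrays_unique (m1 m2 : {measure set (measurableTypeR R) -> \bar R}) :
  (forall r, m1 `]-oo, r]%classic = m2 `]-oo, r]%classic) ->
  (forall r, m1 `]-oo, r]%classic < +oo) -> forall A, measurable A -> m1 A = m2 A.
Proof.
move=> m12 m1oo; apply: (measure_unique lrays (fun k => `]-oo, k%:R]%classic)).
- exact: lrays_measurableE.
- move=> _ _ [x ->] [y ->]; exists (Num.min x y); apply/seteqP; split => z /=; rewrite !in_itv/= le_min.
    by move=> [-> ->].
  by move=> /andP[].
- by move=> k; exists k%:R.
- apply/seteqP; split => // x _; exists (Num.truncn `|x|).+1 => //=.
  by rewrite in_itv/= (le_trans (ler_norm x))// ltW// truncnS_gt.
- by move=> _ [r ->].
- by move=> k.
Qed.

(** A set of directions spans a cone invariant under dilation, so only the ball is rescaled. *)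
Lemma vol_ball_cone n (r : R) (A : set 'rV[R]_n) : (0 < r)%R -> measurable A ->
  vol ([set x : 'rV[R]_n | (enorm x <= r)%R] `&` @normalize R n @^-1` A) =
  (r ^+ n)%:E * vol (@normalize R n @^-1` A `&` unitball R n).
Proof.
move=> r0 mA.
have mN : measurable (@normalize R n @^-1` A).
  by rewrite -[X in measurable X]setTI; apply: measurable_normalize.
have mr s : measurable [set x : 'rV[R]_n | (enorm x <= s)%R].
  rewrite -[X in measurable X]setTI (_ : [set x | _] = @enorm R n @^-1` `]-oo, s]%classic).
    exact: measurable_enorm.
  by apply/seteqP; split => x /=; rewrite in_itv.
have mA1 := measurableI _ _ (mr r) mN.
have mA2 := measurableI _ _ mN (mr 1%R).
rewrite (measureE vol mA1) (measureE vol mA2).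
rewrite (integral_vol_scale r0 (measurable_indicE mA1)); last by move=> x; rewrite lee_fin.
congr (_ * _); apply: eq_integral => x _; congr EFin; apply: eq_indic => /=.
rewrite normalizeZ// enormZ gtr0_norm// -[X in (_ <= X)%R]mulr1 ler_pM2l//.
by split => -[].
Qed.

Lemma radii_ball n (r : R) : (0 <= r)%R ->
  radii n.+1 `]-oo, r]%classic = (r ^+ n.+1)%:E * vol (unitball R n.+1).
Proof.
move=> r0; rewrite /radii /pushm /pushforward/=.
rewrite (_ : _ @^-1` _ = [set x : 'rV[R]_n.+1 | (enorm x <= r)%R]); last by apply/seteqP; split => x /=; rewrite in_itv.
move: r0; rewrite le_eqVlt => /predU1P[<-|r0].
  rewrite expr0n/= mul0e (_ : [set _ | _] = [set 0%R]) ?vol0//.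
  apply/seteqP; split => x /=; last by move=> ->; rewrite enorm0.
  by move=> H; apply/eqP; rewrite -enorm_eq0 eq_le H enorm_ge0.
have := @vol_ball_cone n.+1 r setT r0 measurableT.
by rewrite preimage_setT setIT setTI.
Qed.

Lemma radii_neg n (r : R) : (r < 0)%R -> radii n `]-oo, r]%classic = 0.
Proof.
move=> r0; rewrite /radii /pushm /pushforward/= (_ : _ @^-1` _ = set0) ?measure0//.
apply/seteqP; split => x //=; rewrite in_itv/= => H.
by have := le_lt_trans H r0; rewrite ltNge enorm_ge0.
Qed.

Lemma radii_lty n (r : R) : radii n.+1 `]-oo, r]%classic < +oo.
Proof.
have [r0|r0] := leP 0%R r; last by rewrite radii_neg.
by rewrite radii_ball// lte_mul_pinfty ?lee_fin ?exprn_ge0// vol_unitball_lty.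
Qed.

Let radii_sigma_finite n : sigma_finite setT (radii n.+1).
Proof.
exists (fun k => `]-oo, k%:R]%classic).
  apply/esym/seteqP; split => // x _; exists (Num.truncn `|x|).+1 => //=.
  by rewrite in_itv/= (le_trans (ler_norm x))// ltW// truncnS_gt.
by move=> k; split; [exact: measurable_itv|exact: radii_lty].
Qed.
HB.instance Definition _ n := Measure_isSigmaFinite.Build _ _ _ (radii n.+1) (@radii_sigma_finite n).

Let measurable_polar n : measurable_fun setT (fun x : 'rV[R]_n => (enorm x : measurableTypeR R, normalize x)).
Proof. by apply: measurable_fun_pair; [exact: measurable_enorm|exact: measurable_normalize]. Qed.

(** Norm and direction are independent under volume. For fixed [B] both sides are measures in [A],
    and on left rays they agree by the homogeneity of cones. *)
Lemma polar_law n (X : set (measurableTypeR R * 'rV[R]_n.+1)) : measurable X ->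
  (radii n.+1 \x sph n.+1) X = pushm vol (@measurable_polar n.+1) X.
Proof.
apply: product_measure_unique => A B mA mB.
have mN : measurable (@normalize R n.+1 @^-1` B).
  by rewrite -[X in measurable X]setTI; apply: measurable_normalize.
pose m1 := pushm (mrestr vol mN) (@measurable_enorm R n.+1 : measurable_fun setT (@enorm R n.+1 : _ -> measurableTypeR R)).
have sB0 : (0 <= fine (sph n.+1 B))%R by rewrite fine_ge0.
pose m2 := mscale (NngNum sB0) (radii n.+1).
transitivity (m1 A); first by [].
have fB : (fine (sph n.+1 B))%:E = sph n.+1 B by rewrite fineK//; exact: fin_num_measure.
have lr r : m1 `]-oo, r]%classic = m2 `]-oo, r]%classic.
  rewrite -[RHS]/((fine (sph n.+1 B))%:E * radii n.+1 `]-oo, r]%classic).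
  rewrite fB.
  rewrite -[LHS]/(vol (@enorm R n.+1 @^-1` `]-oo, r]%classic `&` normalize @^-1` B)).
  rewrite (_ : @enorm R n.+1 @^-1` _ = [set x : 'rV[R]_n.+1 | (enorm x <= r)%R]); last first.
    by apply/seteqP; split => x /=; rewrite in_itv.
  have [r0|r0|r0] := ltrgtP 0%R r.
  - rewrite vol_ball_cone// radii_ball ?ltW// sphE [RHS]muleC -[RHS]muleA; congr (_ * _).
    rewrite muleA -[X in _ = (X * _) * _](fineK (vol_unitball_fin n.+1)) -EFinM.
    by rewrite divff ?mul1e// gt_eqF// fine_vol_unitball_gt0.
  - rewrite radii_neg// mule0 (_ : [set x | _] = set0) ?set0I ?measure0//.
    apply/seteqP; split => x //= H.
    by have := le_lt_trans H r0; rewrite ltNge enorm_ge0.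
  - rewrite -r0 radii_ball// expr0n/= mul0e mule0 (_ : [set x | _] = [set 0%R]); last first.
      apply/seteqP; split => x /=; last by move=> ->; rewrite enorm0.
      by move=> H; apply/eqP; rewrite -enorm_eq0 eq_le H enorm_ge0.
    apply/eqP; rewrite -measure_le0 -(vol0 n).
    have m0 : measurable [set (0 : 'rV[R]_n.+1)%R] by apply: compact_mx_measurable; exact: compact_set1.
    by apply: le_measure; rewrite ?inE//; exact: measurableI.
transitivity (m2 A).
  apply: (@lrays_unique (pushm (mrestr vol mN) _) (mscale (NngNum sB0) (radii n.+1))) => // r.
  rewrite -[X in X < _]/(m1 _) lr -[X in X < _]/((fine (sph n.+1 B))%:E * radii n.+1 `]-oo, r]%classic).
  by rewrite lte_mul_pinfty ?lee_fin//; exact: radii_lty.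
rewrite -[LHS]/((fine (sph n.+1 B))%:E * radii n.+1 A).
by rewrite fB muleC.
Qed.

Lemma integral_polar n (F : R -> 'rV[R]_n.+1 -> \bar R) :
  measurable_fun setT (fun p : measurableTypeR R * 'rV[R]_n.+1 => F p.1 p.2) ->
  (forall r x, 0 <= F r x) ->
  \int[vol]_x F (enorm x) (normalize x) = \int[radii n.+1]_r \int[sph n.+1]_x F r x.
Proof.
move=> mF F0.
rewrite -(@fubini_tonelli1 _ _ _ _ _ _ _ _ mF)/=; last by move=> p; exact: F0.
transitivity (\int[pushm vol (@measurable_polar n.+1)]_z F z.1 z.2); last first.
  by apply: eq_measure_integral => A mA _; exact/esym/polar_law.
by rewrite ge0_integral_pushforward// => z _; exact: F0.
Qed.

Lemma integral_polar_prod n (l : R -> \bar R) (f : 'rV[R]_n.+1 -> \bar R) :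
  measurable_fun setT (l : measurableTypeR R -> _) -> measurable_fun setT f ->
  (forall r, 0 <= l r) -> (forall x, 0 <= f x) ->
  \int[vol]_x (l (enorm x) * f (normalize x)) =
  (\int[radii n.+1]_r l r) * \int[sph n.+1]_x f x.
Proof.
move=> ml mf l0 f0.
have mF : measurable_fun setT (fun p : measurableTypeR R * 'rV[R]_n.+1 => l p.1 * f p.2).
  by apply: emeasurable_funM; exact: measurableT_comp.
rewrite (integral_polar (F := fun r x => l r * f x) mF); last by move=> r x; exact: mule_ge0.
have If0 : 0 <= \int[sph n.+1]_x f x by apply: integral_ge0 => x _; exact: f0.
rewrite -[RHS](ge0_integralZrT (radii n.+1) ml l0 If0).
by apply: eq_integral => r _; exact: (ge0_integralZlT (sph n.+1) mf f0 (l0 r)).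
Qed.

Lemma integral_unitball n (f : 'rV[R]_n.+1 -> \bar R) :
  measurable_fun setT f -> (forall x, 0 <= f x) ->
  \int[vol]_x ((\1_(unitball R n.+1) x)%:E * f (normalize x)) =
  vol (unitball R n.+1) * \int[sph n.+1]_x f x.
Proof.
move=> mf f0; pose l (r : R) : \bar R := (\1_(`]-oo, 1]%classic) r)%:E.
have ml : measurable_fun setT (l : measurableTypeR R -> _) by apply: measurable_indicE; exact: measurable_itv.
have l0 r : 0 <= l r by rewrite lee_fin.
rewrite -[X in X * _]mul1e -(expr1n _ n.+1) -radii_ball// (measureE (radii n.+1)) //.
rewrite -[RHS](integral_polar_prod ml mf l0 f0).
by apply: eq_integral => x _; congr (_%:E * _); apply: eq_indic.
Qed.

(** Every nonzero vector is normalized to a unit vector, and the origin is null, so [sph] has no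
    mass off the unit sphere. *)
Lemma eq_integral_sph n (f g : 'rV[R]_n.+1 -> \bar R) :
  measurable_fun setT f -> measurable_fun setT g ->
  (forall x, enorm x = 1%R -> f x = g x) -> \int[sph n.+1]_x f x = \int[sph n.+1]_x g x.
Proof.
move=> mf mg fg.
have mS : measurable (unitsphere R n.+1) by apply: compact_mx_measurable; exact: compact_unitsphere.
have S0 : sph n.+1 (~` unitsphere R n.+1) = 0.
  have m0 : measurable [set (0 : 'rV[R]_n.+1)%R] by apply: compact_mx_measurable; exact: compact_set1.
  rewrite sphE (_ : vol (_ `&` _) = 0) ?mule0//.
  apply/eqP; rewrite -measure_le0 -(vol0 n); apply: le_measure; rewrite ?inE//.
    apply: measurableI; last exact: measurable_unitball.
    by rewrite -[X in measurable X]setTI; apply: measurable_normalize => //; exact: measurableC.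
  move=> x [/= H _]; apply/eqP/negPn/negP => x0; apply: H.
  exact: enorm_normalize.
apply: ae_eq_integral => //; exists (~` unitsphere R n.+1); split => //.
  exact: measurableC.
by move=> x /= H x1; apply: H => _; exact: fg.
Qed.

Lemma integral_sph_orthogmx n (T : 'M[R]_n.+1) (f : 'rV[R]_n.+1 -> \bar R) : orthogmx T ->
  measurable_fun setT f -> (forall x, 0 <= f x) ->
  \int[sph n.+1]_x f (x *m T) = \int[sph n.+1]_x f x.
Proof.
move=> oT mf f0.
have mT := @measurable_mulmxr R 1 n.+1 n.+1 T.
have mfT : measurable_fun setT (fun x : 'rV[R]_n.+1 => f (x *m T)) by exact: (measurableT_comp mf mT).
apply: (mulvar_prod (vol_unitball_gt0 n.+1) (vol_unitball_lty n.+1)).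
rewrite muleC -[LHS](integral_unitball mfT)// muleC -[RHS](integral_unitball mf)//.
have mF : measurable_fun setT (fun x : 'rV[R]_n.+1 => (\1_(unitball R n.+1) x)%:E * f (normalize x)).
  apply: emeasurable_funM; last exact: (measurableT_comp mf (@measurable_normalize R n.+1)).
  by apply: measurable_indicE; exact: measurable_unitball.
rewrite -[RHS](integral_vol_orthogmx oT mF); last by move=> x; rewrite mule_ge0// lee_fin.
apply: eq_integral => x _; rewrite normalize_frame//; congr (_%:E * _).
by apply: eq_indic; rewrite /unitball/= enorm_frame.
Qed.

Lemma vol_starb n (rho : 'rV[R]_n.+1 -> R) : measurable_fun setT rho ->
  (forall x, enorm x = 1%R -> (0 <= rho x)%R) ->
  vol (starb rho) = vol (unitball R n.+1) * \int[sph n.+1]_x (rho x ^+ n.+1)%:E.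
Proof.
move=> mrho rho0.
pose D := [set p : measurableTypeR R * 'rV[R]_n.+1 | (p.1 <= rho p.2)%R].
have mD : measurable D.
  rewrite -[X in measurable X]setTI.
  rewrite (_ : D = (fun p : measurableTypeR R * 'rV[R]_n.+1 => (rho p.2 - p.1)%R) @^-1` `[0%R, +oo[); last first.
    by apply/seteqP; split => p; rewrite /D /= in_itv/= subr_ge0 andbT.
  have mf : measurable_fun setT (fun p : measurableTypeR R * 'rV[R]_n.+1 => (rho p.2 - p.1)%R).
    by apply: measurable_funB; [exact: measurableT_comp|exact: measurable_fst].
  by apply: mf.
pose l (r : R) (x : 'rV[R]_n.+1) : \bar R := (\1_D (r, x))%:E.
have ml : measurable_fun setT (fun p : measurableTypeR R * 'rV[R]_n.+1 => l p.1 p.2).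
  rewrite (_ : (fun p => _) = fun p => (\1_D p : R)%:E); last by apply/funext => -[].
  exact: measurable_indicE.
have mE : measurable [set x : 'rV[R]_n.+1 | (enorm x <= rho (normalize x))%R].
  rewrite -[X in measurable X]setTI (_ : [set x | _] = (fun x : 'rV[R]_n.+1 => (enorm x : measurableTypeR R, normalize x)) @^-1` D); last by apply/seteqP; split.
  by apply: measurable_polar.
have m0 : measurable [set (0 : 'rV[R]_n.+1)%R] by apply: compact_mx_measurable; exact: compact_set1.
have mS : measurable (starb rho).
  rewrite (_ : starb rho = [set 0%R] `|` [set x : 'rV[R]_n.+1 | (enorm x <= rho (normalize x))%R]); last by apply/seteqP; split.
  exact: measurableU.
(* [starb] contains the origin by fiat; at most this null set is lost. *)
transitivity (vol [set x : 'rV[R]_n.+1 | (enorm x <= rho (normalize x))%R]).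
  apply/eqP; rewrite eq_le; apply/andP; split; last first.
    by apply: le_measure; rewrite ?inE// => x /= H; right.
  rewrite -[leRHS]add0e -(vol0 n).
  by apply: le_trans (measureU2 _ m0 mE); apply: le_measure; rewrite ?inE//; exact: measurableU.
rewrite (measureE vol mE).
transitivity (\int[vol]_x l (enorm x) (normalize x)).
  by apply: eq_integral => x _; congr EFin; apply: eq_indic.
rewrite (integral_polar ml); last by move=> r x; rewrite lee_fin.
rewrite -[LHS](tonelli (sph n.+1) (radii n.+1) (h := fun x r => l r x)); last 2 first.
- by exact: (measurableT_comp ml (@measurable_swap _ _ _ _)).
- by move=> x r; rewrite lee_fin.
(* Off the sphere [rho] is arbitrary; truncation at 0 makes the integrand nonnegative everywhere
   without changing the integral. *)
have mrn : measurable_fun setT (fun x : 'rV[R]_n.+1 => (Num.max (rho x) 0 ^+ n.+1)%:E).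
  by apply/measurable_EFinP/measurable_funX; exact: measurable_maxr.
transitivity (vol (unitball R n.+1) * \int[sph n.+1]_x (Num.max (rho x) 0 ^+ n.+1)%:E); last first.
  congr (_ * _); apply: eq_integral_sph => //.
    by apply/measurable_EFinP/measurable_funX.
  by move=> x x1; rewrite max_l// rho0.
rewrite -[RHS](ge0_integralZlT (sph n.+1) mrn); last 2 first.
- by move=> x; rewrite lee_fin exprn_ge0// le_max lexx orbT.
- exact: measure_ge0.
apply: eq_integral_sph.
- apply: (@measurable_fun_fubini_tonelli_F _ _ _ (measurableTypeR R) R (radii n.+1) (fun p => l p.2 p.1)).
    by exact: (measurableT_comp ml (@measurable_swap _ _ _ _)).
  by move=> p; rewrite lee_fin.
- exact: measurable_funeM.
move=> x x1; rewrite max_l ?rho0// muleC -radii_ball ?rho0//.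
rewrite (measureE (radii n.+1)); last exact: measurable_itv.
by apply: eq_integral => r _; congr EFin; apply: eq_indic; rewrite /D/= in_itv.
Qed.

End polar.
Arguments sph {R} n A. Arguments radii {R} n A.

(** * Averages over spheres *)

Section compact_continuity.
Context {R : realType} {V : normedModType R}.
Implicit Types (A : set V) (f : V -> R).

Lemma within_contP A f : {within A, continuous f} <->
  forall x, A x -> forall e, 0 < e -> exists2 d, 0 < d & forall y, A y -> `|x - y| < d -> `|f x - f y| < e.
Proof.
rewrite subspace_continuousP; split=> [cf x Ax e e0|H x Ax].
  have /cvgrPdist_lt/(_ e e0) := cf x Ax.
  rewrite /prop_near1/= => /nbhs_ballP[d /= d0 H]; exists d => // y Ay xy.
  by apply: H => //; rewrite -ball_normE.
apply/cvgrPdist_lt => e e0; have [d d0 Hd] := H x Ax e e0.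
rewrite /prop_near1/=; apply/nbhs_ballP; exists d => //= y.
by rewrite -ball_normE /= => xy Ay; exact: Hd.
Qed.

Lemma within_cont_comp (T : topologicalType) A f (g : T -> V) (x : T) :
  {within A, continuous f} -> {for x, continuous g} -> (\forall y \near x, A (g y)) ->
  {for x, continuous (f \o g)}.
Proof.
move=> /subspace_continuousP cf cg Ag.
have Agx : A (g x) by exact: (nbhs_singleton Ag).
apply: (cvg_trans _ (cf (g x) Agx)) => P; rewrite /nbhs/= => HP.
have := cg _ HP; rewrite /= => H.
by near=> y; have : A (g y) -> P (f (g y)); [near: y; exact: H|apply; near: y; exact: Ag].
Unshelve. all: by end_near. Qed.

(** Heine-Cantor for a function continuous on [A] alone, from the near-covering form of
    compactness. *)
Lemma compact_unif A f e : compact A -> {within A, continuous f} -> 0 < e ->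
  exists2 d, 0 < d & forall x y, A x -> A y -> `|x - y| < d -> `|f x - f y| < e.
Proof.
move=> /compact_near_coveringP cA /within_contP cf e0.
have := cA R (0^'+) (fun d x => A x -> forall y, A y -> `|x - y| < d -> `|f x - f y| < e) _.
move=> /(_ _)[|].
  move=> x Ax; have e20 : 0 < e / 2 by rewrite divr_gt0.
  have [d d0 Hd] := cf x Ax (e / 2) e20.
  have d20 : 0 < d / 2 by rewrite divr_gt0.
  exists ([set y | `|x - y| < d / 2], [set i | i < d / 2]) => /=.
    split; last exact: nbhs_right_lt.
    by apply/nbhs_ballP; exists (d / 2) => //= y; rewrite -ball_normE.
  move=> [y i] /= [xy id2] Ay z Az yz.
  have yd : `|x - y| < d by rewrite (lt_trans xy)// gtr_pMr// invf_lt1// ltr1n.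
  have zd : `|x - z| < d.
    by rewrite (le_lt_trans (ler_distD y _ _))// (splitr d) ltrD// (lt_trans yz).
  rewrite (le_lt_trans (ler_distD (f x) _ _))// (splitr e) ltrD//; last exact: Hd.
  by rewrite distrC; exact: Hd.
move=> d d0 /= Hd; exists (d / 2); first by rewrite divr_gt0.
move=> x y Ax Ay xy; apply: (Hd (d / 2)) => //; last by rewrite divr_gt0.
by rewrite /= sub0r normrN ger0_norm ?divr_ge0 ?ltW// gtr_pMr// invf_lt1// ltr1n.
Qed.

Lemma within_cont_bounded A f : compact A -> {within A, continuous f} ->
  exists2 M, 0 <= M & forall x, A x -> `|f x| <= M.
Proof.
move=> cA cf; have /compact_bounded[M [_ HM]] := continuous_compact cf cA.
exists (`|M| + 1); first by rewrite addr_ge0.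
move=> x Ax; apply: (HM (`|M| + 1)); last by exists x.
by rewrite ltr_pwDr// ler_norm.
Qed.

End compact_continuity.

(** * Bounded measurable functions *)

Section bounded_measurable.
Context {R : realType}.

(** The working class of integrands: integrable for every finite measure and stable under the
    operations used, so signed real integrals can be added and exchanged freely. *)
Definition bmeas d (T : measurableType d) (h : T -> R) :=
  measurable_fun setT h /\ exists M, forall x, `|h x| <= M.

Lemma bmeas_integrable d (T : measurableType d) (mu : {finite_measure set T -> \bar R}) h :
  bmeas h -> mu.-integrable setT (EFin \o h).
Proof.
move=> [mh [M hM]]; apply: measurable_bounded_integrable => //.
  by rewrite -ge0_fin_numE// fin_num_measure.
by exists M; split; [exact: num_real|move=> x Mx y _; exact: le_trans (hM y) (ltW Mx)].
Qed.

Lemma bmeas_comp d d' (T : measurableType d) (T' : measurableType d') (h : T' -> R) (g : T -> T') :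
  measurable_fun setT g -> bmeas h -> bmeas (h \o g).
Proof.
by move=> mg [mh [M hM]]; split; [exact: measurableT_comp|exists M => x; exact: hM].
Qed.

Lemma bmeas_cst d (T : measurableType d) c : bmeas (fun _ : T => c).
Proof. by split => //; exists `|c|. Qed.

Lemma bmeasD d (T : measurableType d) (g h : T -> R) : bmeas g -> bmeas h -> bmeas (fun x => g x + h x).
Proof.
move=> [mg [M gM]] [mh [N hN]]; split; first exact: measurable_funD.
by exists (M + N) => x; rewrite (le_trans (ler_normD _ _))// lerD.
Qed.

Lemma bmeasM d (T : measurableType d) (g h : T -> R) : bmeas g -> bmeas h -> bmeas (fun x => g x * h x).
Proof.
move=> [mg [M gM]] [mh [N hN]]; split; first exact: measurable_funM.
by exists (M * N) => x; rewrite normrM ler_pM.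
Qed.

Lemma bmeasN d (T : measurableType d) (h : T -> R) : bmeas h -> bmeas (fun x => - h x).
Proof.
move=> [mh [N hN]]; split; first exact: measurableT_comp.
by exists N => x; rewrite normrN.
Qed.

Lemma bmeasB d (T : measurableType d) (g h : T -> R) : bmeas g -> bmeas h -> bmeas (fun x => g x - h x).
Proof. by move=> bg bh; apply: bmeasD => //; exact: bmeasN. Qed.

Lemma bmeas_indic d (T : measurableType d) (A : set T) : measurable A -> bmeas (\1_A : T -> R).
Proof.
move=> mA; split; first exact: measurable_indic.
by exists 1 => x; rewrite indicE; case: (_ \in _); rewrite ?normr1 ?normr0.
Qed.

End bounded_measurable.

Section sphere_average.
Context {R : realType}.

(** Functions are controlled on the sphere only and may be wild elsewhere; the 0-homogeneous
    extension is the version that is measurable on R^n. *)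
Definition hat n (f : 'rV[R]_n -> R) (x : 'rV[R]_n) := f (normalize x).

Lemma hat_normalize n (f : 'rV[R]_n -> R) x : hat f (normalize x) = hat f x.
Proof. by rewrite /hat normalize_idem. Qed.

Lemma hat_id n (f : 'rV[R]_n -> R) x : enorm x = 1 -> hat f x = f x.
Proof. by move=> x1; rewrite /hat normalize_id. Qed.

Lemma hat_continuous n (f : 'rV[R]_n -> R) x : {within unitsphere R n, continuous f} ->
  x != 0 -> {for x, continuous (hat f)}.
Proof.
move=> cf x0; apply: (within_cont_comp cf); first exact: continuous_normalize.
have : nbhs x [set y : 'rV[R]_n | y != 0].
  apply: open_nbhs_nbhs; split => //.
  rewrite (_ : [set y | _] = ~` [set 0]); last by apply/seteqP; split => y /= /eqP.
  by apply: closed_openC; apply: compact_closed; [exact: norm_hausdorff|exact: compact_set1].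
by apply: filterS => y y0; rewrite /unitsphere/= enorm_normalize.
Qed.

Lemma hat_bmeas n (f : 'rV[R]_n -> R) : {within unitsphere R n, continuous f} -> bmeas (hat f).
Proof.
move=> cf; split.
  have m0 : measurable [set (0 : 'rV[R]_n)] by apply: compact_mx_measurable; exact: compact_set1.
  rewrite -(setvU [set (0 : 'rV[R]_n)]); apply/measurable_funU => //; first exact: measurableC.
  split; last by apply: measurable_fun_set1.
  apply: open_continuous_mx_measurable.
    by apply: closed_openC; apply: compact_closed; [exact: norm_hausdorff|exact: compact_set1].
  by move=> x; rewrite inE /= => /eqP x0; exact: hat_continuous.
have [M M0 HM] := within_cont_bounded (@compact_unitsphere R n) cf.
(* [normalize] fixes the origin, so [hat f] takes there the value f 0, which the bound on the sphere
   does not control. *)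
exists (M + `|f 0|) => x; have [->|x0] := eqVneq x 0.
  by rewrite /hat normalize0 lerDr.
by rewrite (le_trans (HM _ _)) ?lerDl// /unitsphere/= enorm_normalize.
Qed.

Definition savg n (h : 'rV[R]_n -> R) : R := (\int[sph n]_x h x)%R.

Lemma savg_fin n (h : 'rV[R]_n -> R) : bmeas h -> (savg h)%:E = (\int[sph n]_x (h x)%:E)%E.
Proof. by move=> bh; rewrite /savg /Rintegral fineK//; apply: integrable_fin_num => //; exact: bmeas_integrable. Qed.

Lemma savgD n (g h : 'rV[R]_n -> R) : bmeas g -> bmeas h -> savg (fun x => g x + h x) = savg g + savg h.
Proof. by move=> bg bh; apply: RintegralD => //; exact: bmeas_integrable. Qed.

Lemma savgB n (g h : 'rV[R]_n -> R) : bmeas g -> bmeas h -> savg (fun x => g x - h x) = savg g - savg h.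
Proof. by move=> bg bh; apply: RintegralB => //; exact: bmeas_integrable. Qed.

Lemma savgZ n c (h : 'rV[R]_n -> R) : bmeas h -> savg (fun x => c * h x) = c * savg h.
Proof. by move=> bh; apply: RintegralZl => //; exact: bmeas_integrable. Qed.

Lemma savg_cst n c : savg (fun _ : 'rV[R]_n => c) = c.
Proof. by rewrite /savg Rintegral_cst// [X in fine X]probability_setT mulr1. Qed.

Lemma eq_savg n (g h : 'rV[R]_n.+1 -> R) : bmeas g -> bmeas h ->
  (forall x, enorm x = 1 -> g x = h x) -> savg g = savg h.
Proof.
move=> [mg _] [mh _] gh; congr fine; apply: eq_integral_sph => //.
- exact/measurable_EFinP.
- exact/measurable_EFinP.
- by move=> x x1; rewrite gh.
Qed.

Lemma le_savg n (g h : 'rV[R]_n.+1 -> R) : bmeas g -> bmeas h ->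
  (forall x, enorm x = 1 -> g x <= h x) -> savg g <= savg h.
Proof.
(* The inequality is known on the sphere only; the maximum equals h there and dominates g
   everywhere. *)
move=> bg bh gh; have bm : bmeas (fun x => Num.max (g x) (h x)).
  case: bg bh => [mg [M gM]] [mh [N hN]]; split; first exact: measurable_maxr.
  exists (M + N) => x; have M0 := le_trans (normr_ge0 _) (gM x).
  have N0 := le_trans (normr_ge0 _) (hN x).
  by rewrite maxEle; case: ifP => _; rewrite (le_trans (gM x), le_trans (hN x))// ?lerDl ?lerDr.
rewrite (@eq_savg _ h (fun x => Num.max (g x) (h x)))//; last by move=> x x1; rewrite max_r// gh.
by apply: le_Rintegral => //; [exact: bmeas_integrable|exact: bmeas_integrable|move=> x _; rewrite le_max lexx].
Qed.

Lemma savg_orthogmx n (T : 'M[R]_n.+1) (h : 'rV[R]_n.+1 -> R) : orthogmx T -> bmeas h ->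
  savg (fun x => h (x *m T)) = savg h.
Proof.
move=> oT bh; have [mh [M hM]] := bh.
have mT := @measurable_mulmxr R 1 n.+1 n.+1 T.
have bhT : bmeas (fun x => h (x *m T)) by exact: (bmeas_comp mT bh).
have bM : bmeas (fun x => h x + M) by apply: bmeasD => //; exact: bmeas_cst.
(* Rotation invariance is available for nonnegative functions, hence the shift by the bound M. *)
have H : savg (fun x => h (x *m T) + M) = savg (fun x => h x + M).
  congr fine; apply: (integral_sph_orthogmx (f := fun x => (h x + M)%:E)) => //.
    by apply/measurable_EFinP; case: bM.
  by move=> x; rewrite lee_fin -lerBlDr sub0r; have := hM x; rewrite ler_norml => /andP[].
by move: H; rewrite !savgD//; try exact: bmeas_cst; move=> /addIr.
Qed.

End sphere_average.

Section signed_lebint.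
Context {R : realType}.
Local Open Scope ereal_scope.

(** Bounded with support in a cube: a condition that passes to slices with the same M and r, so it
    can be carried through inductions on the dimension. *)
Definition boxed n (M r : R) (A : 'rV[R]_n -> R) :=
  forall x, (0 <= A x <= M * \1_[set x : 'rV[R]_n | forall i, (`|x 0 i| <= r)%R] x)%R.

Lemma boxed_integral n (M r : R) (f : 'rV[R]_n -> R) : (0 <= M)%R -> (0 <= r)%R ->
  measurable_fun setT f -> boxed M r f ->
  \int[vol]_x (f x)%:E <= (M * (2 * r) ^+ n)%:E.
Proof.
move=> M0 r0 mf bf; have mB := measurable_indicE (R := R) (@measurable_box R n r).
apply: (@le_trans _ _ (\int[vol]_x (M%:E * (\1_[set x : 'rV[R]_n | forall i, (`|x 0 i| <= r)%R] x)%:E))).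
  apply: ge0_le_integral => //.
  - by move=> x _; rewrite lee_fin; case/andP: (bf x).
  - exact/measurable_EFinP.
  - exact: measurable_funeM.
  - by move=> x _; rewrite -EFinM lee_fin; case/andP: (bf x).
rewrite (ge0_integralZlT vol mB)//.
by rewrite -(measureE vol (@measurable_box R n r)) [X in _ * X](vol_box n r0) -EFinM.
Qed.

Lemma lebint_boxed_lty n (M r : R) (A : 'rV[R]_n -> R) : (0 <= M)%R -> (0 <= r)%R ->
  measurable_fun setT A -> boxed M r A -> lebint (fun x => (A x)%:E) < +oo.
Proof.
move=> M0 r0 mA bA; rewrite lebintE; last 2 first.
- exact/measurable_EFinP.
- by move=> x; rewrite lee_fin; case/andP: (bA x).
by apply: le_lt_trans (boxed_integral M0 r0 mA bA) _; rewrite ltry.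
Qed.

(** For a signed integrand [lebint] has not been identified with an integral against [vol]; the
    difference is split slice by slice, where finiteness is inherited. *)
Lemma lebintB n (M r : R) (A B : 'rV[R]_n -> R) : (0 <= M)%R -> (0 <= r)%R ->
  measurable_fun setT A -> measurable_fun setT B -> boxed M r A -> boxed M r B ->
  lebint (fun x => (A x - B x)%:E) = lebint (fun x => (A x)%:E) - lebint (fun x => (B x)%:E).
Proof.
move=> M0 r0; elim: n A B => [|n IH] A B mA mB bA bB; first by rewrite /= EFinB.
have slice (C : 'rV[R]_n.+1 -> R) x : boxed M r C -> boxed M r (fun t => C (rcons0 x t)).
  move=> bC t; have /andP[-> /le_trans/=] := bC (rcons0 x t); apply.
  rewrite ler_wpM2l// !indicE ler_nat; case: (_ \in _) / boolP => //= /set_mem/= H.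
  by rewrite mem_set// => i; have := H (lift ord0 i); rewrite rcons0_lift.
have mslice (C : 'rV[R]_n.+1 -> R) x : measurable_fun setT C -> measurable_fun setT (fun t => C (rcons0 x t)).
  by move=> mC; apply: (measurableT_comp mC); exact: measurable_rcons0_r.
have int (C : 'rV[R]_n.+1 -> R) : measurable_fun setT C -> boxed M r C ->
    (@lebesgue_measure R).-integrable setT (fun x => lebint (fun t => (C (rcons0 x t))%:E)).
  move=> mC bC; have C0 x : 0 <= (C x)%:E by rewrite lee_fin; case/andP: (bC x).
  have E x : lebint (fun t => (C (rcons0 x t))%:E) = \int[vol]_t (C (rcons0 x t))%:E.
    by apply: lebintE => [|t]; [apply/measurable_EFinP; exact: mslice|exact: C0].
  apply/integrableP; split.
    under eq_fun do rewrite E.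
    by apply: (measurable_vol_inner (F := fun x => (C x)%:E)) => //; exact/measurable_EFinP.
  under eq_integral do rewrite gee0_abs ?lebint_ge0//.
  exact: (lebint_boxed_lty M0 r0 mC bC).
rewrite /= -integralB//; [|exact: int|exact: int].
by apply: eq_integral => x _; rewrite IH//; [exact: mslice|exact: mslice|exact: slice|exact: slice].
Qed.

(** With M a bound of f, the signed integrand on the ball is (f + M) - M, a difference of two boxed
    functions, and polar coordinates evaluate each. *)
Lemma sphint_savg m n (U : 'M[R]_(m.+1, n)) (f : 'rV[R]_n -> R) : isframe U ->
  bmeas (hat f) -> sphint U f = (savg (fun y => hat f (y *m U)))%:E.
Proof.
move=> HU bf; have mU := @measurable_mulmxr R 1 m.+1 n U.
have bfU : bmeas (fun y => hat f (y *m U)) by exact: (bmeas_comp mU bf).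
have [mfU [M hM]] := bfU.
have M0 : (0 <= M)%R by apply: le_trans (hM 0%R).
have mB := @measurable_unitball R m.+1.
pose A (y : 'rV[R]_m.+1) : R := (\1_(unitball R m.+1) y * (hat f (y *m U) + M))%R.
pose B (y : 'rV[R]_m.+1) : R := (\1_(unitball R m.+1) y * M)%R.
have bfM : bmeas (fun y => hat f (y *m U) + M)%R by apply: bmeasD => //; exact: bmeas_cst.
have f0 y : (0 <= hat f (y *m U) + M)%R.
  by rewrite -lerBlDr sub0r; have := hM y; rewrite ler_norml => /andP[].
have mA : measurable_fun setT A by apply: measurable_funM; [exact: measurable_indic|case: bfM].
have mBB : measurable_fun setT B by apply: measurable_funM; [exact: measurable_indic|].
have bx (c : 'rV[R]_m.+1 -> R) : (forall y, (0 <= c y <= M + M)%R) -> boxed (M + M)%R 1 (fun y => \1_(unitball R m.+1) y * c y)%R.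
  move=> hc y; have /andP[c0 cM] := hc y; rewrite !indicE.
  case: (y \in unitball R m.+1) / boolP => [/set_mem/= y1|_]; last first.
    by rewrite mul0r lexx mulr_ge0// addr_ge0.
  by rewrite mul1r c0/= mem_set ?mulr1//= => i; exact: le_trans (coord_le_enorm _ _) y1.
have bA : boxed (M + M)%R 1 A.
  by apply: bx => y; rewrite f0/= lerD2r; exact: le_trans (ler_norm _) (hM y).
have bB : boxed (M + M)%R 1 B by apply: bx => y; rewrite M0 lerDl.
rewrite /sphint (_ : (fun y => _) = fun y => (A y - B y)%:E); last first.
  by apply/funext => y; rewrite /A /B -mulrBr addrK.
rewrite (lebintB _ _ mA mBB bA bB)//; last by rewrite addr_ge0.
rewrite !lebintE; first last.
- by move=> x; rewrite lee_fin; case/andP: (bA x).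
- exact/measurable_EFinP.
- by move=> x; rewrite lee_fin; case/andP: (bB x).
- exact/measurable_EFinP.
have EA : \int[vol]_x (A x)%:E = vol (unitball R m.+1) * (savg (fun y => hat f (y *m U) + M)%R)%:E.
  rewrite savg_fin// -integral_unitball; last 2 first.
  - by apply/measurable_EFinP; case: bfM.
  - by move=> y; rewrite lee_fin.
  apply: eq_integral => y _; rewrite -EFinM; congr (_ * (_ + _))%:E.
  by rewrite -(hat_normalize f (_ *m U)) normalize_frame// normalize_idem -normalize_frame// hat_normalize.
have EB : \int[vol]_x (B x)%:E = vol (unitball R m.+1) * M%:E.
  rewrite (measureE vol mB) -(ge0_integralZrT vol (measurable_indicE mB))//.
rewrite EA EB savgD//; last exact: bmeas_cst.
rewrite savg_cst.
have [v v0 ->] : exists2 v, (0 < v)%R & vol (unitball R m.+1) = v%:E.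
  by exists (fine (vol (unitball R m.+1))); [exact: fine_vol_unitball_gt0|rewrite fineK// vol_unitball_fin].
set S := savg _; rewrite -[LHS]/(((v * (S + M) - v * M) * v^-1)%R%:E).
rewrite -mulrBr addrK mulrAC divff ?mul1r//.
by rewrite gt_eqF.
Qed.

End signed_lebint.

(** * Orthonormal frames of subspaces *)

Section frames.
Context {R : realType}.

Lemma dotv_mx n (x y : 'rV[R]_n) : x *m y^T = (dotv x y)%:M.
Proof. by rewrite [LHS]mx11_scalar. Qed.

(** One step of Gram-Schmidt in terms of projections: pass to the orthogonal complement of v inside
    the range of P. *)
Lemma proj_peel n m (P : 'M[R]_n) (v : 'rV[R]_n) : grass R n m.+1 P ->
  enorm v = 1 -> v *m P = v -> grass R n m (P - v^T *m v).
Proof.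
move=> [Ps [PP rP]] v1 vP.
have vv : v *m v^T = 1%:M by rewrite dotv_mx -sqr_enorm v1 expr1n.
have Pv : P *m v^T = v^T by rewrite -{1}Ps -trmx_mul vP.
have vP' : v *m (P - v^T *m v) = 0 by rewrite mulmxBr vP mulmxA vv mul1mx subrr.
have P'P : (P - v^T *m v) *m P = P - v^T *m v by rewrite mulmxBl PP -mulmxA vP.
have idem : (P - v^T *m v) *m (P - v^T *m v) = P - v^T *m v.
  by rewrite mulmxBr P'P mulmxA mulmxBl Pv -(mulmxA _ v) vv mulmx1 subrr mul0mx subr0.
split; first by rewrite linearB/= trmx_mul trmxK Ps.
split=> //; apply/eqP; rewrite eqn_leq; apply/andP; split.
  rewrite -ltnS -rP ltn_neqAle; apply/andP; split; last by rewrite -P'P mxrankM_maxr.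
  (* With equal ranks the rows of P would lie in the row space of the smaller projection, which acts
     there as the identity but kills v; then v would be 0. *)
  apply/negP => /eqP rE.
  have sP : (P - v^T *m v <= P)%MS by rewrite -P'P submxMl.
  have := mxrank_leqif_sup sP; rewrite /leqif rE eqxx => -[_ /esym/submxP[D DP]].
  have v0 : v = 0.
    rewrite -vP DP mulmxA -[LHS]mulmx1.
    have : v *m P = v *m P *m (P - v^T *m v) by rewrite {1}DP {2}DP -!mulmxA idem.
    by rewrite vP vP' => v0; rewrite v0 !mul0mx.
  by move: v1; rewrite v0 enorm0 => /esym/eqP; rewrite oner_eq0.
have : (\rank P <= \rank (P - v^T *m v)%R + \rank (v^T *m v))%N.
  by rewrite -{1}(subrK (v^T *m v) P) mxrank_add.
rewrite rP => H; rewrite -ltnS; apply: (leq_trans H); rewrite -[leqRHS]addn1 leq_add2l.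
exact: leq_trans (mxrankM_maxr _ _) (rank_leq_row _).
Qed.

Lemma frame_col n m (v : 'rV[R]_n) (U : 'M[R]_(m, n)) : enorm v = 1 -> isframe U ->
  U *m v^T = 0 -> isframe (col_mx v U).
Proof.
move=> v1 fU Uv; have vv : v *m v^T = 1%:M by rewrite dotv_mx -sqr_enorm v1 expr1n.
rewrite /isframe tr_col_mx mul_col_row vv Uv fU.
rewrite -[v *m U^T]trmxK trmx_mul trmxK Uv trmx0.
by rewrite [RHS]scalar_mx_block.
Qed.

(** A normalized nonzero row of P is a unit vector of its range; peel it off and continue with the
    rest. *)
Lemma grass_frame n m (P : 'M[R]_n) : grass R n m P ->
  exists2 U : 'M[R]_(m, n), isframe U & U^T *m U = P.
Proof.
elim: m P => [|m IH] P gP.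
  have [Ps [PP /eqP]] := gP; rewrite mxrank_eq0 => /eqP ->.
  by exists 0; rewrite ?mulmx0// /isframe; apply/matrixP => -[].
have [Ps [PP rP]] := gP.
have [i Pi] : exists i, row i P != 0.
  apply/existsP; apply: contra_eqT rP => /existsPn H.
  rewrite (_ : P = 0) ?mxrank0//; apply/row_matrixP => i; rewrite row0; apply/eqP.
  by have := H i; rewrite negbK.
pose v := normalize (row i P).
have v1 : enorm v = 1 by exact: enorm_normalize.
have vP : v *m P = v by rewrite /v /normalize -scalemxAl -row_mul PP.
have vv : v *m v^T = 1%:M by rewrite dotv_mx -sqr_enorm v1 expr1n.
have [U fU UP] := IH _ (proj_peel gP v1 vP).
have Uv : U *m v^T = 0.
  have -> : U = U *m (P - v^T *m v) by rewrite -UP mulmxA fU mul1mx.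
  by rewrite -mulmxA mulmxBl -mulmxA vv mulmx1 -{1}Ps -trmx_mul vP subrr mulmx0.
exists (col_mx v U : 'M[R]_(1 + m, n)).
  exact: frame_col.
have E : (col_mx v U)^T *m col_mx v U = v^T *m v + U^T *m U by rewrite tr_col_mx mul_row_col.
by apply: (etrans E); rewrite UP addrC subrK.
Qed.

Lemma frame_grass n m (U : 'M[R]_(m, n)) : isframe U -> grass R n m (U^T *m U).
Proof.
move=> fU; split; first by rewrite trmx_mul trmxK.
split; first by rewrite mulmxA -(mulmxA U^T) fU mulmx1.
have rU : \rank U = m by apply/eqP/row_freeP; exists U^T.
apply/eqP; rewrite eqn_leq; apply/andP; split.
  by apply: leq_trans (mxrankM_maxl _ _) _; rewrite mxrank_tr rU.
have : (\rank (U *m (U^T *m U)) <= \rank (U^T *m U))%N by exact: mxrankM_maxr.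
by rewrite mulmxA fU mul1mx rU.
Qed.

Lemma frameP n m (P : 'M[R]_n) : grass R n m P -> isframe (frame m P) /\ (frame m P)^T *m frame m P = P.
Proof.
move=> /grass_frame[U fU UP]; rewrite /frame; case: xgetP => [V _ [] //|/(_ U)].
by move=> /(_ (conj fU UP)).
Qed.

Lemma rcons0E n (x : R) (t : 'rV[R]_n) : rcons0 x t = row_mx x%:M t.
Proof.
apply/rowP => j; case: (unliftP ord0 j) => [k ->|->].
  rewrite rcons0_lift; have -> : lift ord0 k = rshift 1 k :> 'I_(1 + n) by exact: val_inj.
  exact/esym/(row_mxEr x%:M t 0 k).
rewrite rcons0_0; have -> : ord0 = lshift n (0 : 'I_1) :> 'I_(1 + n) by exact: val_inj.
by apply: etrans (esym (row_mxEl x%:M t 0 0)); rewrite mxE.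
Qed.

Lemma orthog_completion n (v : 'rV[R]_n.+1) : enorm v = 1 ->
  exists T : 'M[R]_n.+1, exists U : 'M[R]_(n, n.+1),
    [/\ orthogmx T, isframe U & forall s u, rcons0 s u *m T = s *: v + u *m U].
Proof.
move=> v1; have g1 : grass R n.+1 n.+1 1%:M.
  by split; [rewrite trmx1|split; [rewrite mulmx1|exact: mxrank1]].
have vv : v *m v^T = 1%:M by rewrite dotv_mx -sqr_enorm v1 expr1n.
have [U fU UP] := grass_frame (proj_peel g1 v1 (mulmx1 v)).
have Uv : U *m v^T = 0.
  have -> : U = U *m (1%:M - v^T *m v) by rewrite -UP mulmxA fU mul1mx.
  by rewrite -mulmxA mulmxBl -mulmxA vv mulmx1 mul1mx subrr mulmx0.
exists (col_mx v U : 'M[R]_(1 + n, n.+1)), U; split => //.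
  exact: frame_col.
by move=> s u; rewrite rcons0E; apply: etrans (mul_row_col s%:M u v U) _; rewrite mul_scalar_mx.
Qed.

(** Two frames of one subspace differ by the orthogonal matrix [U *m V^T]. *)
Lemma savg_frame_indep m n (U V : 'M[R]_(m.+1, n)) (f : 'rV[R]_n -> R) : isframe U -> isframe V ->
  U^T *m U = V^T *m V -> bmeas f -> savg (fun y => f (y *m U)) = savg (fun y => f (y *m V)).
Proof.
move=> fU fV UV bf; have VO : U = U *m V^T *m V by rewrite -mulmxA -UV mulmxA fU mul1mx.
have oO : orthogmx (U *m V^T).
  by rewrite /orthogmx trmx_mul trmxK !mulmxA -VO.
rewrite -[RHS](savg_orthogmx oO); last by apply: bmeas_comp bf; exact: measurable_mulmxr.
by congr savg; apply/funext => y; rewrite -mulmxA -VO.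
Qed.

End frames.

(** * From great subspheres to higher dimensions *)

Section fubini_bounded.
Context {R : realType} d1 d2 (T1 : measurableType d1) (T2 : measurableType d2).
Variables (m1 : {finite_measure set T1 -> \bar R}) (m2 : {finite_measure set T2 -> \bar R}).

Lemma bmeas_swap (F : T1 -> T2 -> R) : bmeas (fun p : T1 * T2 => F p.1 p.2) ->
  bmeas (fun p : T2 * T1 => F p.2 p.1).
Proof. by move=> [mF [M FM]]; split; [exact: (measurableT_comp mF (@measurable_swap _ _ _ _))|exists M => p; exact: (FM (p.2, p.1))]. Qed.

Lemma bmeas_slice (F : T1 -> T2 -> R) x : bmeas (fun p : T1 * T2 => F p.1 p.2) -> bmeas (F x).
Proof. by move=> [mF [M FM]]; split; [exact: (measurable_fun_pair2 x mF)|exists M => y; exact: (FM (x, y))]. Qed.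

Lemma bmeas_integrable_prod (F : T1 -> T2 -> R) : bmeas (fun p : T1 * T2 => F p.1 p.2) ->
  (m1 \x m2)%E.-integrable setT (EFin \o (fun p : T1 * T2 => F p.1 p.2)).
Proof.
move=> [mF [M FM]]; apply: measurable_bounded_integrable => //.
  rewrite [X in (X < _)%E](_ : _ = (m1 setT * m2 setT)%E); last first.
    by rewrite -setXTT; exact: product_measure1E.
  rewrite lte_mul_pinfty//; first by rewrite fin_num_measure.
  by rewrite -ge0_fin_numE// fin_num_measure.
by exists M; split; [exact: num_real|move=> x Mx y _; exact: le_trans (FM y) (ltW Mx)].
Qed.

Lemma bmeas_Rintegral (F : T1 -> T2 -> R) : bmeas (fun p : T1 * T2 => F p.1 p.2) ->
  bmeas (fun x => \int[m2]_y F x y).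
Proof.
move=> bF; have [mF [M FM]] := bF; split.
  apply: measurableT_comp => //.
  have if12 := bmeas_integrable_prod bF.
  exact: (measurable_fubini_F if12).
exists (M * fine (m2 setT)) => x.
have bFx := bmeas_slice x bF.
apply: le_trans (le_normr_Rintegral _ _) _ => //; first exact: bmeas_integrable.
rewrite -Rintegral_cst//; apply: le_Rintegral => //.
- apply: bmeas_integrable; case: bFx => mFx _; split; first exact: measurableT_comp.
  by exists M => y; rewrite normr_id; exact: (FM (x, y)).
- by apply: bmeas_integrable; exact: bmeas_cst.
- by move=> y _; exact: (FM (x, y)).
Qed.

Lemma Rintegral_swap (F : T1 -> T2 -> R) : bmeas (fun p : T1 * T2 => F p.1 p.2) ->
  \int[m1]_x (\int[m2]_y F x y) = \int[m2]_y (\int[m1]_x F x y).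
Proof.
move=> bF; have := Fubini (bmeas_integrable_prod bF).
have bF' := bmeas_swap bF.
rewrite /Rintegral/= => H; congr fine.
have E1 x : (\int[m2]_y (F x y)%:E)%E = (fine (\int[m2]_y (F x y)%:E))%:E.
  rewrite fineK//; apply: integrable_fin_num => //; apply: bmeas_integrable.
  exact: bmeas_slice bF.
have E2 y : (\int[m1]_x (F x y)%:E)%E = (fine (\int[m1]_x (F x y)%:E))%:E.
  rewrite fineK//; apply: integrable_fin_num => //; apply: bmeas_integrable.
  by case: bF => mF [M FM]; split; [exact: (measurable_fun_pair1 y mF)|exists M => x; exact: (FM (x, y))].
by rewrite -(eq_integral _ _ (fun x _ => E1 x)) -(eq_integral _ _ (fun x _ => E2 x)).
Qed.

End fubini_bounded.

Section hyperplane_step.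
Context {R : realType}.

Lemma measurable_rcons d (T : measurableType d) n (f : T -> measurableTypeR R) (g : T -> 'rV[R]_n) :
  measurable_fun setT f -> measurable_fun setT g -> measurable_fun setT (fun x => rcons0 (f x) (g x)).
Proof. by move=> mf mg; exact: (measurableT_comp (@measurable_rcons0 R n) (measurable_fun_pair mf mg)). Qed.

Lemma normalize_coord n (x : 'rV[R]_n) i j : normalize x i j = (enorm x)^-1 * x i j.
Proof. by rewrite /normalize mxE. Qed.

(** On the sphere the direction of the tail is uniform and independent of the first coordinate: in
    the slices of the ball at a fixed first coordinate, everything else depends on the tail through
    its norm. *)
Lemma tail_law m (A : set (measurableTypeR R)) (f : 'rV[R]_m.+1 -> \bar R) :
  measurable A -> measurable_fun setT f -> (forall x, 0 <= f x)%E ->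
  (\int[sph m.+2]_y (f (normalize (tail0 y)) * (\1_A (y 0 0))%:E) =
   (\int[sph m.+1]_u f u) * \int[sph m.+2]_y (\1_A (y 0 0 : measurableTypeR R))%:E)%E.
Proof.
move=> mA mf f0.
have mtn : measurable_fun setT (fun y : 'rV[R]_m.+2 => normalize (tail0 y)).
  by apply: measurableT_comp; [exact: measurable_normalize|exact: measurable_tail0].
have mi : measurable_fun setT (fun y : 'rV[R]_m.+2 => (\1_A (y 0 0 : measurableTypeR R) : R)%:E).
  exact: (measurableT_comp (measurable_indicE mA) (@measurable_coord R 1 m.+2 0 0)).
have mg : measurable_fun setT (fun y : 'rV[R]_m.+2 => f (normalize (tail0 y)) * (\1_A (y 0 0 : measurableTypeR R) : R)%:E)%E.
  by apply: emeasurable_funM => //; exact: (measurableT_comp mf).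
(* A representative of the points with first coordinate s and tail of norm r (for r >= 0). *)
pose q (s r : R) : 'rV[R]_m.+2 := rcons0 s (r *: delta_mx 0 0 : 'rV[R]_m.+1).
have mq : measurable_fun setT (fun p : measurableTypeR R * measurableTypeR R => q p.1 p.2).
  apply: measurable_rcons; first exact: measurable_fst.
  by apply: measurable_scalerv => //; exact: measurable_snd.
have mBA : measurable_fun setT (fun x : 'rV[R]_m.+2 => (\1_(unitball R m.+2) x * \1_A (normalize x 0 0 : measurableTypeR R) : R)%:E).
  apply/measurable_EFinP/measurable_funM; first by apply: measurable_indic; exact: measurable_unitball.
  apply: (measurableT_comp (measurable_indic mA)); apply: (measurableT_comp (@measurable_coord R 1 m.+2 0 0)).
  exact: measurable_normalize.
pose L (s r : R) : \bar R := (\1_(unitball R m.+2) (q s r) * \1_A (normalize (q s r) 0 0 : measurableTypeR R))%:E.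
have mL : measurable_fun setT (fun p : measurableTypeR R * measurableTypeR R => L p.1 p.2).
  exact: (measurableT_comp mBA mq).
have L0 s r : (0 <= L s r)%E by rewrite lee_fin mulr_ge0.
have qE s (t : 'rV[R]_m.+1) : L s (enorm t) = (\1_(unitball R m.+2) (rcons0 s t) * \1_A (normalize (rcons0 s t) 0 0 : measurableTypeR R))%:E.
  have E : enorm (q s (enorm t)) = enorm (rcons0 s t).
    apply/eqP; rewrite -(@eqrXn2 _ 2) ?enorm_ge0// !enorm_rcons0 enormZ ger0_norm ?enorm_ge0//.
    rewrite (_ : enorm (delta_mx 0 0 : 'rV[R]_m.+1) = 1) ?mulr1//.
    apply/eqP; rewrite -(@eqrXn2 _ 2) ?enorm_ge0// expr1n sqr_enorm dotvE big_ord_recl !mxE/= mulr1.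
    by rewrite big1 ?addr0// => i _; rewrite !mxE/= mulr0.
  rewrite /L; congr ((_ * \1_A _)%:E); first by apply: eq_indic; rewrite /unitball/= E.
  by rewrite !normalize_coord E /q !rcons0_0.
have key (F : 'rV[R]_m.+1 -> \bar R) : measurable_fun setT F -> (forall x, 0 <= F x)%E ->
   (vol (unitball R m.+2) * \int[sph m.+2]_y (F (normalize (tail0 y)) * (\1_A (y 0 0 : measurableTypeR R))%:E) =
    (\int[@lebesgue_measure R]_s \int[radii m.+1]_r L s r) * \int[sph m.+1]_u F u)%E.
  move=> mF F0.
  have mG : measurable_fun setT (fun y : 'rV[R]_m.+2 => F (normalize (tail0 y)) * (\1_A (y 0 0 : measurableTypeR R) : R)%:E)%E.
    by apply: emeasurable_funM => //; exact: (measurableT_comp mF).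
  rewrite -integral_unitball//; last by move=> x; rewrite mule_ge0// lee_fin.
  have mBG : measurable_fun setT (fun x : 'rV[R]_m.+2 => (\1_(unitball R m.+2) x * \1_A (normalize x 0 0 : measurableTypeR R))%:E * F (normalize (tail0 x)))%E.
    by apply: emeasurable_funM => //; exact: (measurableT_comp mF).
  transitivity (\int[vol]_x ((\1_(unitball R m.+2) x * \1_A (normalize x 0 0 : measurableTypeR R))%:E * F (normalize (tail0 x))))%E.
    apply: eq_integral => x _; rewrite EFinM -muleA [in RHS](muleC _ (F _)); congr (_ * (F _ * _))%E.
    have [->|x0] := eqVneq x 0; first by rewrite normalize0.
    rewrite -(normalizeZ (a := (enorm x)^-1) (tail0 x)) ?invr_gt0 ?enorm_gt0//; congr normalize.
    by apply/rowP => j; rewrite !mxE.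
  rewrite integral_volS//; last by move=> x; rewrite mule_ge0// lee_fin mulr_ge0.
  have ISF0 : (0 <= \int[sph m.+1]_u F u)%E by apply: integral_ge0 => x _; exact: F0.
  rewrite -[RHS](ge0_integralZrT (@lebesgue_measure R) _ _ ISF0); last 2 first.
  - exact: (@measurable_fun_fubini_tonelli_F _ _ (measurableTypeR R) (measurableTypeR R) R (radii m.+1) (fun p => L p.1 p.2)).
  - by move=> s; apply: integral_ge0 => r _; exact: L0.
  apply: eq_integral => s _.
  have E := integral_polar_prod (measurable_fun_pair2 s mL) mF (L0 s) F0.
  rewrite -[RHS]E.
  by apply: eq_integral => t _; rewrite qE tail0K.
apply: (mulvar_prod (vol_unitball_gt0 m.+2) (vol_unitball_lty m.+2)).
have S1 : (\int[sph m.+1]_u (cst 1%E u : \bar R) = 1)%E.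
  by rewrite integral_cst// mul1e; exact: probability_setT.
(* The factor common to all F is never computed: the constant function 1 identifies it. *)
have := key (cst 1%E) (measurable_cst _) (fun _ => lee01); rewrite S1 mule1.
under eq_integral do rewrite mul1e.
move=> H; rewrite muleC; apply: (etrans (key f mf f0)).
by rewrite -H muleC -muleA; congr (_ * _)%E; exact: muleC.
Qed.

Lemma savg_tail_law m (A : set (measurableTypeR R)) (f : 'rV[R]_m.+1 -> R) :
  measurable A -> bmeas f ->
  savg (fun y : 'rV[R]_m.+2 => f (normalize (tail0 y)) * \1_A (y 0 0)) =
  savg f * savg (fun y : 'rV[R]_m.+2 => \1_A (y 0 0)).
Proof.
move=> mA bf; have [mf [M fM]] := bf.
have bt (g : 'rV[R]_m.+1 -> R) : bmeas g -> bmeas (fun y : 'rV[R]_m.+2 => g (normalize (tail0 y))).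
  apply: (bmeas_comp (g := fun y : 'rV[R]_m.+2 => normalize (tail0 y))).
  by apply: measurableT_comp; [exact: measurable_normalize|exact: measurable_tail0].
have bA : bmeas (fun y : 'rV[R]_m.+2 => \1_A (y 0 0) : R).
  exact: (bmeas_comp (@measurable_coord R 1 m.+2 0 0) (bmeas_indic mA)).
have pos (g : 'rV[R]_m.+1 -> R) : bmeas g -> (forall x, 0 <= g x) ->
   savg (fun y : 'rV[R]_m.+2 => g (normalize (tail0 y)) * \1_A (y 0 0)) =
   savg g * savg (fun y : 'rV[R]_m.+2 => \1_A (y 0 0)).
  move=> bg g0; apply: EFin_inj; rewrite EFinM !savg_fin//; last by apply: bmeasM => //; exact: bt.
  have [/measurable_EFinP mg _] := bg.
  have g0' x : (0 <= (EFin \o g) x)%E by rewrite lee_fin.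
  exact: (etrans _ (tail_law mA mg g0')).
have fM0 x : 0 <= f x + M.
  by rewrite -lerBlDr sub0r; have := fM x; rewrite ler_norml => /andP[].
have M0 : 0 <= M by apply: le_trans (fM 0).
have bfM : bmeas (fun x => f x + M) by apply: bmeasD => //; exact: bmeas_cst.
have E1 := pos _ bfM fM0.
have E2 := pos _ (bmeas_cst _ M) (fun _ => M0).
have -> : (fun y : 'rV[R]_m.+2 => f (normalize (tail0 y)) * \1_A (y 0 0)) =
  (fun y => (f (normalize (tail0 y)) + M) * \1_A (y 0 0) - M * \1_A (y 0 0)).
  by apply/funext => y; rewrite mulrDl addrK.
rewrite savgB; last 2 first.
- by apply: bmeasM => //; exact: (bt _ bfM).
- by apply: bmeasM => //; exact: bmeas_cst.
by rewrite E1 E2 savgD ?mulrDl ?addrK//; exact: bmeas_cst.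
Qed.

Lemma sph_gt0 n (c : 'rV[R]_n) (r : R) (A : set 'rV[R]_n) : enorm c = 1 -> 0 < r ->
  measurable A -> (forall x, enorm (x - c) <= r -> A (normalize x)) -> (0 < sph n A)%E.
Proof.
move=> c1 r0 mA HA.
(* A ball of radius r' about c/2 is used: 1/2 keeps it inside the unit ball, and r/2 becomes r after
   doubling, which does not affect directions. *)
pose r' := Num.min (1 / 2) (r / 2).
have r'0 : 0 < r' by rewrite lt_min !divr_gt0.
have sub (x : 'rV[R]_n) : unitball R n x -> (normalize @^-1` A `&` unitball R n) (r' *: x + (1 / 2) *: c).
  rewrite /unitball/= => x1; have rx : enorm (r' *: x) <= r'.
    by rewrite enormZ gtr0_norm// ler_piMr// ltW.
  split; last first.
    have rc : enorm ((1 / 2) *: c) = 1 / 2 by rewrite enormZ c1 mulr1 ger0_norm.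
    rewrite (le_trans (enormD _ _))// rc (le_trans (lerD rx (lexx _)))//.
    have : r' <= 1 / 2 by rewrite ge_min lexx.
    lra.
  rewrite -(normalizeZ (a := 2))//; apply: HA.
  rewrite scalerDr [2 *: ((1 / 2) *: c)]scalerA mul1r mulfV// scale1r addrK enormZ ger0_norm//.
  have : r' <= r / 2 by rewrite ge_min lexx orbT.
  lra.
have mN : measurable (normalize @^-1` A `&` unitball R n).
  apply: measurableI; last exact: measurable_unitball.
  by rewrite -[X in measurable X]setTI; apply: measurable_normalize.
rewrite sphE mule_gt0 ?lte_fin ?invr_gt0 ?fine_vol_unitball_gt0//.
rewrite (measureE vol mN) (integral_vol_affine ((1 / 2) *: c) r'0 (measurable_indicE mN)); last first.
  by move=> x; rewrite lee_fin.
rewrite mule_gt0 ?lte_fin ?exprn_gt0//.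
apply: (lt_le_trans (vol_unitball_gt0 n)).
rewrite (measureE vol (@measurable_unitball R n)); apply: ge0_le_integral => //.
- by apply: measurable_indicE; exact: measurable_unitball.
- apply: (measurableT_comp (measurable_indicE mN)).
  by apply: measurable_addv => //; exact: measurable_scalerv.
move=> x _; rewrite lee_fin !indicE ler_nat.
by case: (x \in unitball R n) / boolP => // /set_mem/sub/mem_set ->.
Qed.

Lemma mx_norm_le_enorm n (x : 'rV[R]_n) : `|x| <= enorm x.
Proof. by apply: mx_norm_le => [|i j]; [exact: enorm_ge0|rewrite ord1; exact: coord_le_enorm]. Qed.

Lemma enorm_tail n (x : 'rV[R]_n.+1) : enorm x ^+ 2 = x 0 0 ^+ 2 + enorm (tail0 x) ^+ 2.
Proof. by rewrite -{1}(rcons0K x) enorm_rcons0. Qed.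

Lemma rotate_to n (v : 'rV[R]_n.+1) : enorm v = 1 ->
  exists2 T : 'M[R]_n.+1, orthogmx T & forall x, dotv (x *m T) v = x 0 0.
Proof.
move=> v1; have [T [U [oT fU TU]]] := orthog_completion v1; exists T => // x.
have -> : v = rcons0 1 0 *m T by rewrite TU mul0mx addr0 scale1r.
rewrite dotv_frame// dotvE big_ord_recl rcons0_0 mulr1 big1 ?addr0// => i _.
by rewrite rcons0_lift mxE mulr0.
Qed.

Lemma savg_ge_cst n c (h : 'rV[R]_n.+1 -> R) : bmeas h -> (forall x, enorm x = 1 -> c <= h x) -> c <= savg h.
Proof.
move=> bh ch; rewrite -[c](@savg_cst R n.+1).
by apply: le_savg => //; exact: bmeas_cst.
Qed.

(** Used for a unit vector y with q = y_0^2, a = |y_0| and t the norm of its tail; since t <= 1, t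
    is at least t^2 = 1 - q. *)
Lemma tail_arith (q a t : R) : 0 <= q -> 0 <= t -> t ^+ 2 = 1 - q -> q <= a * (1 / 2) -> 1 - a <= t <= 1.
Proof.
move=> q0 t0 tq qa.
have t1 : t <= 1 by rewrite -(@expr_le1 _ 2)// tq lerBlDr lerDl.
have tt : t ^+ 2 <= t by rewrite expr2 ler_piMr.
by rewrite t1 andbT; lra.
Qed.

Lemma slab_arith (d0 d a b : R) : 0 < d0 -> d <= d0 / 3 -> a <= d -> 1 - a <= b -> a + (1 - b) < d0.
Proof. by move=> *; lra. Qed.

(* Points of the sphere in the slab of width d around the hyperplane v^perp are
   moved to that hyperplane; averaging over v gives back a multiple of the
   average over the whole sphere since the slab kernel is rotation invariant. *)
Lemma savg_hyperplane_ge0 m (h : 'rV[R]_m.+2 -> R) : {within unitsphere R m.+2, continuous h} ->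
  (forall U : 'M[R]_(m.+1, m.+2), isframe U -> 0 <= savg (fun y => hat h (y *m U))) ->
  0 <= savg (hat h).
Proof.
move=> ch hU; have bh := hat_bmeas ch.
apply/ler_addgt0Pr => w w0; rewrite addrC -lerBlDr sub0r.
have [d0 d00 unif] := compact_unif (@compact_unitsphere R m.+2) ch w0.
(* Below 1/2 the tail cannot vanish; d0/3 makes the displacement into the hyperplane, at most 2d,
   smaller than d0. *)
pose d := Num.min (1 / 2) (d0 / 3).
have d_gt0 : 0 < d by rewrite lt_min !divr_gt0.
have d_half : d <= 1 / 2 by rewrite ge_min lexx.
have d_d0 : d <= d0 / 3 by rewrite ge_min lexx orbT.
pose A : set (measurableTypeR R) := `[- d, d]%classic.
have mA : measurable A by exact: measurable_itv.
pose C := savg (fun y : 'rV[R]_m.+2 => \1_A (y 0 0)).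
have bA : bmeas (fun y : 'rV[R]_m.+2 => \1_A (y 0 0) : R).
  exact: (bmeas_comp (@measurable_coord R 1 m.+2 0 0) (bmeas_indic mA)).
have C0 : 0 < C.
  rewrite -lte_fin savg_fin//.
  have mAA : measurable [set y : 'rV[R]_m.+2 | A (y 0 0)].
    by rewrite -[X in measurable X]setTI; apply: (@measurable_coord R 1 m.+2 0 0).
  rewrite -(measureE (sph m.+2) mAA).
  apply: (@sph_gt0 _ (rcons0 0 (delta_mx 0 0)) (d / 2)) => //; last 2 first.
  - by rewrite divr_gt0.
  - move=> x Hx /=; rewrite normalize_coord /A/= in_itv/= -ler_norml normrM.
    have x0 : `|x 0 0| <= d / 2.
      apply: le_trans Hx; apply: le_trans (coord_le_enorm _ 0).
      by rewrite !mxE unlift_none subr0.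
    have xn : 1 / 2 <= enorm x.
      have := enormD x (- (x - rcons0 0 (delta_mx 0 0))).
      rewrite enormN opprB addrC subrK.
      rewrite (_ : enorm (rcons0 0 _) = 1); first lra.
      apply/eqP; rewrite -(@eqrXn2 _ 2) ?enorm_ge0// enorm_rcons0 expr0n add0r expr1n sqr_enorm dotvE big_ord_recl !mxE/= mulr1.
      by rewrite big1 ?addr0// => i _; rewrite !mxE/= mulr0.
    have xp : 0 < enorm x by lra.
    rewrite ger0_norm ?invr_ge0 ?enorm_ge0// mulrC ler_pdivrMr//.
    rewrite (le_trans x0)//; nra.
  - apply/eqP; rewrite -(@eqrXn2 _ 2) ?enorm_ge0// enorm_rcons0 expr0n add0r expr1n sqr_enorm dotvE big_ord_recl !mxE/= mulr1.
    by rewrite big1 ?addr0// => i _; rewrite !mxE/= mulr0.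
have bk : bmeas (fun p : 'rV[R]_m.+2 * 'rV[R]_m.+2 => \1_A (dotv p.1 p.2) : R).
  have md : measurable_fun setT (fun p : 'rV[R]_m.+2 * 'rV[R]_m.+2 => dotv p.1 p.2 : measurableTypeR R).
    by apply: measurable_dotv; [exact: measurable_fst|exact: measurable_snd].
  exact: (bmeas_comp md (bmeas_indic mA)).
have slabC (y : 'rV[R]_m.+2) : enorm y = 1 -> savg (fun x => \1_A (dotv x y)) = C.
  move=> y1; have [T oT HT] := rotate_to y1.
  rewrite -(savg_orthogmx oT); last exact: (bmeas_slice (F := fun y x => \1_A (dotv x y)) y (bmeas_swap (F := fun x y => \1_A (dotv x y)) bk)).
  by congr savg; apply/funext => x; rewrite HT.
(* Moving y to the direction of its component in v^perp changes h by at most w. By independence the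
   moved average is C times the average over the hyperplane, hence nonnegative, and the error is at
   most w times the slab mass C, a factor that later cancels. *)
have slabJ (v : 'rV[R]_m.+2) : enorm v = 1 -> - (w * C) <= savg (fun y => hat h y * \1_A (dotv v y)).
  move=> v1; have [T [U [oT fU TU]]] := orthog_completion v1.
  have vT y : dotv v (y *m T) = y 0 0.
    rewrite (_ : v = rcons0 1 0 *m T); last by rewrite TU mul0mx addr0 scale1r.
    rewrite dotv_frame// dotvE big_ord_recl rcons0_0 mul1r big1 ?addr0// => i _.
    by rewrite rcons0_lift mxE mul0r.
  have bf : bmeas (fun u => hat h (u *m U)) by apply: bmeas_comp bh; exact: measurable_mulmxr.
  have bhk : bmeas (fun y => hat h y * \1_A (dotv v y)).
    by apply: bmeasM => //; exact: (bmeas_slice (F := fun v y => \1_A (dotv v y)) v bk).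
  rewrite -(savg_orthogmx oT bhk).
  have bt : bmeas (fun y : 'rV[R]_m.+2 => hat h (normalize (tail0 y) *m U)).
    apply: (bmeas_comp (g := fun y : 'rV[R]_m.+2 => normalize (tail0 y)) _ bf).
    by apply: measurableT_comp; [exact: measurable_normalize|exact: measurable_tail0].
  apply: (@le_trans _ _ (savg (fun y : 'rV[R]_m.+2 => hat h (normalize (tail0 y) *m U) * \1_A (y 0 0) - w * \1_A (y 0 0)))).
    rewrite savgB; [|exact: bmeasM|by apply: bmeasM => //; exact: bmeas_cst].
    rewrite savgZ// -/C lerBrDr addrC subrr.
    rewrite (savg_tail_law mA bf); apply: mulr_ge0; [exact: hU|exact: ltW].
  have bTk : bmeas (fun y => hat h (y *m T) * \1_A (dotv v (y *m T))).
    by apply: (bmeas_comp _ bhk); exact: measurable_mulmxr.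
  apply: le_savg => //.
    by apply: bmeasB; [exact: bmeasM|apply: bmeasM => //; exact: bmeas_cst].
  move=> y y1; rewrite vT -mulrBl; rewrite indicE; case: (_ \in A) / boolP => [/set_mem|_]; last by rewrite !mulr0.
  rewrite /A/= in_itv/= -ler_norml !mulr1 => yd.
  have t2 : enorm (tail0 y) ^+ 2 = 1 - y 0 0 ^+ 2.
    by have := enorm_tail y; rewrite y1 expr1n => ->; rewrite addrC addKr.
  have y2 : y 0 0 ^+ 2 <= `|y 0 0| * (1 / 2).
    by rewrite -(real_normK (num_real (y 0 0))) expr2 ler_wpM2l// (le_trans yd).
  have tn0 : tail0 y != 0.
    rewrite -enorm_gt0 -(@ltr_pXn2r _ 2) ?nnegrE ?enorm_ge0// expr0n t2 subr_gt0.
    rewrite (le_lt_trans y2)// (le_lt_trans (ler_wpM2r _ yd))//; nra.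
  have tle : 1 - `|y 0 0| <= enorm (tail0 y) <= 1.
    by apply: (@tail_arith (y 0 0 ^+ 2)) => //; [exact: sqr_ge0|exact: enorm_ge0].
  rewrite lerBlDr -lerBlDl (le_trans (ler_norm _))// ltW//.
  have -> : hat h (normalize (tail0 y) *m U) = h (normalize (tail0 y) *m U).
    by rewrite hat_id// enorm_frame// enorm_normalize.
  have -> : hat h (y *m T) = h (y *m T) by rewrite hat_id// enorm_frame.
  apply: unif.
  - by rewrite /unitsphere/= enorm_frame// enorm_normalize.
  - by rewrite /unitsphere/= enorm_frame.
  rewrite (le_lt_trans (mx_norm_le_enorm _))//.
  rewrite -{2}(rcons0K y) TU opprD addrCA -mulmxBl.
  rewrite (le_lt_trans (enormD _ _))// enormN enormZ v1 mulr1 enorm_frame//.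
  have -> : normalize (tail0 y) - tail0 y = (1 - enorm (tail0 y)) *: normalize (tail0 y).
    by rewrite scalerBl scale1r normalizeK.
  have /andP[tl1 tl2] := tle.
  rewrite enormZ enorm_normalize// mulr1 [X in _ + X]ger0_norm ?subr_ge0//.
  exact: slab_arith d00 d_d0 yd tl1.
clearbody C.
have bF : bmeas (fun p : 'rV[R]_m.+2 * 'rV[R]_m.+2 => hat h p.2 * \1_A (dotv p.1 p.2)).
  by apply: bmeasM => //; apply: (bmeas_comp _ bh); exact: measurable_snd.
have SW := Rintegral_swap (sph m.+2) (sph m.+2) (F := fun v y => hat h y * \1_A (dotv v y)) bF.
have E2 : savg (fun y => savg (fun v => hat h y * \1_A (dotv v y))) = C * savg (hat h).
  rewrite -[RHS](savgZ C bh); apply: eq_savg.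
  - exact: (bmeas_Rintegral (sph m.+2) (sph m.+2) (F := fun y v => hat h y * \1_A (dotv v y)) (bmeas_swap (F := fun v y => hat h y * \1_A (dotv v y)) bF)).
  - exact: (bmeasM (bmeas_cst _ C) bh).
  move=> y y1; have bky := bmeas_slice (F := fun y x => \1_A (dotv x y)) y (bmeas_swap (F := fun x y => \1_A (dotv x y)) bk).
  by apply: (etrans (savgZ (hat h y) bky)); rewrite (slabC y y1) mulrC.
have E1 : - (w * C) <= savg (fun v => savg (fun y => hat h y * \1_A (dotv v y))).
  apply: (savg_ge_cst _ slabJ).
  exact: (bmeas_Rintegral (sph m.+2) (sph m.+2) (F := fun v y => hat h y * \1_A (dotv v y)) bF).
have H : - (w * C) <= C * savg (hat h).
  by apply: (le_trans E1); rewrite le_eqVlt; apply/orP; left; apply/eqP; exact: (etrans SW E2).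
by move: H; rewrite -mulNr [X in X <= _]mulrC (ler_pM2l C0) lerNl.
Qed.

End hyperplane_step.

(** * The Brunn-Minkowski inequality *)

Section brunn_minkowski.
Context {R : realType}.
Local Open Scope ereal_scope.
Notation leb := (@lebesgue_measure R).

Let affset (A : set R) (m : R) : set R := [set z | A (2 * z + - m)%R].

Let measurable_affset (A : set (measurableTypeR R)) m : measurable A -> measurable (affset A m : set (measurableTypeR R)).
Proof.
move=> mA; rewrite -[X in measurable X]setTI; apply: (_ : measurable_fun setT (fun z : measurableTypeR R => 2 * z + - m)%R) => //.
by apply: measurable_funD => //; exact: measurable_funM.
Qed.

(** With M = max A and m = min B, the sets (A + m)/2 and (B + M)/2 both lie in H, the first to the
    left and the second to the right of p = (M + m)/2, so they meet at most in p. Here [affset A m]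
    is (A + m)/2. *)
Let bm_compact (A B H : set (measurableTypeR R)) : compact (A : set R) -> compact (B : set R) -> measurable H ->
  A !=set0 -> B !=set0 -> (forall x y, A x -> B y -> H (2^-1 * (x + y))%R) ->
  leb A + leb B <= 2%:E * leb H.
Proof.
move=> cA cB mH A0 B0 ABH.
have cid C : {within C, continuous (@id R)} by apply: continuous_subspaceT => x; exact: cvg_id.
have mA := compact_measurable cA; have mB := compact_measurable cB.
have [M AM hM] : exists2 M, A M & forall x, A x -> (x <= M)%R.
  have [c /set_mem Ac hc] := @compact_EVT_max R R id A A0 cA (cid _).
  by exists c => // x Bx; apply: hc; exact/mem_set.
have [m Bm hm] : exists2 m, B m & forall x, B x -> (m <= x)%R.
  have [c /set_mem Ac hc] := @compact_EVT_min R R id B B0 cB (cid _).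
  by exists c => // x Bx; apply: hc; exact/mem_set.
pose p : measurableTypeR R := (2^-1 * (M + m))%R.
rewrite (lebesgue_affine (- m)%R (ltr0n R 2) mA) (lebesgue_affine (- M)%R (ltr0n R 2) mB).
rewrite -muleDr ?ge0_adde_def ?inE//.
rewrite lee_pmul2l//.
pose A' := affset A m `\ p; pose B' := affset B M.
have mA' : measurable A' by apply: measurableD => //; exact: measurable_affset.
have mB' : measurable B' by exact: measurable_affset.
have le_A' : leb (affset A m) <= leb A'.
  have -> : leb A' = leb A' + leb [set p] by rewrite lebesgue_measure_set1 adde0.
  have mp : measurable ([set p] : set (measurableTypeR R)) by [].
  apply: (@le_trans _ _ (leb (A' `|` [set p]))); last exact: measureU2.
  apply: le_measure; rewrite ?inE//; [exact: measurable_affset|exact: measurableU|].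
  by move=> z Az; have [->|zp] := eqVneq z p; [right|left; split => //= /eqP; rewrite (negPf zp)].
apply: le_trans (leeD2r _ le_A') _; rewrite -measureU//.
- apply: le_measure; rewrite ?inE//; first exact: measurableU.
  move=> z [[Az _]|Bz].
    by have := ABH _ _ Az Bm; rewrite (_ : (2^-1 * _ = z)%R)//; lra.
  by have := ABH _ _ AM Bz; rewrite (_ : (2^-1 * _ = z)%R)//; lra.
- apply/seteqP; split => // z [[Az zp] Bz]; case: zp => /=.
  have := hM _ Az; have := hm _ Bz => /= ? ?; rewrite /p; lra.
Qed.

(** Inner regularity reduces to compact sets, one set at a time, since a measure must be known to be
    finite before it is moved across. The points a and b are added to keep the compact sets
    nonempty. *)
Lemma brunn_minkowski1 (A B H : set (measurableTypeR R)) : measurable A -> measurable B -> measurable H ->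
  A !=set0 -> B !=set0 -> (forall x y, A x -> B y -> H (2^-1 * (x + y))%R) ->
  leb A + leb B <= 2%:E * leb H.
Proof.
move=> mA mB mH [a Aa] [b Bb] ABH.
have [->|Hoo] := eqVneq (leb H) +oo; first by rewrite mulry gtr0_sg// mul1e leey.
have Hfin : leb H \is a fin_num by rewrite ge0_fin_numE// ltey.
have step K L : compact (K : set R) -> compact (L : set R) -> K `<=` A -> L `<=` B ->
    leb K + leb L <= 2%:E * leb H.
  move=> cK cL KA LB.
  have c1 (x : R) (S : set R) : compact S -> compact (S `|` [set x]).
    by move=> cS; apply: compactU => //; exact: compact_set1.
  apply: (@le_trans _ _ (leb (K `|` [set a]) + leb (L `|` [set b]))).
    by apply: leeD; apply: le_measure; rewrite ?inE//; try exact: subsetUl;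
      apply: compact_measurable => //; exact: c1.
  apply: bm_compact => //; [exact: c1|exact: c1|by exists a; right|by exists b; right|].
  by move=> x y [/KA Ax|->] [/LB By|->]; exact: ABH.
have oo2 : 2%:E * leb H \is a fin_num by rewrite fin_numM.
have stepL L : compact (L : set R) -> L `<=` B -> leb A + leb L <= 2%:E * leb H.
  move=> cL LB.
  have Lfin : leb L \is a fin_num.
    rewrite ge0_fin_numE//; apply: (@le_lt_trans _ _ (2%:E * leb H)); last by rewrite ltey_eq oo2.
    by have := step set0 L (@compact0 _) cL (@sub0set _ _) LB; rewrite measure0 add0e.
  rewrite -leeBrDr// (lebesgue_regularity_inner_sup mA).
  apply: ge_ereal_sup => _ [K [cK KA] <-]; rewrite leeBrDr//; exact: step.
have Afin : leb A \is a fin_num.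
  rewrite ge0_fin_numE//; apply: (@le_lt_trans _ _ (2%:E * leb H)); last by rewrite ltey_eq oo2.
  by have := stepL set0 (@compact0 _) (@sub0set _ _); rewrite measure0 adde0.
rewrite addeC -leeBrDr// (lebesgue_regularity_inner_sup mB).
apply: ge_ereal_sup => _ [K [cK KA] <-]; rewrite leeBrDr// addeC; exact: stepL.
Qed.

Let measurable_sublevel d (T : measurableType d) (f : T -> R) : measurable_fun setT f ->
  measurable [set q : T * measurableTypeR R | (0 <= q.2 < f q.1)%R].
Proof.
move=> mf; rewrite (_ : mkset _ = [set q : T * measurableTypeR R | (0 <= q.2)%R] `&` [set q | (q.2 < f q.1)%R]).
  apply: measurableI.
    rewrite -[X in measurable X]setTI.
    apply: (_ : measurable_fun setT (fun q : T * measurableTypeR R => 0 <= q.2)%R) => //.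
    by apply: measurable_fun_ler => //; exact: measurable_snd.
  rewrite -[X in measurable X]setTI.
  apply: (_ : measurable_fun setT (fun q : T * measurableTypeR R => q.2 < f q.1)%R) => //.
  by apply: measurable_fun_ltr; [exact: measurable_snd|exact: (measurableT_comp mf measurable_fst)].
by apply/seteqP; split => q /=; [move=> /andP[]|move=> [-> ->]].
Qed.

Lemma layer_cake (f : measurableTypeR R -> R) : measurable_fun setT f -> (forall x, 0 <= f x)%R ->
  \int[leb]_x (f x)%:E = \int[leb]_t leb [set x | (0 <= t < f x)%R].
Proof.
move=> mf f0.
have mS := measurable_sublevel mf.
transitivity (\int[leb]_x \int[leb]_t (\1_[set q : measurableTypeR R * measurableTypeR R | (0 <= q.2 < f q.1)%R] (x, t) : R)%:E).
  apply: eq_integral => x _.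
  have -> : (fun t => (\1_[set q : measurableTypeR R * measurableTypeR R | (0 <= q.2 < f q.1)%R] (x, t) : R)%:E) =
     fun t => (\1_`[0, f x[%classic%R t)%:E.
    by apply/funext => t; congr EFin; apply: eq_indic; rewrite /= in_itv.
  rewrite -measureE; last exact: measurable_itv.
  have := @lebesgue_measure_itv R `[0%R, f x[; rewrite /= lte_fin sube0 => ->.
  by case: ltP => // fx; apply/congr1/le_anti; rewrite f0 fx.
rewrite (@tonelli R _ _ _ _ leb leb ( fun x t => (\1_[set q : measurableTypeR R * measurableTypeR R | (0 <= q.2 < f q.1)%R] (x, t) : R)%:E))//.
  apply: eq_integral => t _; rewrite -measureE//.
  have mp : measurable_fun setT (fun x : measurableTypeR R => (x, t : measurableTypeR R)).
    exact: measurable_fun_pair.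
  by have := mp measurableT _ mS; rewrite setTI.
rewrite [X in measurable_fun _ X](_ : _ = fun q => (\1_[set q : measurableTypeR R * measurableTypeR R | (0 <= q.2 < f q.1)%R] q)%:E).
  exact: measurable_indicE.
by apply/funext => -[].
Qed.

(** When f and g both have supremum 1, their superlevel sets at t < 1 are nonempty together and
    empty together for t >= 1. One-dimensional Brunn-Minkowski thus applies at every level and
    yields an additive inequality. *)
Let pl_normalized (f g h : measurableTypeR R -> R) : measurable_fun setT f -> measurable_fun setT g ->
  measurable_fun setT h -> (forall x, 0 <= f x <= 1)%R -> (forall x, 0 <= g x <= 1)%R -> (forall x, 0 <= h x)%R ->
  (forall t, t < 1 -> exists x, t < f x)%R -> (forall t, t < 1 -> exists x, t < g x)%R ->
  (forall x y, f x * g y <= h (2^-1 * (x + y)) ^+ 2)%R ->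
  \int[leb]_x (f x)%:E + \int[leb]_x (g x)%:E <= 2%:E * \int[leb]_x (h x)%:E.
Proof.
move=> mf mg mh f01 g01 h0 fs gs fgh.
have mlev (k : measurableTypeR R -> R) t : measurable_fun setT k -> measurable [set x | (0 <= t < k x)%R].
  move=> mk; have mp : measurable_fun setT (fun x : measurableTypeR R => (x, t : measurableTypeR R)).
    exact: measurable_fun_pair.
  by have := mp measurableT _ (measurable_sublevel mk); rewrite setTI.
have mint (k : measurableTypeR R -> R) : measurable_fun setT k ->
    measurable_fun setT (fun t : measurableTypeR R => leb [set x | (0 <= t < k x)%R]).
  move=> mk; have := measurable_fun_ysection leb (measurable_sublevel mk).
  rewrite [X in measurable_fun _ X](_ : _ = fun t : measurableTypeR R => leb [set x | (0 <= t < k x)%R])//.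
  by apply/funext => t; congr leb; apply/seteqP; split => x; rewrite /ysection/= inE.
have f0 x : (0 <= f x)%R by case/andP: (f01 x).
have g0 x : (0 <= g x)%R by case/andP: (g01 x).
rewrite !layer_cake//.
rewrite -ge0_integralD//; [|exact: mint|exact: mint].
rewrite -(ge0_integralZlT leb (mint _ mh))//.
apply: ge0_le_integral => //.
- by move=> t _; rewrite adde_ge0.
- by apply: emeasurable_funD; exact: mint.
- by apply: measurable_funeM; exact: mint.
move=> t _; have [t0|t0] := leP 0%R t; last first.
  have E (k : measurableTypeR R -> R) : [set x | (false && (t < k x))%R] = set0 by apply/seteqP; split.
  by rewrite !E !measure0 adde0 mule0.
have [t1|t1] := ltP t 1%R; last first.
  have E (k : measurableTypeR R -> R) : (forall x, 0 <= k x <= 1)%R -> [set x | (true && (t < k x))%R] = set0.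
    move=> k01; apply/seteqP; split => // x /=; have /andP[_ k1] := k01 x.
    by move=> /lt_le_trans/(_ k1); rewrite ltNge t1.
  by rewrite (E f)// (E g)// !measure0 adde0 mule_ge0.
have ml (k : measurableTypeR R -> R) : measurable_fun setT k -> measurable [set x | (true && (t < k x))%R].
  by move=> /(mlev k t); rewrite t0.
apply: brunn_minkowski1; [exact: ml|exact: ml|exact: ml|exact: fs|exact: gs|].
move=> x y /= tf tg; rewrite -(ltr_pXn2r (n := 2))// ?nnegrE//.
by apply: lt_le_trans (fgh x y); rewrite expr2; apply: ltr_pM.
Qed.

Let amgm (x y z : R) : (0 <= x -> 0 <= y -> x + y <= 2 * z -> x * y <= z ^+ 2)%R.
Proof.
move=> x0 y0 xy; apply: (@le_trans _ _ ((2^-1 * (x + y)) ^+ 2)%R).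
  rewrite -subr_ge0 (_ : _ - _ = (2^-1 * (x - y)) ^+ 2)%R ?sqr_ge0//; by field.
by rewrite ler_pXn2r ?nnegrE//; lra.
Qed.

(** Dividing f and g by their suprema a and b, and h by sqrt(a b), keeps the hypothesis and
    normalizes; [amgm] then passes from the sum to the product. *)
Let pl1 (M : R) (f g h : measurableTypeR R -> R) : measurable_fun setT f -> measurable_fun setT g ->
  measurable_fun setT h -> (forall x, 0 <= f x <= M)%R -> (forall x, 0 <= g x <= M)%R -> (forall x, 0 <= h x)%R ->
  \int[leb]_x (f x)%:E < +oo -> \int[leb]_x (g x)%:E < +oo -> \int[leb]_x (h x)%:E < +oo ->
  (forall x y, f x * g y <= h (2^-1 * (x + y)) ^+ 2)%R ->
  (Rintegral leb setT f * Rintegral leb setT g <= Rintegral leb setT h ^+ 2)%R.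
Proof.
move=> mf mg mh fM gM h0 foo goo hoo fgh.
have supP (k : measurableTypeR R -> R) : (forall x, 0 <= k x <= M)%R ->
    [/\ 0 <= sup (range k), forall x, k x <= sup (range k) & forall t, t < sup (range k) -> exists x, t < k x]%R.
  move=> kM; have hs : has_sup (range k).
    by split; [exists (k 0%R); exists 0%R|exists M => _ [x _ <-]; case/andP: (kM x)].
  have ub x : (k x <= sup (range k))%R by apply: ub_le_sup; [case: hs|exists x].
  split => //; first by apply: le_trans (ub 0%R); case/andP: (kM 0%R).
  by move=> t /(sup_gt (proj1 hs)) [_ [x _ <-] tx]; exists x.
have [a0 fa sa] := supP _ fM; have [b0 gb sb] := supP _ gM.
set a := sup (range f) in a0 fa sa; set b := sup (range g) in b0 gb sb.
have f0 x : (0 <= f x)%R by case/andP: (fM x).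
have g0 x : (0 <= g x)%R by case/andP: (gM x).
have zero (k : measurableTypeR R -> R) : (forall x, 0 <= k x <= 0)%R -> Rintegral leb setT k = 0%R.
  move=> k0; rewrite (_ : k = cst 0%R) ?Rintegral_cst ?mul0r//.
  by apply/funext => x; apply/le_anti; rewrite andbC k0.
have [aE|aN] := eqVneq a 0%R.
  by rewrite (zero f) ?mul0r ?sqr_ge0// => x; rewrite f0 -aE fa.
have [bE|bN] := eqVneq b 0%R.
  by rewrite (zero g) ?mulr0 ?sqr_ge0// => x; rewrite g0 -bE gb.
have {a0 aN} a0 : (0 < a)%R by rewrite lt_def aN.
have {b0 bN} b0 : (0 < b)%R by rewrite lt_def bN.
pose c := Num.sqrt (a * b)%R.
have c0 : (0 < c)%R by rewrite sqrtr_gt0 mulr_gt0.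
have c2 : (c ^+ 2 = a * b)%R by rewrite sqr_sqrtr// mulr_ge0// ltW.
have mZ s (k : measurableTypeR R -> R) : measurable_fun setT k -> measurable_fun setT (fun x => s^-1 * k x)%R.
  by move=> mk; exact: measurable_funM.
have intZ s (k : measurableTypeR R -> R) : (0 < s)%R -> measurable_fun setT k -> (forall x, 0 <= k x)%R ->
    \int[leb]_x (k x)%:E < +oo ->
    \int[leb]_x (s^-1 * k x)%:E = (s^-1 * Rintegral leb setT k)%:E.
  move=> s0 mk k0 koo; under eq_integral do rewrite EFinM.
  rewrite (ge0_integralZlT leb); [|exact/measurable_EFinP|by move=> x; rewrite lee_fin|by rewrite lee_fin invr_ge0 ltW].
  by rewrite EFinM /Rintegral fineK// ge0_fin_numE// integral_ge0// => x _; rewrite lee_fin.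
have := @pl_normalized (fun x => a^-1 * f x)%R (fun x => b^-1 * g x)%R (fun x => c^-1 * h x)%R
  (mZ _ _ mf) (mZ _ _ mg) (mZ _ _ mh).
rewrite !intZ// -EFinD -EFinM lee_fin => /(_ _ _ _ _ _ _)/amgm H.
have {H} : (a^-1 * Rintegral leb setT f * (b^-1 * Rintegral leb setT g) <= (c^-1 * Rintegral leb setT h) ^+ 2)%R.
  have pos s (k : measurableTypeR R -> R) : (0 < s)%R -> (forall x, 0 <= k x)%R -> (0 <= s^-1 * Rintegral leb setT k)%R.
    by move=> s0 k0; rewrite mulr_ge0 ?invr_ge0 ?(ltW s0)// Rintegral_ge0.
  apply: H; try exact: pos.
  - by move=> x; rewrite mulr_ge0 ?invr_ge0 ?(ltW a0)//= mulrC ler_pdivrMr// mul1r.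
  - by move=> x; rewrite mulr_ge0 ?invr_ge0 ?(ltW b0)//= mulrC ler_pdivrMr// mul1r.
  - by move=> x; rewrite mulr_ge0 ?invr_ge0 ?(ltW c0).
  - move=> t t1; have [|x tx] := sa (t * a)%R; first by rewrite -[ltRHS]mul1r ltr_pM2r.
    by exists x; rewrite mulrC ltr_pdivlMr.
  - move=> t t1; have [|x tx] := sb (t * b)%R; first by rewrite -[ltRHS]mul1r ltr_pM2r.
    by exists x; rewrite mulrC ltr_pdivlMr.
  - move=> x y; rewrite mulrACA exprMn exprVn c2 invfM.
    by rewrite ler_wpM2l// mulr_ge0// invr_ge0 ltW.
rewrite mulrACA exprMn exprVn c2 invfM ler_pM2l// mulr_gt0// invr_gt0//.
Qed.

Let boxed_Rintegral n (M r : R) (f : 'rV[R]_n -> R) : (0 <= M)%R -> (0 <= r)%R ->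
  measurable_fun setT f -> boxed M r f ->
  (Rintegral vol setT f)%:E = \int[vol]_x (f x)%:E.
Proof.
move=> M0 r0 mf bf; rewrite /Rintegral fineK// ge0_fin_numE.
  by apply: le_lt_trans (boxed_integral M0 r0 mf bf) _; rewrite ltry.
by apply: integral_ge0 => x _; rewrite lee_fin; case/andP: (bf x).
Qed.

(** The functional form is what survives slicing: by the induction hypothesis the slice integrals of
    f, g, h satisfy the one-dimensional hypothesis, although they are no indicators even when f, g,
    h are. *)
Lemma prekopa_leindler n (M r : R) (f g h : 'rV[R]_n -> R) : (0 <= M)%R -> (0 <= r)%R ->
  measurable_fun setT f -> measurable_fun setT g -> measurable_fun setT h ->
  boxed M r f -> boxed M r g -> boxed M r h ->
  (forall x y, f x * g y <= h (2^-1 *: (x + y)) ^+ 2)%R ->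
  (Rintegral vol setT f * Rintegral vol setT g <= Rintegral vol setT h ^+ 2)%R.
Proof.
move=> M0 r0; elim: n f g h => [|n IH] f g h mf mg mh bf bg bh fgh.
  have E (k : 'rV[R]_0 -> R) : measurable_fun setT k -> boxed M r k -> Rintegral vol setT k = k 0%R.
    by move=> mk bk; rewrite /Rintegral -lebintE//=; [exact/measurable_EFinP|move=> x; rewrite lee_fin; case/andP: (bk x)].
  rewrite !E//; have := fgh 0%R 0%R; rewrite (_ : 2^-1 *: _ = 0 :> 'rV[R]_0)%R//.
  by apply/rowP => -[].
pose S (k : 'rV[R]_n.+1 -> R) (x : R) (t : 'rV[R]_n) := k (rcons0 x t).
have bS k x : boxed M r k -> boxed M r (S k x).
  move=> bk t; have /andP[-> /le_trans/=] := bk (rcons0 x t); apply.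
  rewrite ler_wpM2l// !indicE ler_nat; case: (_ \in _) / boolP => //= /set_mem/= H.
  by rewrite mem_set// => i; have := H (lift ord0 i); rewrite rcons0_lift.
have mS k x : measurable_fun setT k -> measurable_fun setT (S k x).
  by move=> mk; apply: (measurableT_comp mk); exact: measurable_rcons0_r.
pose F (k : 'rV[R]_n.+1 -> R) (x : measurableTypeR R) : R := Rintegral vol setT (S k x).
have FE k x : measurable_fun setT k -> boxed M r k -> (F k x)%:E = \int[vol]_t (k (rcons0 x t))%:E.
  by move=> mk bk; exact: (boxed_Rintegral M0 r0 (mS _ _ mk) (bS _ _ bk)).
have k0 (k : 'rV[R]_n.+1 -> R) : boxed M r k -> forall x, 0 <= (k x)%:E.
  by move=> bk x; rewrite lee_fin; case/andP: (bk x).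
have mF k : measurable_fun setT k -> boxed M r k -> measurable_fun setT (F k).
  move=> mk bk; apply/measurable_EFinP; rewrite (_ : _ \o _ = fun x => \int[vol]_t (k (rcons0 x t))%:E).
    by apply: (measurable_vol_inner (F := fun x => (k x)%:E)) => //; [exact/measurable_EFinP|exact: k0].
  by apply/funext => x; exact: FE.
have FI k : measurable_fun setT k -> boxed M r k -> \int[leb]_x (F k x)%:E = \int[vol]_x (k x)%:E.
  move=> mk bk; rewrite (integral_volS (F := fun x => (k x)%:E)); [|exact/measurable_EFinP|exact: k0].
  by apply: eq_integral => x _; exact: FE.
have F0 k x : boxed M r k -> (0 <= F k x)%R.
  by move=> bk; apply: Rintegral_ge0 => t _; case/andP: (bS _ x bk t).
have Foo k : measurable_fun setT k -> boxed M r k -> \int[leb]_x (F k x)%:E < +oo.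
  by move=> mk bk; rewrite FI//; apply: le_lt_trans (boxed_integral M0 r0 mk bk) _; rewrite ltry.
have FR k : measurable_fun setT k -> boxed M r k -> Rintegral vol setT k = Rintegral leb setT (F k).
  by move=> mk bk; rewrite /Rintegral FI.
have FM k x : measurable_fun setT k -> boxed M r k -> (0 <= F k x <= M * (2 * r) ^+ n)%R.
  move=> mk bk; rewrite F0//= -lee_fin FE//; exact: (boxed_integral M0 r0 (mS _ _ mk) (bS _ _ bk)).
rewrite !FR//; apply: (@pl1 (M * (2 * r) ^+ n)%R); try by [exact: mF|exact: Foo|move=> x; exact: FM|move=> x; exact: F0].
move=> x y; apply: IH; try by [exact: mS|exact: bS].
move=> s t; apply: le_trans (fgh _ _) _; rewrite /S (_ : 2^-1 *: _ = rcons0 (2^-1 * (x + y)) (2^-1 *: (s + t)))%R//.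
by apply/rowP => j; rewrite !mxE; case: (unlift ord0 j) => [k|]; rewrite ?mxE.
Qed.

(** For equal volumes the multiplicative form says that the square of vol A is at most that of vol
    H, so no n-th roots appear. *)
Lemma vol_midpoint n (r : R) (A B H : set 'rV[R]_n) : (0 <= r)%R ->
  measurable A -> measurable B -> measurable H ->
  (forall x i, A x -> `|x 0 i| <= r)%R -> (forall x i, B x -> `|x 0 i| <= r)%R ->
  (forall x i, H x -> `|x 0 i| <= r)%R ->
  (forall x y, A x -> B y -> H (2^-1 *: (x + y))%R) -> vol A = vol B -> vol A <= vol H.
Proof.
move=> r0 mA mB mH rA rB rH ABH AB.
have mI (S : set 'rV[R]_n) : measurable S -> measurable_fun setT (\1_S : 'rV[R]_n -> R).
  by move=> mS; exact: measurable_indic.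
have bI (S : set 'rV[R]_n) : (forall x i, S x -> `|x 0 i| <= r)%R -> boxed 1 r (\1_S).
  move=> rS x; rewrite mul1r !indicE ler_nat ler0n/=; case: (_ \in S) / boolP => //= /set_mem Sx.
  by rewrite mem_set// => i; exact: rS.
have RI (S : set 'rV[R]_n) : measurable S -> (forall x i, S x -> `|x 0 i| <= r)%R ->
    (Rintegral vol setT (\1_S))%:E = vol S.
  by move=> mS rS; rewrite (measureE vol mS) (boxed_Rintegral ler01 r0 (mI _ mS) (bI _ rS)).
have := prekopa_leindler ler01 r0 (mI _ mA) (mI _ mB)
  (mI _ mH) (bI _ rA) (bI _ rB) (bI _ rH).
have -> : Rintegral vol setT (\1_B : 'rV[R]_n -> R) = Rintegral vol setT (\1_A : 'rV[R]_n -> R).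
  by apply: EFin_inj; rewrite !RI// AB.
rewrite -(RI A)// -(RI H)// lee_fin -expr2 ler_pXn2r ?nnegrE//; [|exact: Rintegral_ge0|exact: Rintegral_ge0].
apply => x y; rewrite !indicE; case: (x \in A) / boolP => [/set_mem Ax|_]; last by rewrite mul0r sqr_ge0.
case: (y \in B) / boolP => [/set_mem By|_]; last by rewrite mulr0 sqr_ge0.
by rewrite mem_set ?expr1n ?mulr1//; exact: ABH.
Qed.

(** The side slabs are mirror images, and a midpoint of one point from each lies in the central
    slab; the half-open ends make the midpoint inequalities strict. So each of the three parts has
    at most the central volume. *)
Lemma vol_slab n (r h : R) (xi : 'rV[R]_n) (K : set 'rV[R]_n) : (0 <= r)%R -> measurable K ->
  (forall x i, K x -> `|x 0 i| <= r)%R -> (forall x, K x -> K (- x)%R) ->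
  (forall x y, K x -> K y -> K (2^-1 *: (x + y))%R) ->
  vol (K `&` [set x | (`|dotv x xi| < 3 * h)%R]) <= 3%:E * vol (K `&` [set x | (`|dotv x xi| < h)%R]).
Proof.
move=> r0 mK rK sK cK.
pose S (D : set R) := K `&` [set x | D (dotv x xi)].
have mS (D : set (measurableTypeR R)) : measurable D -> measurable (S D).
  move=> mD; apply: measurableI => //; rewrite -[X in measurable X]setTI.
  have md : measurable_fun setT (fun x : 'rV[R]_n => dotv x xi) by exact: measurable_dotv.
  exact: (md measurableT _ mD).
have rS D x i : S D x -> (`|x 0 i| <= r)%R by move=> [Kx _]; exact: rK.
pose A := S `[h, 3 * h[%classic%R; pose B := S `]- (3 * h), - h]%classic%R.
pose C := S `]- h, h[%classic%R.
have mA : measurable A by apply: mS; exact: measurable_itv.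
have mB : measurable B by apply: mS; exact: measurable_itv.
have mC : measurable C by apply: mS; exact: measurable_itv.
have AB : vol A = vol B.
  rewrite (measureE vol mA) (measureE vol mB).
  have oN : orthogmx (- 1%:M : 'M[R]_n)%R.
    by rewrite /orthogmx linearN/= trmx1 mulmxN mulNmx opprK mulmx1.
  transitivity (\int[vol]_x (\1_B (x *m (- 1%:M))%R : R)%:E).
    apply: eq_integral => x _; congr EFin; apply: eq_indic.
    rewrite mulmxN mulmx1 /A /B /S /= !in_itv/= dotvNl lerN2 ltrN2 andbC.
    by split => -[/sK]; rewrite ?opprK.
  by rewrite (integral_vol_orthogmx (F := fun x => (\1_B x)%:E))//; exact: measurable_indicE.
have AC : vol A <= vol C.
  apply: (@vol_midpoint n r A B C) => //; try exact: rS.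
  move=> x y [Kx /=]; rewrite in_itv/= => /andP[x1 x2] [Ky /=]; rewrite in_itv/= => /andP[y1 y2].
  split; first exact: cK.
  by rewrite /= in_itv/= dotvZl dotvDl; apply/andP; split; lra.
have CE : C = K `&` [set x | (`|dotv x xi| < h)%R].
  by congr (K `&` _); apply/seteqP; split => x; rewrite /= in_itv/= -ltr_norml.
rewrite -CE; apply: (@le_trans _ _ (vol (A `|` B `|` C))).
  apply: le_measure; rewrite ?inE.
  - rewrite (_ : _ `&` _ = S `]- (3 * h), 3 * h[%classic%R); first by apply: mS; exact: measurable_itv.
    by congr (K `&` _); apply/seteqP; split => x; rewrite /= in_itv/= -ltr_norml.
  - by apply: measurableU => //; exact: measurableU.
  move=> x [Kx /=]; rewrite ltr_norml => /andP[x1 x2].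
  have [xh|hx] := leP h (dotv x xi); first by left; left; split => //=; rewrite in_itv/= xh x2.
  have [xh|hx'] := leP (dotv x xi) (- h)%R; first by left; right; split => //=; rewrite in_itv/= xh x1.
  by right; split => //=; rewrite in_itv/= hx hx'.
apply: le_trans (measureU2 _ _ _) _ => //; first exact: measurableU.
have tri (x : \bar R) : 0 <= x -> 3%:E * x = x + x + x.
  move=> x0; have -> : 3%:E = 1 + 1 + 1 :> \bar R by rewrite -!EFinD; congr EFin; ring.
  by rewrite !ge0_muleDl ?lee_fin// !mul1e.
rewrite tri//; apply: leeD => //.
apply: le_trans (measureU2 _ _ _) _ => //.
by apply: leeD => //; apply: le_trans AC; rewrite [X in _ <= X]AB.
Qed.

End brunn_minkowski.

(** * Radial functions of symmetric convex bodies *)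

Section symmetric_bodies.
Context {R : realType}.

(** The inner and outer radii are explicit because they pass unchanged to sections and control all
    estimates. *)
Definition symbody n (r b : R) (K : set 'rV[R]_n) :=
  [/\ closed K, forall x y t, 0 <= t <= 1 -> K x -> K y -> K (t *: x + (1 - t) *: y),
      forall x, K x -> K (- x), forall x, enorm x <= r -> K x &
      forall x, K x -> enorm x <= b].

Variables (n : nat) (r b : R) (K : set 'rV[R]_n).
Hypotheses (r0 : 0 < r) (bK : symbody r b K).

Lemma symbody_measurable : measurable K.
Proof. by case: bK => cK _ _ _ _; exact: closed_mx_measurable. Qed.

Lemma symbody_scale x t : 0 <= t <= 1 -> K x -> K (t *: x).
Proof.
case: bK => _ cK _ rK _ t01 Kx.
have := cK x 0 t t01 Kx; rewrite scaler0 addr0; apply; apply: rK.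
by rewrite enorm0 ltW.
Qed.

Let S th : set R := [set s | 0 <= s /\ K (s *: th)].

Let S_sup th : enorm th = 1 -> has_sup (S th).
Proof.
case: bK => _ _ _ rK Kb th1; split.
  by exists 0; split => //; rewrite scale0r; apply: rK; rewrite enorm0 ltW.
exists b => s [s0 Ks]; apply: le_trans (Kb _ Ks).
by rewrite enormZ th1 mulr1 ger0_norm.
Qed.

Lemma radial_ub th s : enorm th = 1 -> K (s *: th) -> `|s| <= radial K th.
Proof.
move=> th1 Ks; apply: ub_le_sup; first by case: (S_sup th1).
split; first exact: normr_ge0.
have [s0|s0] := leP 0 s; first by rewrite ger0_norm.
by case: bK => _ _ sK _ _; rewrite ltr0_norm// scaleNr; exact: sK.
Qed.

Lemma radial_in th s : enorm th = 1 -> `|s| < radial K th -> K (s *: th).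
Proof.
move=> th1 /(sup_gt (proj1 (S_sup th1)))[t [t0 Kt] st].
have [s0|s0] := leP 0 s.
  have -> : s *: th = (s / t) *: (t *: th).
    by rewrite scalerA divfK// gt_eqF// (le_lt_trans _ st).
  apply: symbody_scale => //; rewrite divr_ge0//= ler_pdivrMr ?(le_lt_trans _ st)// mul1r.
  by apply: ltW; apply: le_lt_trans st; exact: ler_norm.
have -> : s *: th = - ((- s / t) *: (t *: th)).
  by rewrite scalerA divfK ?scaleNr ?opprK// gt_eqF// (le_lt_trans _ st).
case: (bK) => _ _ sK _ _; apply: sK.
rewrite ltr0_norm// in st.
by apply: symbody_scale => //; rewrite divr_ge0 ?oppr_ge0 ?(ltW s0)//= ler_pdivrMr ?mul1r ?ltW// (le_lt_trans _ st)// oppr_ge0 ltW.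
Qed.

Lemma radial_ge th : enorm th = 1 -> r <= radial K th.
Proof.
move=> th1; rewrite -(ger0_norm (ltW r0)); apply: radial_ub => //.
by case: bK => _ _ _ rK _; apply: rK; rewrite enormZ th1 mulr1 ger0_norm// ltW.
Qed.

Lemma radial_le th : enorm th = 1 -> radial K th <= b.
Proof.
move=> th1; apply: ge_sup; first by case: (S_sup th1).
case: bK => _ _ _ _ Kb s [s0 /Kb]; by rewrite enormZ th1 mulr1 ger0_norm.
Qed.

(* The gauge of K is (1/r)-Lipschitz because K contains the ball of radius r. *)
Lemma radial_line th w s e : enorm th = 1 -> 0 < e -> enorm w <= e * r -> K (s *: th + w) ->
  `|s| <= (1 + e) * radial K th.
Proof.
move=> th1 e0 we Kw; case: (bK) => _ cK _ rK _.
have e1 : 0 < 1 + e by rewrite addr_gt0.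
suff : K ((s / (1 + e)) *: th).
  by move=> /(radial_ub th1); rewrite normrM normfV (gtr0_norm e1) ler_pdivrMr// mulrC.
(* The point -w/e lies in the inner ball and gets weight e/(1+e), so the two multiples of w
   cancel. *)
have -> : (s / (1 + e)) *: th = (1 + e)^-1 *: (s *: th + w) + (1 - (1 + e)^-1) *: (- e^-1 *: w).
  rewrite scalerDr !scalerA -addrA -scalerDl (mulrC s).
  rewrite (_ : _ + _ * - e^-1 = 0) ?scale0r ?addr0//.
  by field; rewrite !gt_eqF.
apply: cK => //.
  by rewrite invr_ge0 (ltW e1)/= invf_le1// lerDl ltW.
apply: rK; rewrite enormZ normrN normfV (gtr0_norm e0) mulrC ler_pdivrMr// mulrC//.
Qed.

(** The point is a mixture of a point of K on the axis, with weight 1 - e, and of w/e in the inner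
    ball, with weight e. *)
Lemma radial_line_in th w s e : enorm th = 1 -> 0 < e < 1 -> enorm w <= e * r ->
  `|s| < (1 - e) * radial K th -> K (s *: th + w).
Proof.
move=> th1 /andP[e0 e1] we sr; case: (bK) => _ cK _ rK _.
have d0 : 0 < 1 - e by rewrite subr_gt0.
have := cK ((s / (1 - e)) *: th) (e^-1 *: w) (1 - e).
rewrite subKr !scalerA mulrCA divff ?gt_eqF// mulr1 divff ?gt_eqF// scale1r; apply.
- by rewrite ltW//= lerBlDl lerDr ltW.
- by apply: radial_in => //; rewrite normrM normfV (gtr0_norm d0) ltr_pdivrMr// mulrC.
- by apply: rK; rewrite enormZ normfV (gtr0_norm e0) mulrC ler_pdivrMr// mulrC.
Qed.

(** A point s th of K is s th' plus an error of norm at most b |th' - th|; apply [radial_line] with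
    e = (b/r) |th' - th|. *)
Lemma radial_lipschitz th th' : enorm th = 1 -> enorm th' = 1 ->
  radial K th <= radial K th' + b / r * radial K th' * enorm (th' - th).
Proof.
move=> th1 th1'; set d := enorm _.
have r1 := radial_ge th1'; have b0 : 0 < b by apply: lt_le_trans r0 _; exact: le_trans (radial_le th1').
have [dE|dN] := eqVneq d 0.
  rewrite dE mulr0 addr0; suff -> : th = th' by [].
  by move/eqP: dE; rewrite enorm_eq0 subr_eq0 => /eqP.
have d0 : 0 < d by rewrite lt_def dN enorm_ge0.
apply/ler_addgt0Pl => eps eps0; rewrite -lerBlDl.
have [s [s0 Ks] es] := sup_adherent eps0 (S_sup th1).
apply: (ltW (lt_le_trans es _)).
have sb : s <= b by rewrite -(ger0_norm s0); apply: le_trans (radial_ub th1 Ks) (radial_le th1).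
have e0 : 0 < b / r * d by rewrite !mulr_gt0 ?invr_gt0.
rewrite -(ger0_norm s0); apply: le_trans (@radial_line th' (s *: (th - th')) s _ th1' e0 _ _) _.
- rewrite enormZ -opprB enormN -/d ger0_norm// mulrAC divfK ?gt_eqF//.
  by rewrite ler_pM2r.
- by rewrite -scalerDr addrC subrK.
by rewrite mulrDl mul1r lerD2l (mulrAC (b / r)).
Qed.

Lemma radial_continuous : {within unitsphere R n, continuous (radial K)}.
Proof.
apply/within_contP => x x1 e e0; have := radial_ge x1; have := radial_le x1 => xb rx.
have b0 : 0 < b by apply: lt_le_trans r0 _; exact: le_trans rx xb.
pose L := b / r * b; have L0 : 0 < L by rewrite !mulr_gt0 ?invr_gt0.
have step u v : enorm u = 1 -> enorm v = 1 -> radial K u - radial K v <= L * (n%:R * `|u - v|).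
  move=> u1 v1; rewrite lerBlDl; apply: le_trans (radial_lipschitz u1 v1) _.
  rewrite lerD2l; apply: ler_pM; rewrite ?enorm_ge0//.
  - by rewrite !mulr_ge0 ?invr_ge0 ?(ltW b0) ?(ltW r0)// (le_trans (ltW r0))// radial_ge.
  - by rewrite ler_wpM2l ?radial_le// mulr_ge0 ?invr_ge0 ?ltW.
  - by rewrite distrC; apply: enorm_le_coord => i; exact: coord_le_mx_norm.
(* The factor n compares the sup norm with the Euclidean norm; the added 1 keeps the divisor
   positive for n = 0. *)
have N0 : 0 < L * n%:R + 1 by rewrite ltr_wpDl// mulr_ge0// ltW.
exists (e / (L * n%:R + 1)); first by rewrite divr_gt0.
move=> y y1; rewrite ltr_pdivlMr// => xy.
apply: (@le_lt_trans _ _ (L * (n%:R * `|x - y|))).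
  by rewrite ler_norml step// andbT lerNl opprB distrC step.
apply: le_lt_trans xy; rewrite mulrA mulrC ler_wpM2l// lerDl//.
Qed.

End symmetric_bodies.

(** * Archimedes' theorem *)

Section archimedes.
Context {R : realType}.
Local Open Scope ereal_scope.
Notation leb := (@lebesgue_measure R).

Let disc (q : R) := [set w : 'rV[R]_2 | (enorm w ^+ 2 <= q)%R].

Let mdisc q : measurable (disc q).
Proof.
rewrite -[disc q]setTI; apply: (_ : measurable_fun setT (fun w : 'rV[R]_2 => enorm w ^+ 2 <= q)%R) => //.
by apply: measurable_fun_ler => //; apply: measurable_funX; exact: measurable_enorm.
Qed.

Let vol_disc q : vol (disc q) = (Num.max 0%R q)%:E * vol (unitball R 2).
Proof.
have [q0|q0] := ltP q 0%R.
  rewrite (_ : disc q = set0) ?vol0 ?mul0e ?measure0//.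
  by apply/seteqP; split => w // /(le_lt_trans)/(_ q0); rewrite ltNge sqr_ge0.
transitivity (radii 2 `]-oo, Num.sqrt q]%classic); last by rewrite radii_ball ?sqrtr_ge0// sqr_sqrtr.
rewrite -[RHS]/(vol (@enorm R 2 @^-1` `]-oo, Num.sqrt q]%classic)); congr vol; apply/seteqP.
have E (w : 'rV[R]_2) : (enorm w ^+ 2 <= q)%R = (enorm w <= Num.sqrt q)%R.
  by rewrite -[in LHS](sqr_sqrtr q0) ler_pXn2r// nnegrE ?enorm_ge0 ?sqrtr_ge0.
by split => w; rewrite /disc /= in_itv/= E.
Qed.

Let cone_ball (c : R) := [set x : 'rV[R]_3 | (enorm x <= 1)%R /\ (`|x 0 0| < c * enorm x)%R].

Let mcone c : measurable [set x : 'rV[R]_3 | (`|x 0 0| < c * enorm x)%R].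
Proof.
rewrite -[X in measurable X]setTI.
apply: (_ : measurable_fun setT (fun x : 'rV[R]_3 => `|x 0 0| < c * enorm x)%R) => //.
apply: measurable_fun_ltr.
  by apply: measurableT_comp => //; exact: measurable_coord.
by apply: measurable_funM => //; exact: measurable_enorm.
Qed.

Let mcone_ball c : measurable (cone_ball c).
Proof. exact: (measurableI (unitball R 3) _ (@measurable_unitball R 3) (mcone c)). Qed.

(** The slice at height t is a ring whose squared radii are (t/c)^2 - t^2 and 1 - t^2. The t^2
    cancels in its area, which is that of the slice of the full ball at height t/c. *)
Let slice_cone_ball (c t : R) : (0 < c <= 1)%R ->
  vol [set w : 'rV[R]_2 | cone_ball c (rcons0 t w)] =
  (Num.max 0%R (1 - (t / c) ^+ 2))%:E * vol (unitball R 2).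
Proof.
move=> /andP[c0 c1]; pose al := ((t / c) ^+ 2 - t ^+ 2)%R; pose be := (1 - t ^+ 2)%R.
have al0 : (0 <= al)%R.
  rewrite subr_ge0 expr_div_n ler_pdivlMr ?exprn_gt0//.
  by rewrite ler_piMr ?sqr_ge0// exprn_ile1// ltW.
have E : [set w : 'rV[R]_2 | cone_ball c (rcons0 t w)] = disc be `\` disc al.
  apply/seteqP.
  have n2 (w : 'rV[R]_2) : (enorm (rcons0 t w) ^+ 2 = t ^+ 2 + enorm w ^+ 2)%R.
    by rewrite enorm_tail rcons0_0 tail0K.
  have P1 (w : 'rV[R]_2) : (enorm (rcons0 t w) <= 1)%R = (enorm w ^+ 2 <= be)%R.
    by rewrite -(ler_pXn2r (n := 2))// ?nnegrE ?enorm_ge0// n2 expr1n lerBrDl.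
  have P2 (w : 'rV[R]_2) : (`|rcons0 t w 0 0| < c * enorm (rcons0 t w))%R = ~~ (enorm w ^+ 2 <= al)%R.
    rewrite -ltNge -(ltr_pXn2r (n := 2))// ?nnegrE ?mulr_ge0 ?enorm_ge0 ?(ltW c0)//.
    rewrite exprMn n2 rcons0_0 real_normK ?num_real// ltrBlDl expr_div_n.
    by rewrite ltr_pdivrMr ?exprn_gt0// mulrC.
  split => w; rewrite /cone_ball /disc /= P1 P2; first by move=> [? /negP].
  by move=> [? /negP].
rewrite E; have [ab|ab] := leP al be.
  have sub : disc al `<=` disc be by move=> w /= /le_trans; apply.
  have H : vol (disc be) = vol (disc be `\` disc al) + vol (disc al).
    have := @measureDI _ _ _ vol (disc be) (disc al) (mdisc _) (mdisc _).
    by rewrite (setIidr sub) addeC.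
  have be0 := le_trans al0 ab.
  have g0 : (0 <= 1 - (t / c) ^+ 2)%R by move: ab; rewrite /al /be; lra.
  move: H; rewrite !vol_disc (max_r be0) (max_r al0) (max_r g0).
  pose B := fine (vol (unitball R 2)).
  have bE : vol (unitball R 2) = B%:E by rewrite fineK// vol_unitball_fin.
  rewrite bE -!EFinM => H; have := congr1 (fun z => z - (al * B)%:E) H.
  by rewrite addeK// => <-; rewrite -EFinB; congr EFin; rewrite /be /al; ring.
rewrite max_l; last by move: ab; rewrite /al /be; lra.
rewrite mul0e (_ : _ `\` _ = set0) ?measure0//.
by apply/seteqP; split => w //= [wb]; apply; exact: le_trans wb (ltW ab).
Qed.

(** Cavalieri: after the substitution of c t for t the slices have the areas of those of the
    ball. *)
Let vol_cone_ball (c : R) : (0 < c <= 1)%R -> vol (cone_ball c) = c%:E * vol (unitball R 3).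
Proof.
move=> c01; have /andP[c0 c1] := c01.
have mg : measurable_fun setT (fun t : measurableTypeR R => (Num.max 0%R (1 - t ^+ 2))%:E * vol (unitball R 2)).
  apply: emeasurable_funM => //; apply/measurable_EFinP; apply: measurable_maxr => //.
  by apply: measurable_funB => //; exact: measurable_funX.
have mgc : measurable_fun setT (fun t : measurableTypeR R => (Num.max 0%R (1 - (t / c) ^+ 2))%:E * vol (unitball R 2)).
  by apply: (measurableT_comp mg); exact: measurable_funM.
have g0 c' t : 0 <= (Num.max 0%R (1 - (t / c') ^+ 2))%:E * vol (unitball R 2).
  by apply: mule_ge0 => //; rewrite lee_fin le_max lexx.
have slices (A : set 'rV[R]_3) : measurable A -> vol A = \int[leb]_t vol [set w : 'rV[R]_2 | A (rcons0 t w)].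
  move=> mA; rewrite (measureE vol mA) (integral_volS (measurable_indicE mA)); last by move=> x; rewrite lee_fin.
  apply: eq_integral => t _; rewrite (measureE vol); last first.
    by have := @measurable_rcons0_r R 2 t measurableT A mA; rewrite setTI.
  by apply: eq_integral => w _; congr EFin; exact: eq_indic.
rewrite (slices _ (mcone_ball c)); under eq_integral do rewrite slice_cone_ball//.
rewrite (@integral_affine R c 0 _ c0 mgc (g0 c)); congr (_ * _).
rewrite (slices _ (@measurable_unitball R 3)); apply: eq_integral => t _.
have -> : [set w : 'rV[R]_2 | unitball R 3 (rcons0 t w)] = disc (1 - t ^+ 2).
  apply/seteqP; have P1 (w : 'rV[R]_2) : (enorm (rcons0 t w) <= 1)%R = (enorm w ^+ 2 <= 1 - t ^+ 2)%R.
    by rewrite -(ler_pXn2r (n := 2))// ?nnegrE ?enorm_ge0// enorm_rcons0 expr1n lerBrDl.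
  by split => w; rewrite /unitball /disc /= P1.
by rewrite vol_disc addr0 (mulrC c) mulfK// gt_eqF.
Qed.

(** The mass of the band is the share of the ball that the cone over it fills. *)
Lemma sph_cap (c : R) : (0 < c <= 1)%R -> sph 3 [set u : 'rV[R]_3 | (`|u 0 0| < c)%R] = c%:E.
Proof.
move=> c01; have mA : measurable [set u : 'rV[R]_3 | (`|u 0 0| < c)%R].
  rewrite -[X in measurable X]setTI.
  apply: (_ : measurable_fun setT (fun x : 'rV[R]_3 => `|x 0 0| < c)%R) => //.
  apply: measurable_fun_ltr => //.
  by apply: measurableT_comp => //; exact: measurable_coord.
apply: (mulvar_prod (vol_unitball_gt0 3) (vol_unitball_lty 3)).
rewrite -vol_cone_ball// (measureE (sph 3) mA).
rewrite (@eq_integral_sph _ _ _ (fun u => (\1_[set u : 'rV[R]_3 | (`|u 0 0| < c * enorm u)%R] u)%:E)); last first.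
- by move=> x x1; congr EFin; apply: eq_indic; rewrite /= x1 mulr1.
- by apply: measurable_indicE; exact: mcone.
- exact: measurable_indicE.
rewrite muleC -integral_unitball; last first.
- by move=> x; rewrite lee_fin.
- by apply: measurable_indicE; exact: mcone.
rewrite (measureE vol (mcone_ball c)); apply: eq_integral => x _.
rewrite -EFinM; congr EFin.
rewrite -[LHS]/((\1_(unitball R 3) \* \1_(@normalize R 3 @^-1` [set u : 'rV[R]_3 | (`|u 0 0| < c * enorm u)%R]))%R x).
rewrite -indicI; apply: eq_indic; rewrite /cone_ball /unitball /=.
have [->|x0] := eqVneq x 0%R; first by rewrite normalize0.
rewrite normalize_coord enorm_normalize// mulr1 normrM normfV (ger0_norm (enorm_ge0 _)).
by rewrite mulrC ltr_pdivrMr// enorm_gt0.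
Qed.

Lemma sph_band (s : R) (v : 'rV[R]_3) : (0 < s)%R ->
  sph 3 [set u : 'rV[R]_3 | (`|dotv u v| < s)%R] = (s / Num.max s (enorm v))%:E.
Proof.
move=> s0; have mS w : measurable [set u : 'rV[R]_3 | (`|dotv u w| < s)%R].
  rewrite -[X in measurable X]setTI.
  apply: (_ : measurable_fun setT (fun x : 'rV[R]_3 => `|dotv x w| < s)%R) => //.
  apply: measurable_fun_ltr => //.
  by apply: measurableT_comp => //; exact: measurable_dotv.
have [v0|sv] := ltP (enorm v) s.
  rewrite divff ?gt_eqF// (measureE (sph 3) (mS v)).
  rewrite (@eq_integral_sph _ _ _ (fun u => 1)); last first.
  - move=> x x1; rewrite indicE mem_set//=; apply: le_lt_trans v0.
    by apply: le_trans (normr_dotv_le _ _) _; rewrite x1 mul1r.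
  - by [].
  - exact: measurable_indicE.
  by rewrite integral_cst// mul1e; exact: probability_setT.
have v0 : v != 0%R by rewrite -enorm_gt0 (lt_le_trans s0).
have nv0 : (0 < enorm v)%R by rewrite enorm_gt0.
have [T oT Tv] := rotate_to (enorm_normalize v0).
rewrite -sph_cap; last by rewrite divr_gt0//= ler_pdivrMr// mul1r.
rewrite (measureE (sph 3) (mS v)) -(integral_sph_orthogmx oT (measurable_indicE (mS v))); last by move=> x; rewrite lee_fin.
rewrite (measureE (sph 3)); last first.
  rewrite -[X in measurable X]setTI.
  apply: (_ : measurable_fun setT (fun x : 'rV[R]_3 => `|x 0 0| < s / enorm v)%R) => //.
  apply: measurable_fun_ltr => //.
  by apply: measurableT_comp => //; exact: measurable_coord.
apply: eq_integral => u _; congr EFin; apply: eq_indic => /=.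
by rewrite -[in dotv _ v](normalizeK v) dotvZr Tv normrM (gtr0_norm nv0) ltr_pdivlMr// mulrC.
Qed.

End archimedes.

(** * Integrating a thin kernel around a line *)

Section line_kernel.
Context {R : realType}.
Local Open Scope ereal_scope.
Notation leb := (@lebesgue_measure R).

(** In coordinates (s, z) with axis xi, the line over a fixed z with |z| <= e r meets K in a set
    whose length is within a factor 1 - e or 1 + e of 2 rho_K(xi); the kernel ignores the other
    z. *)
Lemma integral_cylinder_kernel n (r b e : R) (K : set 'rV[R]_n.+1) (xi : 'rV[R]_n.+1)
  (T : 'M[R]_n.+1) (U : 'M[R]_(n, n.+1)) (k : 'rV[R]_n -> R) :
  (0 < r)%R -> (0 < e < 1)%R -> symbody r b K -> enorm xi = 1%R -> orthogmx T -> isframe U ->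
  (forall s z, rcons0 s z *m T = s *: xi + z *m U)%R ->
  (forall s z, (rcons0 s z *m T) *m U^T = z)%R ->
  measurable_fun setT k -> (forall z, 0 <= k z)%R -> (forall z, e * r < enorm z -> k z = 0)%R ->
  ((1 - e) * (2 * radial K xi))%:E * \int[vol]_z (k z)%:E <=
  \int[vol]_x ((\1_K x) * k (x *m U^T))%:E <=
  ((1 + e) * (2 * radial K xi))%:E * \int[vol]_z (k z)%:E.
Proof.
move=> r0 e01 bK xi1 oT fU TE TU mk k0 ksupp.
have mK := symbody_measurable bK; have /andP[e0 e1] := e01.
have rho0 : (0 <= radial K xi)%R by apply: le_trans (radial_ge r0 bK xi1); exact: ltW.
have mF : measurable_fun setT (fun x : 'rV[R]_n.+1 => (\1_K x * k (x *m U^T))%:E).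
  apply/measurable_EFinP; apply: measurable_funM; first exact: measurable_indic.
  by apply: (measurableT_comp mk); exact: measurable_mulmxr.
have F0 x : 0 <= (\1_K x * k (x *m U^T))%:E by rewrite lee_fin mulr_ge0.
have mT := @measurable_mulmxr R 1 n.+1 n.+1 T.
rewrite -(integral_vol_orthogmx oT mF F0).
rewrite (integral_volS (F := fun x => (\1_K (x *m T) * k (x *m T *m U^T))%:E)) //; last exact: (measurableT_comp mF mT).
pose h (s : measurableTypeR R) (z : 'rV[R]_n) : \bar R := (\1_K (rcons0 s z *m T) * k z)%:E.
have -> : \int[leb]_s \int[vol]_z (\1_K (rcons0 s z *m T) * k (rcons0 s z *m T *m U^T))%:E =
    \int[leb]_s \int[vol]_z h s z.
  by apply: eq_integral => s _; apply: eq_integral => z _; rewrite /h TU.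
have mh : measurable_fun setT (fun p : measurableTypeR R * 'rV[R]_n => h p.1 p.2).
  apply/measurable_EFinP; apply: measurable_funM.
    have mI : measurable_fun setT (\1_K : 'rV[R]_n.+1 -> R) by exact: measurable_indic.
    apply: (measurableT_comp mI); apply: (measurableT_comp mT); exact: measurable_rcons0.
  by apply: (measurableT_comp mk); exact: measurable_snd.
have h0 s z : 0 <= h s z by rewrite lee_fin mulr_ge0.
rewrite (@tonelli R _ _ _ _ leb vol h)//.
pose L (z : 'rV[R]_n) : set (measurableTypeR R) := [set s | K (rcons0 s z *m T)].
have mL z : measurable (L z).
  have mp : measurable_fun setT (fun s : measurableTypeR R => rcons0 s z *m T).
    by apply: (measurableT_comp mT); exact: measurable_rcons.
  by have := mp measurableT _ mK; rewrite setTI.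
have hE z : \int[leb]_s h s z = (k z)%:E * leb (L z).
  rewrite (measureE leb (mL z)) -(ge0_integralZlT leb (measurable_indicE (mL z)))//; last by rewrite lee_fin.
  apply: eq_integral => s _; rewrite /h mulrC EFinM; congr (_ * _%:E); exact: eq_indic.
have -> : \int[vol]_z \int[leb]_s h s z = \int[vol]_z ((k z)%:E * leb (L z)).
  by apply: eq_integral => z _; exact: hE.
have mkL : measurable_fun setT (fun z => (k z)%:E * leb (L z)).
  rewrite (_ : (fun z => _) = fubini_G leb (fun p : measurableTypeR R * 'rV[R]_n => h p.1 p.2)).
    by apply: measurable_fun_fubini_tonelli_G => // -[x y]; exact: h0.
  by apply/funext => z; exact: esym (hE z).
have mkE : measurable_fun setT (fun z => (k z)%:E) by exact/measurable_EFinP.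
have kE0 z : 0 <= (k z)%:E by rewrite lee_fin.
have len (c : R) : (0 <= c)%R -> leb `](- c)%R, c[%classic = (2 * c)%:E /\ leb `[(- c)%R, c]%classic = (2 * c)%:E.
  move=> c0; rewrite !lebesgue_measure_itv/= !lte_fin -!EFinB opprK.
  have -> : (2 * c = c + c)%R by ring.
  by case: ltP => // cc; have -> : c = 0%R by [lra|]; rewrite addr0.
have Lin z : (enorm z <= e * r)%R -> ((1 - e) * (2 * radial K xi))%:E <= leb (L z).
  move=> zr; have H : `](- ((1 - e) * radial K xi))%R, ((1 - e) * radial K xi)%R[%classic `<=` L z.
    move=> s; rewrite /L /= in_itv/= -ltr_norml TE => sr.
    by apply: (radial_line_in r0 bK xi1 e01) => //; rewrite enorm_frame.
  have c0 : (0 <= (1 - e) * radial K xi)%R by rewrite mulr_ge0// subr_ge0 ltW.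
  rewrite mulrCA -(proj1 (len _ c0)); apply: le_measure; rewrite ?inE//.
have Lout z : (enorm z <= e * r)%R -> leb (L z) <= ((1 + e) * (2 * radial K xi))%:E.
  move=> zr; have H : L z `<=` `[(- ((1 + e) * radial K xi))%R, ((1 + e) * radial K xi)%R]%classic.
    move=> s; rewrite /L /= in_itv/= -ler_norml TE => sr.
    by apply: (radial_line r0 bK xi1 e0) sr; rewrite enorm_frame.
  have c0 : (0 <= (1 + e) * radial K xi)%R by rewrite mulr_ge0// addr_ge0 ?ltW.
  rewrite mulrCA -(proj2 (len _ c0)); apply: le_measure; rewrite ?inE//.
apply/andP; split.
  rewrite -(ge0_integralZlT vol mkE)//; last by rewrite lee_fin !mulr_ge0// subr_ge0 ltW.
  apply: ge0_le_integral => //.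
  - by move=> z _; rewrite mule_ge0// lee_fin !mulr_ge0// subr_ge0 ltW.
  - exact: measurable_funeM.
  - move=> z _; have [zr|zr] := leP (enorm z) (e * r)%R; last by rewrite (ksupp _ zr) mule0 mul0e.
    by rewrite muleC; apply: lee_pmul => //; [rewrite lee_fin !mulr_ge0// subr_ge0 ltW|exact: Lin].
rewrite -(ge0_integralZlT vol mkE)//; last by rewrite lee_fin !mulr_ge0// addr_ge0 ?ltW.
apply: ge0_le_integral => //.
- by move=> z _; rewrite mule_ge0.
- exact: measurable_funeM.
- move=> z _; have [zr|zr] := leP (enorm z) (e * r)%R; last by rewrite (ksupp _ zr) mule0 mul0e.
  by rewrite muleC; apply: lee_pmul => //; exact: Lout.
Qed.

End line_kernel.

(** * Positivity in dimension four *)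

Section quaternions.
Context {R : realType}.

Let o0 : 'I_4 := @Ordinal 4 0 isT.
Let o1 : 'I_4 := @Ordinal 4 1 isT.
Let o2 : 'I_4 := @Ordinal 4 2 isT.
Let o3 : 'I_4 := @Ordinal 4 3 isT.
Let p0 : 'I_3 := @Ordinal 3 0 isT.
Let p1 : 'I_3 := @Ordinal 3 1 isT.
Let p2 : 'I_3 := @Ordinal 3 2 isT.

Let sum4 (F : 'I_4 -> R) : \sum_i F i = F o0 + F o1 + F o2 + F o3.
Proof.
rewrite !big_ord_recl big_ord0 addr0 !addrA.
by congr (F _ + F _ + F _ + F _); exact: val_inj.
Qed.

Let sum3 (F : 'I_3 -> R) : \sum_i F i = F p0 + F p1 + F p2.
Proof.
rewrite !big_ord_recl big_ord0 addr0 !addrA.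
by congr (F _ + F _ + F _); exact: val_inj.
Qed.

Let all4 (P : 'I_4 -> Prop) : P o0 -> P o1 -> P o2 -> P o3 -> forall i, P i.
Proof.
move=> P0 P1 P2 P3 [[|[|[|[|//]]]] i].
- by rewrite (_ : Ordinal i = o0)//; exact: val_inj.
- by rewrite (_ : Ordinal i = o1)//; exact: val_inj.
- by rewrite (_ : Ordinal i = o2)//; exact: val_inj.
- by rewrite (_ : Ordinal i = o3)//; exact: val_inj.
Qed.

(* The rows are x, ix, jx, kx for the quaternion x; they are orthonormal when |x| = 1. *)
Definition quatmx (x : 'rV[R]_4) : 'M[R]_4 :=
  \matrix_(i, j) nth 0 (nth [::]
    [:: [:: x 0 o0; x 0 o1; x 0 o2; x 0 o3];
        [:: - x 0 o1; x 0 o0; - x 0 o3; x 0 o2];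
        [:: - x 0 o2; x 0 o3; x 0 o0; - x 0 o1];
        [:: - x 0 o3; - x 0 o2; x 0 o1; x 0 o0]] i) j.

Definition quatframe (x : 'rV[R]_4) : 'M[R]_(3, 4) :=
  \matrix_(i, j) quatmx x (lift ord0 i) j.

(* Left multiplication by the imaginary quaternion u. *)
Definition imquat (u : 'rV[R]_3) : 'M[R]_4 :=
  \matrix_(i, j) nth 0 (nth [::]
    [:: [:: 0; u 0 p0; u 0 p1; u 0 p2];
        [:: - u 0 p0; 0; u 0 p2; - u 0 p1];
        [:: - u 0 p1; - u 0 p2; 0; u 0 p0];
        [:: - u 0 p2; u 0 p1; - u 0 p0; 0]] i) j.

Lemma rcons0_quatmx s z x : rcons0 s z *m quatmx x = s *: x + z *m quatframe x.
Proof.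
apply/rowP => j; rewrite !mxE big_ord_recl rcons0_0; congr (s * _ + _).
  by rewrite mxE; move: j; apply: all4.
by apply: eq_bigr => i _; rewrite rcons0_lift !mxE.
Qed.

Lemma quatmx_orthog x : enorm x = 1 -> orthogmx (quatmx x).
Proof.
move=> x1; have := sqr_enorm x; rewrite x1 expr1n dotvE sum4 => E.
apply/matrixP; apply: all4; apply: all4; rewrite !mxE sum4 !mxE /= ?mulr0n ?mulr1n; try ring; rewrite E; ring.
Qed.

Lemma quatframe_isframe x : enorm x = 1 -> isframe (quatframe x).
Proof.
move=> /quatmx_orthog/matrixP oQ; apply/matrixP => i j.
have := oQ (lift ord0 i) (lift ord0 j); rewrite !mxE (inj_eq lift_inj) => <-.
by apply: eq_bigr => k _; rewrite !mxE.
Qed.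

Lemma rcons0_quatmx_tr s z x : enorm x = 1 -> rcons0 s z *m quatmx x *m (quatframe x)^T = z.
Proof.
move=> x1; rewrite rcons0_quatmx mulmxDl -mulmxA (quatframe_isframe x1) mulmx1.
rewrite -scalemxAl (_ : x *m _ = 0) ?scaler0 ?add0r//.
apply/rowP => j; rewrite !mxE sum4 !mxE; case: j => [[|[|[|//]]] ?] /=; ring.
Qed.

(** The quaternion product u x read in two ways: for fixed unit u an orthogonal map of x, for fixed
    unit x an isometric parametrization of x^perp. The exchange of averages in [conv_ge0] rests on
    this. *)
Lemma mulmx_imquat u x : x *m imquat u = u *m quatframe x.
Proof.
by apply/rowP; apply: all4; rewrite !mxE sum3 sum4 !mxE /=; ring.
Qed.

Lemma imquat_tr u : (imquat u)^T = - imquat u.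
Proof. by apply/matrixP; apply: all4; apply: all4; rewrite !mxE /= ?oppr0 ?opprK. Qed.

Lemma imquat_orthog u : enorm u = 1 -> orthogmx (imquat u).
Proof.
move=> u1; have := sqr_enorm u; rewrite u1 expr1n dotvE sum3 => E.
apply/matrixP; apply: all4; apply: all4; rewrite !mxE sum4 !mxE /= ?mulr0n ?mulr1n; try ring; rewrite E; ring.
Qed.

Lemma measurable_imquat : measurable_fun setT imquat.
Proof.
apply: measurable_mxP; apply: all4; apply: all4; under eq_fun do rewrite mxE /=.
all: try exact: measurable_cst.
all: try exact: measurable_coord.
all: by apply: measurable_funN; exact: measurable_coord.
Qed.

End quaternions.

(** * The slab difference and its spherical average *)

Section band_kernel.
Context {R : realType}.

Lemma ge0_integral_mfrestr d (T : measurableType d) (mu : {measure set T -> \bar R}) (D : set T)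
  (mD : measurable D) (moo : (mu D < +oo)%E) (f : T -> R) :
  measurable_fun setT f -> (forall x, 0 <= f x) ->
  (\int[mfrestr mD moo]_x (f x)%:E = \int[mu]_x (\1_D x * f x)%:E)%E.
Proof.
move=> mf f0; have mD' : measurable (~` D) by exact: measurableC.
rewrite (ge0_negligible_integral mD' measurableT) //.
- rewrite setDE setCK setTI (@eq_measure_integral _ _ _ _ mu); last first.
    by move=> A mA AD; rewrite -[LHS]/(mu (A `&` D)) (setIidl AD).
  rewrite integral_mkcond; apply: eq_integral => x _; rewrite patchE indicE.
  by case: ifP; rewrite ?mul1r ?mul0r.
- exact/measurable_EFinP.
- by move=> x _; rewrite lee_fin.
- by rewrite -[LHS]/(mu (~` D `&` D)) setICl measure0.
Qed.

Definition band (e t : R) : R := \1_[set s | `|s| < e] t - 3^-1 * \1_[set s | `|s| < 3 * e] t.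

(** For z in R^3 this is the average of [band e] at <u,z> over u in S^2; the weight 1/3 has been
    absorbed into the numerator of the second term. *)
Definition bandavg n (e : R) (z : 'rV[R]_n) : R :=
  e / Num.max e (enorm z) - e / Num.max (3 * e) (enorm z).

Let mlt (e : R) : measurable ([set s | `|s| < e] : set (measurableTypeR R)).
Proof.
rewrite -[X in measurable X]setTI.
apply: (_ : measurable_fun setT (fun x : measurableTypeR R => `|x| < e)) => //.
by apply: measurable_fun_ltr => //; exact: measurableT_comp.
Qed.

Lemma bmeas_band e : bmeas (band e : measurableTypeR R -> R).
Proof.
apply: bmeasB; first by apply: bmeas_indic; exact: mlt.
by apply: bmeasM; [exact: bmeas_cst|apply: bmeas_indic; exact: mlt].
Qed.

Let bmeas_lt d (T : measurableType d) (g : T -> R) e : measurable_fun setT g ->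
  bmeas (fun x => \1_[set s | `|s| < e] (g x) : R).
Proof. by move=> mg; exact: (bmeas_comp (h := (\1_[set s | `|s| < e] : measurableTypeR R -> R)) mg (bmeas_indic (mlt e))). Qed.

Let mpre d (T : measurableType d) (g : T -> measurableTypeR R) e : measurable_fun setT g ->
  measurable [set x | `|g x| < e].
Proof. by move=> mg; have := mg measurableT _ (mlt e); rewrite setTI. Qed.

Lemma savg_band (e : R) (v : 'rV[R]_3) : 0 < e -> savg (fun u => band e (dotv u v)) = bandavg e v.
Proof.
move=> e0; have md : measurable_fun setT (fun u : 'rV[R]_3 => dotv u v) by exact: measurable_dotv.
have S s : 0 < s -> savg (fun u : 'rV[R]_3 => \1_[set s' | `|s'| < s] (dotv u v)) = s / Num.max s (enorm v).
  move=> s0; apply: EFin_inj; rewrite savg_fin; last exact: bmeas_lt.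
  by rewrite -(sph_band v s0) (measureE (sph 3) (mpre s md)); apply: eq_integral => u _; congr EFin; exact: eq_indic.
rewrite /band savgB; [|exact: bmeas_lt|by apply: bmeasM; [exact: bmeas_cst|exact: bmeas_lt]].
rewrite savgZ; last exact: bmeas_lt.
have e30 : 0 < 3 * e by rewrite mulr_gt0.
by rewrite !S// /bandavg mulrA mulKf.
Qed.

Lemma Rintegral_band_ge0 n (r b e : R) (K : set 'rV[R]_n) (xi : 'rV[R]_n)
  (mK : measurable K) (Koo : (vol K < +oo)%E) : 0 < r -> symbody r b K ->
  0 <= Rintegral (mfrestr mK Koo) setT (fun x : 'rV[R]_n => band e (dotv x xi)).
Proof.
move=> r0 bK; have md : measurable_fun setT (fun u : 'rV[R]_n => dotv u xi) by exact: measurable_dotv.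
have I s : (Rintegral (mfrestr mK Koo) setT (fun x : 'rV[R]_n => \1_[set t | `|t| < s] (dotv x xi)))%:E =
    vol (K `&` [set x | `|dotv x xi| < s]).
  rewrite /Rintegral fineK; last first.
    by apply: integrable_fin_num => //; apply: bmeas_integrable; exact: bmeas_lt.
  have -> : vol (K `&` [set x | `|dotv x xi| < s]) = mfrestr mK Koo [set x | `|dotv x xi| < s].
    by rewrite -[RHS]/(vol ([set x | `|dotv x xi| < s] `&` K)) setIC.
  rewrite (measureE (mfrestr mK Koo) (mpre s md)).
  by apply: eq_integral => u _; congr EFin; exact: eq_indic.
rewrite /band RintegralB//; last 2 first.
- by apply: bmeas_integrable; exact: bmeas_lt.
- by apply: bmeas_integrable; apply: bmeasM; [exact: bmeas_cst|exact: bmeas_lt].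
rewrite RintegralZl//; last by apply: bmeas_integrable; exact: bmeas_lt.
rewrite subr_ge0 ler_pdivrMl// -lee_fin EFinM !I.
case: (bK) => _ cK sK rK Kb; apply: (@vol_slab R n `|b|) => //.
- by move=> x i /Kb xb; apply: le_trans (coord_le_enorm x i) (le_trans xb (ler_norm b)).
- move=> x y Kx Ky; rewrite scalerDr; have := cK x y 2^-1 _ Kx Ky.
  by rewrite (_ : 1 - 2^-1 = 2^-1 :> R); [apply; apply/andP; split; lra|lra].
Qed.

(** Beyond 3e both terms equal e/|z|. *)
Lemma bandavg_supp n (e : R) (z : 'rV[R]_n) : 0 < e -> 3 * e < enorm z -> bandavg e z = 0.
Proof.
move=> e0 ez; have e1 : e < enorm z by apply: lt_trans ez; lra.
by rewrite /bandavg !max_r ?ltW// subrr.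
Qed.

Let max0 n (e : R) (z : 'rV[R]_n) : 0 < e -> 0 < Num.max e (enorm z).
Proof. by move=> e0; rewrite lt_max e0. Qed.

Lemma bandavg_ge0 n (e : R) (z : 'rV[R]_n) : 0 < e -> 0 <= bandavg e z.
Proof.
move=> e0; rewrite subr_ge0; apply: ler_wpM2l; first exact: ltW.
rewrite lef_pV2 ?posrE ?max0 ?mulr_gt0//.
by rewrite ge_max !le_max lexx orbT andbT; apply/orP; left; lra.
Qed.

Lemma bandavg_le1 n (e : R) (z : 'rV[R]_n) : 0 < e -> bandavg e z <= 1.
Proof.
move=> e0; rewrite lerBlDr -[X in X <= _]addr0 lerD//.
  by rewrite ler_pdivrMr ?max0// mul1r le_max lexx.
by rewrite divr_ge0 ?ltW// max0// mulr_gt0.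
Qed.

Lemma bandavg_ge n (e : R) (z : 'rV[R]_n) : 0 < e -> enorm z <= e -> 2^-1 <= bandavg e z.
Proof.
move=> e0 ze; rewrite /bandavg max_l// max_l; last by apply: le_trans ze _; lra.
by rewrite divff ?gt_eqF// invfM mulrCA divff ?gt_eqF//; lra.
Qed.

Lemma measurable_bandavg n (e : R) : 0 < e -> measurable_fun setT (@bandavg n e).
Proof.
move=> e0.
have H s : 0 < s -> measurable_fun setT (fun z : 'rV[R]_n => e / Num.max s (enorm z)).
  move=> s0; apply: measurable_funM => //.
  under eq_fun => z do rewrite -powR_inv1 ?(ltW (max0 _ s0))//.
  apply: (measurableT_comp (measurable_powR (- 1))); apply: measurable_maxr => //.
  exact: measurable_enorm.
by apply: measurable_funB; apply: H => //; rewrite mulr_gt0.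
Qed.

(** Positivity and finiteness of the total mass allow it to be divided out before e tends to 0. *)
Lemma integral_bandavg n (e : R) : 0 < e ->
  (0 < \int[vol]_(z in [set: 'rV[R]_n.+1]) (bandavg e z)%:E < +oo)%E.
Proof.
move=> e0; pose B s := [set z : 'rV[R]_n.+1 | enorm z <= s].
have vB s : 0 < s -> (vol (B s) = (s ^+ n.+1)%:E * vol (unitball R n.+1))%E.
  by move=> s0; rewrite -(radii_ball n (ltW s0)) /radii /pushm /pushforward/=; congr vol; apply/seteqP; split => z; rewrite /B /= in_itv.
have mB s : measurable (B s).
  rewrite -[X in measurable X]setTI.
  apply: (_ : measurable_fun setT (fun x : 'rV[R]_n.+1 => enorm x <= s)) => //.
  by apply: measurable_fun_ler => //; exact: measurable_enorm.
have mb : measurable_fun setT (@bandavg n.+1 e) by exact: measurable_bandavg.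
have mbE : measurable_fun setT (fun z : 'rV[R]_n.+1 => (bandavg e z)%:E) by exact/measurable_EFinP.
have b0 z : (0 <= (@bandavg n.+1 e z)%:E)%E by rewrite lee_fin bandavg_ge0.
apply/andP; split.
  apply: (@lt_le_trans _ _ (\int[vol]_z ((2^-1)%:E * (\1_(B e) z)%:E))%E).
    rewrite (ge0_integralZlT vol (measurable_indicE (mB e)))// -(measureE vol (mB e)).
    by rewrite mule_gt0// [X in (_ < X)%E](vB e e0) mule_gt0 ?lte_fin ?exprn_gt0// vol_unitball_gt0.
  apply: ge0_le_integral => //.
  - by apply: measurable_funeM; exact: measurable_indicE.
  - move=> z _; rewrite -EFinM lee_fin indicE; case: (z \in B e) / boolP => [/set_mem|_] /=.
      by rewrite mulr1; exact: bandavg_ge.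
    by rewrite mulr0 bandavg_ge0.
apply: (@le_lt_trans _ _ (vol (B (3 * e)))); last first.
  by rewrite vB ?mulr_gt0// lte_mul_pinfty ?lee_fin ?exprn_ge0 ?mulr_ge0 ?ltW// vol_unitball_lty.
rewrite (measureE vol (mB _)); apply: ge0_le_integral => //.
- exact: measurable_indicE.
- move=> z _; rewrite lee_fin indicE; case: (z \in B _) / boolP => [_|/negP zB] /=.
    exact: bandavg_le1.
  by rewrite bandavg_supp// ltNge; apply/negP => zB'; apply: zB; exact: mem_set.
Qed.

End band_kernel.

(** * The four-dimensional inequality *)

Section four_dimensions.
Context {R : realType}.
Variables (r b : R) (K : set 'rV[R]_4).
Hypotheses (r0 : 0 < r) (bK : symbody r b K).

Let mK := symbody_measurable bK.

Let Koo : (vol K < +oo)%E.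
Proof.
apply: (@le_lt_trans _ _ (vol [set x : 'rV[R]_4 | forall i, `|x 0 i| <= `|b|])); last first.
  by rewrite vol_box// ltry.
apply: le_measure; rewrite ?inE//; first exact: measurable_box.
by case: bK => _ _ _ _ Kb x /Kb xb i; apply: le_trans (coord_le_enorm x i) (le_trans xb (ler_norm b)).
Qed.

(** K enters as a finite measure, so that Fubini for bounded functions covers the integrals over
    K. *)
Let nu := mfrestr mK Koo.

Let slabdiff (e : R) (xi : 'rV[R]_4) : R := Rintegral nu setT (fun x : 'rV[R]_4 => band e (dotv x xi)).

Let bmeas_band_dotv d (T : measurableType d) (g h : T -> 'rV[R]_4) e :
  measurable_fun setT g -> measurable_fun setT h -> bmeas (fun t => band e (dotv (g t) (h t))).
Proof.
move=> mg mh; have md : measurable_fun setT (fun t => dotv (g t) (h t) : measurableTypeR R) by exact: measurable_dotv.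
exact: (bmeas_comp md (bmeas_band e)).
Qed.

Let bmeas_slabdiff e : bmeas (slabdiff e).
Proof.
pose F (xi x : 'rV[R]_4) : R := band e (dotv x xi).
have bF : bmeas (fun p : 'rV[R]_4 * 'rV[R]_4 => F p.1 p.2).
  by apply: bmeas_band_dotv; [exact: measurable_snd|exact: measurable_fst].
exact: (bmeas_Rintegral (sph 4) nu bF).
Qed.

(** The transpose of [imquat u] is its negative, so for unit xi the arguments run over the unit
    sphere of xi^perp. *)
Let conv (e : R) (xi : 'rV[R]_4) : R := savg (fun u => slabdiff e (xi *m (imquat u)^T)).

Let measurable_imquat_tr : measurable_fun setT (fun u : 'rV[R]_3 => (imquat u)^T).
Proof.
apply: measurable_mxP => i j; under eq_fun do rewrite mxE.
exact: (measurableT_comp (measurable_coord j i) measurable_imquat).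
Qed.

Let mass (e : R) : R := fine (\int[vol]_(z in [set: 'rV[R]_3]) (bandavg e z)%:E)%E.

Let bandN e (t : R) : band e (- t) = band e t.
Proof. by rewrite /band; congr (_ - _ * _); apply: eq_indic; rewrite /= normrN. Qed.

(** After exchanging the integrals, each x in K is weighted by [bandavg] of its projection to
    xi^perp, a kernel concentrated near the line of xi. *)
Let conv_bounds e xi : 0 < e < 1 -> enorm xi = 1 ->
  (1 - e) * (2 * radial K xi) * mass (e * r / 3) <= conv (e * r / 3) xi <=
  (1 + e) * (2 * radial K xi) * mass (e * r / 3).
Proof.
move=> e01 xi1; have /andP[e0 e1] := e01.
(* The kernel lives on |z| <= 3 e', and 3 e' = e r is the distance from the axis at which the line
   bounds with error e hold. *)
pose e' := e * r / 3; have e'0 : 0 < e' by rewrite !mulr_gt0 ?invr_gt0.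
have e'E : 3 * e' = e * r by rewrite /e' mulrC divfK.
have /andP[I0 Ioo] := integral_bandavg 2 e'0.
have IE : (\int[vol]_(z in [set: 'rV[R]_3]) (bandavg e' z)%:E)%E = (mass e')%:E.
  by rewrite /mass fineK// ge0_fin_numE// ltW.
have mb : measurable_fun setT (@bandavg R 3 e') by exact: measurable_bandavg.
have b0 (z : 'rV[R]_3) : 0 <= bandavg e' z by exact: bandavg_ge0.
have mbU : measurable_fun setT (fun x : 'rV[R]_4 => bandavg e' (x *m (quatframe xi)^T)).
  by apply: (measurableT_comp mb); exact: measurable_mulmxr.
have E : conv e' xi = Rintegral nu setT (fun x : 'rV[R]_4 => bandavg e' (x *m (quatframe xi)^T)).
  pose F (u : 'rV[R]_3) (x : 'rV[R]_4) : R := band e' (dotv x (xi *m (imquat u)^T)).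
  have bF : bmeas (fun p : 'rV[R]_3 * 'rV[R]_4 => F p.1 p.2).
    apply: bmeas_band_dotv; first exact: measurable_snd.
    apply: measurable_mulmx => //; apply: (measurableT_comp measurable_imquat_tr); exact: measurable_fst.
  rewrite /conv /savg; transitivity (Rintegral (sph 3) setT (fun u => Rintegral nu setT (F u))); first by [].
  rewrite (Rintegral_swap (sph 3) nu bF); apply: eq_Rintegral => x _.
  rewrite -savg_band//; apply: eq_Rintegral => u _; rewrite /F imquat_tr mulmxN mulmx_imquat dotvNr.
  by rewrite bandN dotvC /dotv trmx_mul trmxK mulmxA.
have lo := integral_cylinder_kernel r0 e01 bK xi1 (quatmx_orthog xi1) (quatframe_isframe xi1)
  (fun s z => rcons0_quatmx s z xi) (fun s z => rcons0_quatmx_tr s z xi1) mb b0.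
have {lo}/andP[lo hi] := lo (fun z ez => bandavg_supp e'0 (eq_ind_r (fun t => t < enorm z) ez e'E)).
have {}E : (conv e' xi)%:E = (\int[vol]_x (\1_K x * bandavg e' (x *m (quatframe xi)^T))%:E)%E.
  rewrite E /Rintegral fineK; last first.
    apply: integrable_fin_num => //; apply: bmeas_integrable; split=> //; exists 1 => x.
    by rewrite ger0_norm// bandavg_le1.
  exact: (ge0_integral_mfrestr mK Koo mbU).
move: lo hi; rewrite -E IE -!EFinM !lee_fin => -> ->; done.
Qed.

Let bmeas_F (f : 'rV[R]_4 -> R) : bmeas (hat f) ->
  bmeas (fun p : 'rV[R]_4 * 'rV[R]_3 => hat f (p.1 *m imquat p.2)).
Proof.
move=> bf; have mg : measurable_fun setT (fun p : 'rV[R]_4 * 'rV[R]_3 => p.1 *m imquat p.2).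
  apply: measurable_mulmx; first exact: measurable_fst.
  by apply: (measurableT_comp measurable_imquat); exact: measurable_snd.
exact: (bmeas_comp mg bf).
Qed.

(** For each unit u an orthogonal substitution in xi moves u from the slab difference to f.
    Integrating over u first then leaves the slab difference at xi times the average of f over
    xi^perp, both nonnegative. *)
Let conv_ge0 e (f : 'rV[R]_4 -> R) : bmeas (hat f) ->
  (forall U : 'M[R]_(3, 4), isframe U -> 0 <= savg (fun y => hat f (y *m U))) ->
  0 <= savg (fun xi => hat f xi * conv e xi).
Proof.
move=> bf f0.
pose F (xi : 'rV[R]_4) (u : 'rV[R]_3) : R := slabdiff e xi * hat f (xi *m imquat u).
have bF : bmeas (fun p : 'rV[R]_4 * 'rV[R]_3 => F p.1 p.2).
  apply: bmeasM; last exact: bmeas_F.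
  exact: (bmeas_comp (g := fun p : 'rV[R]_4 * 'rV[R]_3 => p.1) measurable_fst (bmeas_slabdiff e)).
pose G (xi : 'rV[R]_4) (u : 'rV[R]_3) : R := hat f xi * slabdiff e (xi *m (imquat u)^T).
have bG : bmeas (fun p : 'rV[R]_4 * 'rV[R]_3 => G p.1 p.2).
  apply: bmeasM; first exact: (bmeas_comp (g := fun p : 'rV[R]_4 * 'rV[R]_3 => p.1) measurable_fst bf).
  have mg : measurable_fun setT (fun p : 'rV[R]_4 * 'rV[R]_3 => p.1 *m (imquat p.2)^T).
    apply: measurable_mulmx; first exact: measurable_fst.
    by apply: (measurableT_comp measurable_imquat_tr); exact: measurable_snd.
  exact: (bmeas_comp mg (bmeas_slabdiff e)).
have bSl xi : bmeas (fun u : 'rV[R]_3 => slabdiff e (xi *m (imquat u)^T)).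
  have mg : measurable_fun setT (fun u : 'rV[R]_3 => xi *m (imquat u)^T) by exact: measurable_mulmx.
  exact: (bmeas_comp mg (bmeas_slabdiff e)).
have -> : savg (fun xi => hat f xi * conv e xi) = Rintegral (sph 4) setT (fun xi => Rintegral (sph 3) setT (G xi)).
  by apply: eq_Rintegral => xi _; rewrite /conv -savgZ.
rewrite (Rintegral_swap (sph 4) (sph 3) bG).
have -> : Rintegral (sph 3) setT (fun u => Rintegral (sph 4) setT (fun xi => G xi u)) =
  Rintegral (sph 3) setT (fun u => Rintegral (sph 4) setT (fun xi => F xi u)).
  apply: (@eq_savg R 2 (fun u => Rintegral (sph 4) setT (fun xi => G xi u)) (fun u => Rintegral (sph 4) setT (fun xi => F xi u))).
  - exact: (bmeas_Rintegral (sph 3) (sph 4) (bmeas_swap bG)).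
  - exact: (bmeas_Rintegral (sph 3) (sph 4) (bmeas_swap bF)).
  move=> u u1; have oS := imquat_orthog u1.
  have oSt : orthogmx (imquat u)^T by rewrite imquat_tr /orthogmx linearN/= mulmxN mulNmx opprK.
  have bFu : bmeas (fun xi => F xi u) by exact: (bmeas_slice (F := fun u xi => F xi u) u (bmeas_swap bF)).
  rewrite -[RHS]/(savg (fun xi => F xi u)) -(savg_orthogmx oSt bFu).
  apply: eq_Rintegral => xi _; rewrite /F /G -mulmxA.
  have -> : (imquat u)^T *m imquat u = 1%:M by have := oSt; rewrite /orthogmx trmxK.
  by rewrite mulmx1 mulrC.
rewrite -(Rintegral_swap (sph 4) (sph 3) bF).
have -> : 0 = savg (fun _ : 'rV[R]_4 => 0) by rewrite savg_cst.
apply: (le_savg (bmeas_cst _ _)); first exact: (bmeas_Rintegral (sph 4) (sph 3) bF).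
move=> xi xi1; rewrite -[leRHS]/(savg (fun u => slabdiff e xi * hat f (xi *m imquat u))).
rewrite savgZ; last exact: (bmeas_slice (F := fun xi u => hat f (xi *m imquat u)) xi (bmeas_F bf)).
apply: mulr_ge0; first exact: (Rintegral_band_ge0 e xi mK Koo r0 bK).
have := f0 _ (quatframe_isframe xi1); congr (_ <= _); apply: eq_Rintegral => u _.
by rewrite mulmx_imquat.
Qed.

Lemma savg_radial4_ge0 (f : 'rV[R]_4 -> R) : {within unitsphere R 4, continuous f} ->
  (forall U : 'M[R]_(3, 4), isframe U -> 0 <= savg (fun y => hat f (y *m U))) ->
  0 <= savg (fun xi => hat f xi * hat (radial K) xi).
Proof.
move=> cf f0; have bf := hat_bmeas cf; have bR := hat_bmeas (radial_continuous r0 bK).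
have [_ [M HM]] := bf; have M0 : 0 <= M by apply: le_trans (HM 0).
have rb th : enorm th = 1 -> 0 <= radial K th <= b.
  by move=> th1; rewrite (radial_le r0 bK th1) andbT (le_trans (ltW r0)) ?(radial_ge r0 bK th1).
have b0 : 0 <= b.
  by case: bK => _ _ _ rK Kb; rewrite -(@enorm0 R 4); apply/Kb/rK; rewrite enorm0 ltW.
apply/ler_addgt0Pr => d d0.
pose N := M * b; have N0 : 0 <= N by rewrite mulr_ge0.
(* Replacing c rho_K by [conv] costs at most c e b, and |f| <= M, so the error is c N e; this e
   gives N e <= d and e < 1. *)
pose e := d / (d + N + 1); have e0 : 0 < e by rewrite divr_gt0// addr_gt0// ltr_wpDr.
have eN : N * e <= d.
  have dN : 0 < d + N + 1 by lra.
  by rewrite mulrA ler_pdivrMr// (mulrC N) ler_pM2l//; lra.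
have e1 : e < 1 by rewrite ltr_pdivrMr; lra.
have e01 : 0 < e < 1 by rewrite e0.
clearbody e.
have e'0 : 0 < e * r / 3 by rewrite !mulr_gt0 ?invr_gt0.
have /andP[I0 Ioo] := integral_bandavg 2 e'0.
pose c := 2 * mass (e * r / 3).
have c0 : 0 < c by rewrite mulr_gt0// fine_gt0// I0.
have bC : bmeas (conv (e * r / 3)).
  pose F (xi : 'rV[R]_4) (u : 'rV[R]_3) : R := slabdiff (e * r / 3) (xi *m (imquat u)^T).
  have mg : measurable_fun setT (fun p : 'rV[R]_4 * 'rV[R]_3 => p.1 *m (imquat p.2)^T).
    apply: measurable_mulmx; first exact: measurable_fst.
    by apply: (measurableT_comp measurable_imquat_tr); exact: measurable_snd.
  have bF : bmeas (fun p : 'rV[R]_4 * 'rV[R]_3 => F p.1 p.2) by exact: (bmeas_comp mg (bmeas_slabdiff _)).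
  exact: (bmeas_Rintegral (sph 4) (sph 3) bF).
have bfR : bmeas (fun xi => hat f xi * hat (radial K) xi) by exact: bmeasM.
have H : 0 <= savg (fun xi => c * (hat f xi * hat (radial K) xi) + c * (N * e)).
  apply: le_trans (conv_ge0 (e * r / 3) bf f0) _; apply: le_savg.
  - exact: bmeasM.
  - by apply: bmeasD; [apply: bmeasM => //; exact: bmeas_cst|exact: bmeas_cst].
  move=> x x1; rewrite hat_id// (hat_id _ x1); have /andP[R0 Rb] := rb x x1.
  have := conv_bounds e01 x1.
  set C := conv _ x; set rho := radial K x in R0 Rb *; set y := f x.
  have -> : (1 - e) * (2 * rho) * mass (e * r / 3) = c * rho - c * (e * rho) by rewrite /c; ring.
  have -> : (1 + e) * (2 * rho) * mass (e * r / 3) = c * rho + c * (e * rho) by rewrite /c; ring.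
  move=> /andP[C1 C2].
  have yM : `|y| <= M by have := HM x; rewrite hat_id.
  have dC : `|C - c * rho| <= c * (e * b).
    have : `|C - c * rho| <= c * (e * rho) by rewrite ler_norml; apply/andP; split; lra.
    by move=> /le_trans; apply; apply: ler_wpM2l; [exact: ltW|apply: ler_wpM2l => //; exact: ltW].
  rewrite -lerBlDl (_ : _ - _ = y * (C - c * rho)); last by ring.
  apply: le_trans (ler_norm _) _; rewrite normrM.
  have -> : c * (N * e) = M * (c * (e * b)) by rewrite /N; ring.
  by apply: ler_pM.
move: H; rewrite savgD; last 2 first.
- by apply: bmeasM => //; exact: bmeas_cst.
- exact: bmeas_cst.
rewrite savgZ// savg_cst -mulrDr pmulr_rge0// => /le_trans; apply.
by rewrite lerD2l.
Qed.

End four_dimensions.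

(** * Reduction to four-dimensional sections *)

Section positivity.
Context {R : realType}.

Let sec n m (V : 'M[R]_(m, n)) (f : 'rV[R]_n -> R) (u : 'rV[R]_m) := f (u *m V).

Let hat_sec n m (V : 'M[R]_(m, n)) (f : 'rV[R]_n -> R) u : isframe V ->
  hat (sec V f) u = hat f (u *m V).
Proof. by move=> fV; rewrite /hat /sec normalize_frame. Qed.

Let sec_continuous n m (V : 'M[R]_(m, n)) (f : 'rV[R]_n -> R) : isframe V ->
  {within unitsphere R n, continuous f} -> {within unitsphere R m, continuous (sec V f)}.
Proof.
move=> fV /within_contP cf; apply/within_contP => x x1 e e0.
have [|d d0 Hd] := cf (x *m V) _ e e0; first by rewrite /unitsphere/= enorm_frame.
have /cvgrPdist_lt/(_ d d0)/nbhs_ballP[c /= c0 Hc] := @continuous_mulmxr R 1 m n V x.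
exists c => // y y1 xy; apply: Hd; first by rewrite /unitsphere/= enorm_frame.
by apply: Hc; rewrite -ball_normE.
Qed.

Let lift_frame n m (f : 'rV[R]_n -> R) : {within unitsphere R n, continuous f} ->
  (forall U : 'M[R]_(m.+1, n), isframe U -> 0 <= savg (fun y => hat f (y *m U))) ->
  forall V : 'M[R]_(m.+2, n), isframe V -> 0 <= savg (fun y => hat f (y *m V)).
Proof.
move=> cf f0 V fV.
have -> : (fun y => hat f (y *m V)) = hat (sec V f) by apply/funext => y; rewrite hat_sec.
apply: savg_hyperplane_ge0; first exact: sec_continuous.
move=> U fU; have := f0 _ (isframeM fU fV); congr (_ <= savg _).
by apply/funext => y; rewrite hat_sec// mulmxA.
Qed.

Let lift_frames n m k (f : 'rV[R]_n -> R) : {within unitsphere R n, continuous f} ->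
  (forall U : 'M[R]_(m.+1, n), isframe U -> 0 <= savg (fun y => hat f (y *m U))) ->
  forall V : 'M[R]_((k + m).+1, n), isframe V -> 0 <= savg (fun y => hat f (y *m V)).
Proof. by move=> cf f0; elim: k => [//|k IH]; exact: lift_frame. Qed.

Lemma symbody_section n m (r b : R) (K : set 'rV[R]_n) (V : 'M[R]_(m, n)) : isframe V ->
  symbody r b K -> symbody r b [set u : 'rV[R]_m | K (u *m V)].
Proof.
move=> fV [cK vK sK rK Kb]; split.
- by apply: (closed_comp (f := fun u : 'rV[R]_m => u *m V)) => // x _; exact: continuous_mulmxr.
- by move=> x y t t01 Kx Ky /=; rewrite mulmxDl -!scalemxAl; exact: vK.
- by move=> x Kx /=; rewrite mulNmx; exact: sK.
- by move=> x xr; apply: rK; rewrite enorm_frame.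
- by move=> x /Kb; rewrite enorm_frame.
Qed.

Lemma radial_section n m (K : set 'rV[R]_n) (V : 'M[R]_(m, n)) u :
  radial [set u : 'rV[R]_m | K (u *m V)] u = radial K (u *m V).
Proof. by rewrite /radial; congr sup; apply/seteqP; split => s [s0] /=; rewrite -scalemxAl. Qed.

Lemma within_contM (T : topologicalType) (A : set T) (f g : T -> R) : {within A, continuous f} ->
  {within A, continuous g} -> {within A, continuous (fun x => f x * g x)}.
Proof. by move=> cf cg x; apply: cvgM; [exact: cf|exact: cg]. Qed.

(** Lifting is used twice: on f from dimension 2 to 3 when a = 2, and on the product of f and
    [radial K] from dimension 4 to the full space. In between, the four-dimensional inequality is
    applied in each section. *)
Lemma savg_radial_ge0 n a (r b : R) (K : set 'rV[R]_n.+4) (f : 'rV[R]_n.+4 -> R) :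
  0 < r -> symbody r b K -> a = 2 \/ a = 3 -> {within unitsphere R n.+4, continuous f} ->
  (forall U : 'M[R]_(a, n.+4), isframe U -> 0 <= savg (fun y => hat f (y *m U))) ->
  0 <= savg (fun x => hat f x * hat (radial K) x).
Proof.
move=> r0 bK ha cf f0.
have {ha} f3 (U : 'M[R]_(3, n.+4)) : isframe U -> 0 <= savg (fun y => hat f (y *m U)).
  by case: ha f0 => -> f0; [exact: (lift_frame cf f0)|exact: f0].
pose g x := f x * radial K x.
have cg : {within unitsphere R n.+4, continuous g}.
  by apply: within_contM => //; exact: radial_continuous r0 bK.
have g4 (V : 'M[R]_(4, n.+4)) : isframe V -> 0 <= savg (fun y => hat g (y *m V)).
  move=> fV; have := savg_radial4_ge0 r0 (symbody_section fV bK) (sec_continuous fV cf).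
  have -> : (fun xi => hat (sec V f) xi * hat (radial [set u : 'rV[R]_4 | K (u *m V)]) xi) = (fun y => hat g (y *m V)).
    by apply/funext => y; rewrite hat_sec// /hat radial_section normalize_frame.
  apply => U fU; have := f3 _ (isframeM fU fV); congr (_ <= savg _).
  by apply/funext => y; rewrite hat_sec// mulmxA.
have := @lift_frames n.+4 3 n g cg g4.
rewrite addn3 => /(_ 1%:M (isframe1 _)); congr (_ <= savg _).
by apply/funext => y; rewrite mulmx1.
Qed.

End positivity.

(** * The Hahn-Banach theorem *)

Section hahn_banach.
Context {R : realType} (T : Type).
Implicit Types (f g : T -> R) (p q : (T -> R) -> R).
Variable S : (T -> R) -> Prop.
Hypothesis SD : forall f g, S f -> S g -> S (fun x => f x + g x).
Hypothesis SZ : forall c f, S f -> S (fun x => c * f x).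

Definition sublinear p :=
  (forall f g, S f -> S g -> p (fun x => f x + g x) <= p f + p g) /\
  (forall c f, 0 < c -> S f -> p (fun x => c * f x) = c * p f).

Let SN f : S f -> S (fun x => - f x).
Proof. by move=> /(SZ (-1)); under eq_fun do rewrite mulN1r. Qed.

Let sublinearZ q c f : sublinear q -> 0 <= c -> S f -> q (fun x => c * f x) = c * q f.
Proof.
move=> [qD qZ]; rewrite le_eqVlt => /predU1P[<-|c0] Sf; last exact: qZ.
have := qZ 2 _ (ltr0n R 2) (SZ 0 Sf).
rewrite (_ : (fun x => 2 * (0 * f x)) = fun x => 0 * f x); last by apply/funext => x; ring.
by move=> ?; rewrite mul0r; lra.
Qed.

Let sublinear_lb q f g : sublinear q -> S f -> S g -> q g - q (fun x => - f x) <= q (fun x => f x + g x).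
Proof.
move=> [qD qZ] Sf Sg; have := qD _ _ (SD Sf Sg) (SN Sf).
rewrite (_ : (fun x => f x + g x - f x) = g); first by move=> ?; lra.
by apply/funext => x; ring.
Qed.

Let inf_le (A : set R) m x : (forall y, A y -> m <= y) -> A x -> inf A <= x.
Proof. by move=> lbA Ax; apply: inf_lbound => //; exists m. Qed.

(** A minimal sublinear functional q below p is additive: for each g, inf over t >= 0 of q(f + t g)
    - t q(g) is again sublinear and below q, so minimality gives q(f) <= q(f + g) - q(g). *)
Lemma sublinear_minorant p : sublinear p ->
  exists L, [/\ forall f g, S f -> S g -> L (fun x => f x + g x) = L f + L g,
    forall c f, S f -> L (fun x => c * f x) = c * L f & forall f, S f -> L f <= p f].
Proof.
move=> sp; pose Q := {q | sublinear q /\ forall f, S f -> q f <= p f}.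
(* The order is reversed: a maximal element for Zorn is a pointwise minimal functional. *)
pose le (q q' : Q) := `[< forall f, S f -> sval q' f <= sval q f >].
have [|||q qmin] := @ZL_preorder Q (exist _ p (conj sp (fun f _ => lexx _))) le.
- by move=> q; apply/asboolP => f Sf.
- by move=> q1 q2 q3 /asboolP H1 /asboolP H2; apply/asboolP => f Sf; exact: le_trans (H2 f Sf) (H1 f Sf).
(* A chain is bounded by its pointwise infimum, which is finite because q(f) >= - p(-f). Totality
   lets a single q serve both f and g in the proof of subadditivity. *)
- move=> C Ctot.
  have [[q0 Cq0]|C0] := pselect (C !=set0); last first.
    exists (exist _ p (conj sp (fun f _ => lexx _))) => s Cs; by case: C0; exists s.
  pose E f := [set sval q f | q in C].
  have lb f : S f -> forall y, E f y -> - p (fun x => - f x) <= y.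
    move=> Sf _ [[q [sq qp]] Cq <-] /=; have := sublinear_lb sq Sf (SZ 0 Sf).
    rewrite (sublinearZ sq (lexx _) Sf) (_ : (fun x => f x + 0 * f x) = f); last by apply/funext => x; ring.
    by have := qp _ (SN Sf); lra.
  have Eq0 f : E f !=set0 by exists (sval q0 f); exists q0.
  pose i f := inf (E f).
  have ile (q : Q) f : S f -> C q -> i f <= sval q f.
    by move=> Sf Cq; apply: (inf_le (lb f Sf)); exists q.
  have si : sublinear i.
    split=> [f g Sf Sg|c f c0 Sf].
      apply/ler_addgt0Pl => e e0; have e20 : 0 < e / 2 by rewrite divr_gt0.
      have hi h : S h -> has_inf (E h) by move=> Sh; split => //; exists (- p (fun x => - h x)); exact: lb.
      have [_ [q1 Cq1 <-] h1] := inf_adherent e20 (hi f Sf).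
      have [_ [q2 Cq2 <-] h2] := inf_adherent e20 (hi g Sg).
      have [q [Cq l1 l2]] : exists q : Q, [/\ C q, sval q f <= sval q1 f & sval q g <= sval q2 g].
        have [/asboolP H|/asboolP H] := Ctot _ _ Cq1 Cq2.
          by exists q2; split => //; exact: H.
        by exists q1; split => //; exact: H.
      apply: le_trans (ile q _ (SD Sf Sg) Cq) _.
      have [[qD _] _] := svalP q; apply: le_trans (qD _ _ Sf Sg) _.
      by rewrite -/(i f) -/(i g) in h1 h2; lra.
    apply/le_anti/andP; split.
      rewrite -ler_pdivrMl//; apply: lb_le_inf => // _ [q Cq <-].
      rewrite ler_pdivrMl//; have [[_ qZ] _] := svalP q; rewrite -qZ//.
      by apply: ile => //; exact: SZ.
    apply: lb_le_inf => // _ [q Cq <-]; have [[_ qZ] _] := svalP q; rewrite qZ// ler_pM2l//.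
    exact: ile.
  have ip f : S f -> i f <= p f.
    by move=> Sf; apply: le_trans (ile q0 f Sf Cq0) _; have [_ H] := svalP q0; exact: H.
  by exists (exist _ i (conj si ip)) => q Cq; apply/asboolP => f Sf; exact: ile.
have [sq qp] := svalP q; have [qD qZ] := sq.
have q0 f : S f -> sval q (fun x => 0 * f x) = 0 by move=> Sf; rewrite (sublinearZ sq (lexx _) Sf) mul0r.
have add f g : S f -> S g -> sval q (fun x => f x + g x) = sval q f + sval q g.
  move=> Sf Sg; apply/le_anti/andP; split; first exact: qD.
  pose E h := [set sval q (fun x => h x + t * g x) - t * sval q g | t in [set t | 0 <= t]].
  have lb h : S h -> forall y, E h y -> - sval q (fun x => - h x) <= y.
    move=> Sh _ [t /= t0 <-]; have := sublinear_lb sq Sh (SZ t Sg).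
    by rewrite (sublinearZ sq t0 Sg); lra.
  have E0 h : E h !=set0 by exists (sval q (fun x => h x + 0 * g x) - 0 * sval q g); exists 0 => /=.
  pose i h := inf (E h).
  have ile h t : S h -> 0 <= t -> i h <= sval q (fun x => h x + t * g x) - t * sval q g.
    by move=> Sh t0; apply: (inf_le (lb h Sh)); exists t.
  have iq h : S h -> i h <= sval q h.
    move=> Sh; have := ile h 0 Sh (lexx _); rewrite mul0r subr0.
    by rewrite (_ : (fun x => h x + 0 * g x) = h)//; apply/funext => x; ring.
  have si : sublinear i.
    split=> [f1 f2 Sf1 Sf2|c h c0 Sh].
      apply/ler_addgt0Pl => e e0; have e20 : 0 < e / 2 by rewrite divr_gt0.
      have hi h : S h -> has_inf (E h) by move=> Sh; split => //; exists (- sval q (fun x => - h x)); exact: lb.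
      have [_ [t1 /= t10 <-] h1] := inf_adherent e20 (hi f1 Sf1).
      have [_ [t2 /= t20 <-] h2] := inf_adherent e20 (hi f2 Sf2).
      have := ile _ _ (SD Sf1 Sf2) (addr_ge0 t10 t20).
      rewrite (_ : (fun x => f1 x + f2 x + (t1 + t2) * g x) = fun x => (f1 x + t1 * g x) + (f2 x + t2 * g x)); last by apply/funext => x; ring.
      have := qD _ _ (SD Sf1 (SZ t1 Sg)) (SD Sf2 (SZ t2 Sg)).
      by rewrite -/(i f1) -/(i f2) in h1 h2; lra.
    apply/le_anti/andP; split.
      rewrite -ler_pdivrMl//; apply: lb_le_inf => // _ [t /= t0 <-].
      rewrite ler_pdivrMl//; have := ile _ _ (SZ c Sh) (mulr_ge0 (ltW c0) t0).
      rewrite (_ : (fun x => c * h x + c * t * g x) = fun x => c * (h x + t * g x)); last by apply/funext => x; ring.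
      by rewrite qZ ?mulrBr ?mulrA//; apply: SD => //; exact: SZ.
    apply: lb_le_inf => // _ [t /= t0 <-].
    have := ile h (t / c) Sh (divr_ge0 t0 (ltW c0)); rewrite -(ler_pM2l c0) => /le_trans; apply.
    rewrite mulrBr -(qZ c _ c0 (SD Sh (SZ (t / c) Sg))).
    rewrite (_ : (fun x => c * (h x + t / c * g x)) = fun x => c * h x + t * g x); last first.
      by apply/funext => x; field; rewrite gt_eqF.
    by rewrite mulrA mulrCA divff ?gt_eqF// mulr1.
  have := qmin (exist _ i (conj si (fun h Sh => le_trans (iq h Sh) (qp h Sh)))).
  move=> /(_ _)/asboolP H; have := H (introT (asboolP _) iq) f Sf => /=.
  have := ile f 1 Sf ler01; rewrite (_ : (fun x => f x + 1 * g x) = fun x => f x + g x); last by apply/funext => x; ring.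
  by lra.
exists (sval q); split => // c f Sf.
have [c0|c0] := leP 0 c; first exact: sublinearZ.
have c0' : 0 <= - c by rewrite oppr_ge0 ltW.
have := add _ _ (SZ c Sf) (SZ (- c) Sf); rewrite (sublinearZ sq c0' Sf).
rewrite (_ : (fun x => c * f x + - c * f x) = fun x => 0 * f x); last by apply/funext => x; ring.
by rewrite q0// mulNr; lra.
Qed.

End hahn_banach.

(** * The Riesz representation theorem *)

Section riesz.
(** The induction step of the layer estimate in [I_le], isolated as linear arithmetic. *)
Lemma telescope_step {R : realType} (i1 i0 m l1 l0 c : R) :
  i1 - i0 <= m -> m <= l1 - l0 -> i0 <= l0 + c -> i1 <= l1 + c.
Proof. lra. Qed.
Context {R : realType} {m n : nat}.
Local Notation V := ('M[R]_(m, n)).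
Variables (X : set V) (L : (V -> R) -> R).
Implicit Types (f g phi : V -> R) (c : R).
Hypothesis cX : compact X.
Local Notation C phi := {within X, continuous phi}.
Hypothesis LD : forall f g, C f -> C g -> L (fun x => f x + g x) = L f + L g.
Hypothesis LZ : forall c f, C f -> L (fun x => c * f x) = c * L f.
Hypothesis Lpos : forall f, C f -> (forall x, X x -> 0 <= f x) -> 0 <= L f.

Let C_cst c : C (fun=> c : R).
Proof. by move=> x; exact: cvg_cst. Qed.

Let CD f g : C f -> C g -> C (fun x => f x + g x).
Proof. by move=> cf cg x; apply: cvgD; [exact: cf|exact: cg]. Qed.

Let CZ c f : C f -> C (fun x => c * f x).
Proof. by move=> cf; exact: within_contM. Qed.

Let CB f g : C f -> C g -> C (fun x => f x - g x).
Proof. by move=> cf cg x; apply: cvgB; [exact: cf|exact: cg]. Qed.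

Let Cmin f g : C f -> C g -> C (fun x => Num.min (f x) (g x)).
Proof. by move=> cf cg x; apply: continuous_min; [exact: cf|exact: cg]. Qed.

Let Cmax f g : C f -> C g -> C (fun x => Num.max (f x) (g x)).
Proof. by move=> cf cg x; apply: continuous_max; [exact: cf|exact: cg]. Qed.

Let L0 : L (fun=> 0) = 0.
Proof. by have := LZ 0 (@C_cst 0); rewrite !mul0r. Qed.

Let LB f g : C f -> C g -> L (fun x => f x - g x) = L f - L g.
Proof.
move=> cf cg; have := LD cf (@CZ (-1) g cg); rewrite LZ// mulN1r => <-.
by congr L; apply/funext => x; rewrite mulN1r.
Qed.

Let Lmono f g : C f -> C g -> (forall x, X x -> f x <= g x) -> L f <= L g.
Proof. by move=> cf cg fg; rewrite -subr_ge0 -LB//; apply: Lpos => [|x /fg]; [exact: CB|rewrite subr_ge0]. Qed.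

Let sum_cont k (F : nat -> V -> R) : (forall i, C (F i)) ->
  C (fun x => \sum_(i < k) F i x) /\ L (fun x => \sum_(i < k) F i x) = \sum_(i < k) L (F i).
Proof.
move=> cF; elim: k => [|k [IHc IHL]].
  rewrite (_ : (fun x => _) = fun=> 0); last by apply/funext => x; rewrite big_ord0.
  by rewrite big_ord0; split; [exact: C_cst|exact: L0].
rewrite (_ : (fun x => _) = fun x => \sum_(i < k) F i x + F k x); last by apply/funext => x; rewrite big_ord_recr.
by rewrite LD// IHL big_ord_recr; split => //; exact: CD.
Qed.

(** An increasing sequence of nonnegative continuous functions with limit at least 1 on the part of
    A in X, as in the Daniell construction: the sequence stands for a lower semicontinuous majorant
    of the indicator, and s bounds its integral. *)
Definition covering (A : set V) (psi : nat -> V -> R) (s : R) :=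
  [/\ forall k, C (psi k), forall k x, X x -> 0 <= psi k x <= psi k.+1 x,
      forall x c, A x -> X x -> c < 1 -> exists k, c < psi k x &
      forall k, L (psi k) <= s].

Let covering_le A psi s x k l : covering A psi s -> X x -> (k <= l)%N -> psi k x <= psi l x.
Proof.
move=> [_ inc _ _] Xx /subnK <-; elim: (l - k)%N => [|j IH]; first by rewrite add0n.
by rewrite addSn; apply: le_trans IH _; have /andP[] := inc (j + k)%N x Xx.
Qed.

Let covering_ge0 A psi s x k : covering A psi s -> X x -> 0 <= psi k x.
Proof. by move=> [_ inc _ _] Xx; have /andP[] := inc k x Xx. Qed.

Definition outer (A : set V) : \bar R :=
  ereal_inf [set s%:E | s in [set s | exists psi, covering A psi s]].

Let outer_le A psi s : covering A psi s -> (outer A <= s%:E)%E.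
Proof. by move=> cA; apply: ereal_inf_lbound; exists s => //; exists psi. Qed.

Let covering_bound_ge0 A psi s : covering A psi s -> 0 <= s.
Proof. by move=> cA; have [cp _ _ /(_ 0) /(le_trans _)] := cA; apply; apply: Lpos => // x; exact: (covering_ge0 _ cA). Qed.

Let outer0 : outer set0 = 0%E.
Proof.
apply/le_anti/andP; split.
  apply: (@outer_le _ (fun _ _ => 0)); split=> [k|k x _|x c []|k]; [exact: (@C_cst 0)|by rewrite lexx|by rewrite L0].
by apply: le_ereal_inf_tmp => _ [s [psi cA] <-]; rewrite lee_fin; exact: covering_bound_ge0 cA.
Qed.

Let outer_ge0 A : (0 <= outer A)%E.
Proof. by apply: le_ereal_inf_tmp => _ [s [psi cA] <-]; rewrite lee_fin; exact: covering_bound_ge0 cA. Qed.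

Let outer_homo : {homo outer : A B / A `<=` B >-> (A <= B)%E}.
Proof.
move=> A B AB; apply: ereal_inf_le_tmp => _ [s [psi [cp inc cov ub]] <-]; exists s => //; exists psi.
by split => // x c /AB; exact: cov.
Qed.

Let covering1 A : covering A (fun _ _ => 1) (L (fun=> 1)).
Proof. by split=> [k|k x _|x c _ _ c1|k]; [exact: (@C_cst 1)|rewrite ler01 lexx|exists 0|]. Qed.

Let outer_fin A : outer A \is a fin_num.
Proof. by rewrite ge0_fin_numE// (le_lt_trans (outer_le (covering1 A)))// ltry. Qed.

Let outer_adherent A e : 0 < e -> exists psi, exists2 s, covering A psi s & s <= fine (outer A) + e.
Proof.
move=> e0; have [_ [s [psi cA] <-]] := lb_ereal_inf_adherent e0 (outer_fin A).
rewrite -/(outer A) -[X in (X + _)%E](fineK (outer_fin A)) -EFinD lte_fin => /ltW se.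
by exists psi; exists s.
Qed.

Let outer_sigma_subadditive : sigma_subadditive outer.
Proof.
move=> F; have [->|soo] := eqVneq (\sum_(i <oo) outer (F i))%E +oo%E; first by rewrite leey.
have sfin : (\sum_(i <oo) outer (F i))%E \is a fin_num.
  by rewrite ge0_fin_numE ?ltey// nneseries_ge0.
apply/lee_addgt0Pr => e e0.
have ei i : 0 < e / (2 ^ i.+1)%:R by rewrite divr_gt0// ltr0n expn_gt0.
have /choice[psi /choice[s cs]] : forall i, exists psi, exists s, covering (F i) psi s /\ s <= fine (outer (F i)) + e / (2 ^ i.+1)%:R.
  by move=> i; have [psi [s H1 H2]] := outer_adherent (F i) (ei i); exists psi; exists s.
have cov i := proj1 (cs i); have sle i := proj2 (cs i).
have sumC k j : C (fun x => \sum_(i < k) psi i j x).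
  by apply: (proj1 (sum_cont k (F := fun i => psi i j) _)) => i; case: (cov i).
have -> : (\sum_(i <oo) outer (F i) + e%:E = (fine (\sum_(i <oo) outer (F i)) + e)%:E)%E by rewrite EFinD fineK.
(* A diagonal choice: both the number of summands and the index inside each grow with k, so the
   sequence is increasing and every term is a finite sum. *)
apply: (@outer_le _ (fun k x => \sum_(i < k) psi i k x)); split => //.
- move=> k x Xx; apply/andP; split; first by apply: sumr_ge0 => i _; exact: covering_ge0 (cov i) Xx.
  rewrite big_ord_recr/=; apply: ler_wpDr; first exact: covering_ge0 (cov k) Xx.
  by apply: ler_sum => i _; exact: covering_le (cov i) Xx (leqnSn k).
- move=> x c [i _ Fx] Xx c1; have [_ _ /(_ x c Fx Xx c1) [k ck] _] := cov i.
  have ik : (i < k + i.+1)%N by rewrite addnS ltnS leq_addl.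
  exists (k + i.+1)%N; apply: (lt_le_trans ck).
  apply: le_trans (covering_le (cov i) Xx (leq_addr i.+1 k)) _.
  rewrite (bigD1 (Ordinal ik))//= lerDl; apply: sumr_ge0 => j _; exact: covering_ge0 (cov j) Xx.
- move=> k; rewrite (proj2 (sum_cont k (F := fun i => psi i k) _)); last by move=> i; case: (cov i).
  rewrite -lee_fin EFinD fineK//; apply: le_trans (epsilon_trick xpredT (fun i => outer_ge0 (F i)) (ltW e0)).
  apply: le_trans (nneseries_lim_ge k _); last by move=> i _ _; rewrite adde_ge0// lee_fin ltW.
  rewrite big_mkord -sumEFin; apply: lee_sum => i _.
  rewrite -[outer (F i)](fineK (outer_fin _)) -EFinD lee_fin; apply: le_trans (sle i).
  by case: (cov i) => _ _ _; exact.
Qed.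

HB.instance Definition _ := isOuterMeasure.Build R V outer outer0 outer_ge0 outer_homo outer_sigma_subadditive.

(** Continuous functions that increase with j to the indicator of the set where u > r, reaching 1
    after finitely many steps at each point. *)
Let ramp (u : V -> R) (r : R) (j : nat) (x : V) : R := Num.min 1 (j%:R * Num.max 0 (u x - r)).

Let ramp_cont (u : V -> R) (r : R) j : C u -> C (ramp u r j).
Proof.
move=> cu; apply: Cmin; first exact: (@C_cst 1).
apply: CZ; apply: Cmax; first exact: (@C_cst 0).
exact: (CB cu (@C_cst r)).
Qed.

Let ramp01 u r j x : 0 <= ramp u r j x <= 1.
Proof. by rewrite /ramp le_min ler01 ge_min lexx mulr_ge0// le_max lexx. Qed.

Let ramp_le u r j k x : (j <= k)%N -> ramp u r j x <= ramp u r k x.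
Proof.
move=> jk; rewrite /ramp le_min !ge_min lexx/=; apply/orP; right.
by rewrite ler_wpM2r ?le_max ?lexx// ler_nat.
Qed.

Let ramp0 u r j x : u x <= r -> ramp u r j x = 0.
Proof. by move=> ur; rewrite /ramp max_l ?subr_le0// mulr0 min_r. Qed.

Let ramp1 u r x : r < u x -> exists j, ramp u r j x = 1.
Proof.
move=> ur; have d0 : 0 < u x - r by rewrite subr_gt0.
have [j jP] := exists_natSinv_lt d0; exists j.+1.
have H : 1 <= j.+1%:R * (u x - r) by rewrite -ler_pdivrMl ?ltr0n// mulr1 ltW.
by rewrite /ramp (max_r (ltW d0)) min_l.
Qed.

(** A covering psi of A splits along the ramps. The products psi_k ramp_k cover the part where u >
    r, with bound t, the supremum of their values under L. For a fixed late j the functions psi_k (1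
    - ramp_j) cover the rest, where ramp_j vanishes, with bound s - t + e/2. *)
Let caratheodory_superlevel (u : V -> R) (r : R) : C u -> outer.-caratheodory [set x | r < u x].
Proof.
move=> cu; apply: le_caratheodory_measurable => A.
have cr j : C (ramp u r j) by exact: ramp_cont.
have H e : 0 < e -> fine (outer (A `&` [set x | r < u x])) + fine (outer (A `&` ~` [set x | r < u x])) <= fine (outer A) + e.
  move=> e0; have e20 : 0 < e / 2 by rewrite divr_gt0.
  have [psi [s cov se]] := outer_adherent A e20; have [cp inc cv ub] := cov.
  pose E := [set L (fun x => psi k x * ramp u r k x) | k in [set: nat]].
  have cpr k j : C (fun x => psi k x * ramp u r j x) by apply: within_contM.
  have Es k : L (fun x => psi k x * ramp u r k x) <= s.
    apply: le_trans (ub k); apply: Lmono => // x Xx; have /andP[_ r1] := ramp01 u r k x.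
    by rewrite ler_piMr//; exact: covering_ge0 cov Xx.
  have supE : has_sup E by split; [exists (L (fun x => psi 0%N x * ramp u r 0%N x)); exists 0%N|exists s => _ [k _ <-]; exact: Es].
  pose t := sup E.
  have Et k : L (fun x => psi k x * ramp u r k x) <= t by apply: ub_le_sup; [case: supE|exists k].
  have [_ [j _ <-] tj] := sup_adherent e20 supE; rewrite -/t in tj.
  have o1 : fine (outer (A `&` [set x | r < u x])) <= t.
    rewrite -lee_fin fineK//; apply: (@outer_le _ (fun k x => psi k x * ramp u r k x)); split => //.
    - move=> k x Xx; have /andP[p0 p1] := inc k x Xx; have /andP[q0 q1] := ramp01 u r k x.
      by rewrite mulr_ge0//= ler_pM//; exact: ramp_le.
    - move=> x c [Ax /= ru] Xx c1; have [j' j'1] := ramp1 ru; have [k ck] := cv x c Ax Xx c1.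
      exists (k + j')%N; apply: (lt_le_trans ck).
      apply: le_trans (covering_le cov Xx (leq_addr j' k)) _.
      have -> : ramp u r (k + j') x = 1; last by rewrite mulr1.
      have /andP[_ r1] := ramp01 u r (k + j') x; apply/le_anti; rewrite r1 -j'1.
      exact: ramp_le (leq_addl _ _).
  have o2 : fine (outer (A `&` ~` [set x | r < u x])) <= s - t + e / 2.
    rewrite -lee_fin fineK//; apply: (@outer_le _ (fun k x => psi k x - psi k x * ramp u r j x)).
    have f1 k x : psi k x - psi k x * ramp u r j x = psi k x * (1 - ramp u r j x) by rewrite mulrBr mulr1.
    have r10 x : 0 <= 1 - ramp u r j x by rewrite subr_ge0; have /andP[] := ramp01 u r j x.
    split.
    - by move=> k; exact: CB.
    - move=> k x Xx; have /andP[p0 p1] := inc k x Xx.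
      by rewrite !f1 mulr_ge0//= ler_wpM2r.
    - move=> x c [Ax /= /negP ur] Xx c1; rewrite -leNgt in ur; have [k ck] := cv x c Ax Xx c1.
      by exists k; rewrite ramp0// mulr0 subr0.
    - move=> k; apply: (@le_trans _ _ (L (fun x => psi (k + j)%N x - psi (k + j)%N x * ramp u r j x))).
        apply: Lmono => [||x Xx]; [exact: CB|exact: CB|].
        by rewrite !f1 ler_wpM2r//; exact: covering_le cov Xx (leq_addr _ _).
      rewrite LB//; have := ub (k + j)%N.
      have : L (fun x => psi j x * ramp u r j x) <= L (fun x => psi (k + j)%N x * ramp u r j x).
        apply: Lmono => // x Xx; rewrite ler_wpM2r//; first by case/andP: (ramp01 u r j x).
        exact: covering_le cov Xx (leq_addl _ _).
      by lra.
  by lra.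
pose G := [set x | r < u x]; suff : (outer (A `&` G) + outer (A `&` ~` G) <= outer A)%E by [].
rewrite -(fineK (outer_fin (A `&` G))) -(fineK (outer_fin (A `&` ~` G))).
rewrite -(fineK (outer_fin A)) -EFinD lee_fin.
by apply/ler_addgt0Pr => e e0; exact: H.
Qed.

Let cara := caratheodory_type (outer : set V -> \bar R).

(** Superlevel sets of the entries are Caratheodory measurable, hence all Borel sets are, and the
    measure can be carried to the Borel sets along the identity. *)
Let measurable_id_cara : measurable_fun setT (idfun : cara -> V).
Proof.
apply: measurable_mxP => i j; apply: (measurability _ (RGenOInfty.measurableE R)).
move=> _ [_ [r ->] <-]; rewrite setTI.
rewrite (_ : _ @^-1` _ = [set x : V | r < x i j]); last by apply/seteqP; split => x; rewrite /= in_itv/= andbT.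
by apply: caratheodory_superlevel; apply: continuous_subspaceT; exact: coord_continuous.
Qed.

Let outerm : {outer_measure set V -> \bar R} := outer.
Let cm : {measure set (caratheodory_type outerm) -> \bar R} := (outerm : set (caratheodory_type outerm) -> \bar R).
Let mu := pushm cm measurable_id_cara.

Let muE A : mu A = outer A. Proof. by []. Qed.

Let mX : measurable X. Proof. exact: compact_mx_measurable. Qed.

(** As in Dini's theorem, compactness yields one k with psi_k > 1 - e on all of X. This bounds the
    mass of X from below. *)
Let dini psi s e : 0 < e -> covering X psi s -> (1 - e) * L (fun=> 1) <= s.
Proof.
move=> e0 cov; have [cp inc cv ub] := cov.
have near_cov : forall x, X x -> \forall y \near x & i \near \oo, X y -> 1 - e < psi i y.
  move=> x Xx; have e1 : 1 - e < 1 by rewrite ltrBlDr ltrDl.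
  have [k ck] := cv x _ Xx Xx e1; have d0 : 0 < psi k x - (1 - e) by rewrite subr_gt0.
  have [d dp Hd] := (iffLR (within_contP _ _) (cp k)) x Xx _ d0.
  exists (ball x d, [set i | (k <= i)%N]) => /=.
    by split; [apply/nbhs_ballP; exists d|exists k].
  move=> [y i] /= [xy ki] Xy; apply: lt_le_trans (covering_le cov Xy ki).
  have : `|x - y| < d by move: xy; rewrite -ball_normE.
  by move=> /(Hd y Xy); rewrite ltr_norml => /andP[_]; lra.
have [k _ /(_ k (leqnn k)) Hk] := (iffLR (compact_near_coveringP X) cX) nat \oo _ _ near_cov.
have -> : (1 - e) * L (fun=> 1) = L (fun x => (1 - e) * 1) by rewrite -(@LZ (1 - e) (fun=> 1) (@C_cst 1)).
apply: le_trans (ub k); apply: Lmono => [||x Xx]; [exact: (@C_cst ((1 - e) * 1))|exact: cp|].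
by rewrite mulr1; apply/ltW/Hk.
Qed.

Let L1_ge0 : 0 <= L (fun=> 1).
Proof. by apply: Lpos => //; exact: (@C_cst 1). Qed.

Let mu_X : mu X = (L (fun=> 1))%:E.
Proof.
rewrite muE; apply/le_anti/andP; split; first exact: outer_le (covering1 X).
apply: le_ereal_inf_tmp => _ [s [psi cov] <-]; rewrite lee_fin.
have s0 := covering_bound_ge0 cov.
apply/ler_addgt0Pr => e e0; pose d := e / (L (fun=> 1) + 1).
have p0 : 0 < L (fun=> 1) + 1 by rewrite ltr_wpDl.
have d0 : 0 < d by rewrite divr_gt0.
have := dini d0 cov; rewrite mulrBl mul1r lerBlDr => /le_trans; apply; rewrite lerD2l.
by rewrite /d mulrAC ler_pdivrMr// ler_pM2l// lerDl.
Qed.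

Let mu_setT : mu (~` X) = 0%E.
Proof.
rewrite muE; apply/le_anti/andP; split; last exact: outer_ge0.
apply: (@outer_le _ (fun _ _ => 0)); split=> [k|k x _|x c nXx Xx|k].
- exact: (@C_cst 0).
- by rewrite lexx.
- by case: nXx.
- by rewrite L0.
Qed.

Let C_measurable phi : C phi -> measurable_fun X phi.
Proof.
move=> /continuousP cphi; apply: (measurability _ (RGenOpens.measurableE R)).
move=> _ [_ [a [b ->] <-]].
have /cphi/open_subspaceP[W oW WX] : open (`]a, b[%classic : set R) by exact: interval_open.
by rewrite setIC -WX; apply: measurableI => //; exact: open_mx_measurable.
Qed.

Let C_integrable phi : C phi -> mu.-integrable X (EFin \o phi).
Proof.
move=> cphi; apply: measurable_bounded_integrable => //.
- by rewrite [X in (X < _)%E]mu_X ltry.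
- exact: C_measurable.
have [M M0 HM] := within_cont_bounded cX cphi.
by exists M; split; [exact: num_real|move=> x Mx y Xy; exact: le_trans (HM y Xy) (ltW Mx)].
Qed.

Local Notation I phi := (Rintegral mu X phi).

Let I_cst c : I (fun=> c) = c * L (fun=> 1).
Proof. by rewrite Rintegral_cst// [X in fine X]mu_X. Qed.

(** Cut phi into layers of height w = 1/(N+1). The layer from k w to (k+1) w is at most w on [A k]
    and zero elsewhere, and equals w on [A k.+1]; so its integral is bounded by L of the layer below
    it, and the bottom layer costs at most w L(1). *)
Let I_le phi : C phi -> (forall x, X x -> 0 <= phi x <= 1) -> I phi <= L phi.
Proof.
move=> cphi phi01.
have Hw N : I phi <= L phi + N.+1%:R^-1 * L (fun=> 1).
  pose w : R := N.+1%:R^-1; have w0 : 0 < w by rewrite invr_gt0 ltr0n.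
  pose cut (k : nat) (x : V) : R := Num.min (phi x) (k%:R * w).
  have Ccut k : C (cut k) by apply: Cmin => //; exact: (@C_cst (k%:R * w)).
  pose A k := X `&` phi @^-1` `]k%:R * w, +oo[%classic.
  have mA k : measurable (A k) by apply: C_measurable => //; exact: measurable_itv.
  have cut_le k x : 0 <= cut k.+1 x - cut k x <= w * \1_(A k) x \/ ~ X x.
    have [Xx|nXx] := pselect (X x); [left|by right].
    have kw : k.+1%:R * w = k%:R * w + w by rewrite -natr1 mulrDl mul1r.
    rewrite /cut kw indicE; have [kp|pk] := ltP (k%:R * w) (phi x).
      rewrite mem_set ?mulr1; last by split => //=; rewrite in_itv/= kp.
      by have [?|?] := leP (phi x) (k%:R * w + w); apply/andP; split; lra.
    rewrite memNset ?mulr0; last by move=> [_ /=]; rewrite in_itv/= andbT ltNge pk.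
    by rewrite min_l; [rewrite subrr lexx|lra].
  have iA k : mu.-integrable X (EFin \o (fun x => w * \1_(A k) x)).
    apply: measurable_bounded_integrable => //.
    - by rewrite [X in (X < _)%E]mu_X ltry.
    - by apply: measurable_funM => //; exact: measurable_indic.
    - exists w; split; [exact: num_real|move=> y wy x Xx; apply: (@le_trans _ _ w); last exact: ltW].
      by rewrite /= indicE; case: (_ \in _); rewrite ?mulr1 ?mulr0 ?normr0 ?(ger0_norm (ltW w0))// ltW.
  have step k : I (cut k.+1) - I (cut k) <= w * fine (mu (A k)).
    rewrite -(RintegralB mX (C_integrable (Ccut k.+1)) (C_integrable (Ccut k))).
    apply: (@le_trans _ _ (I (fun x => w * \1_(A k) x))).
      apply: (le_Rintegral mX (C_integrable (CB (Ccut k.+1) (Ccut k))) (iA k)).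
      by move=> x Xx; case: (cut_le k x) => // /andP[].
    rewrite /Rintegral.
    under eq_integral do rewrite EFinM.
    rewrite ge0_integralZl//; [|by apply: measurable_funTS; exact: measurable_indicE|by rewrite lee_fin ltW].
    rewrite integral_indic// (_ : A k `&` X = A k); last by apply/setIidPl; exact: subIsetl.
    have fineZ (y : \bar R) : y \is a fin_num -> fine (w%:E * y) <= w * fine y by move=> yf; rewrite fineM.
    exact: (fineZ (outer (A k)) (outer_fin (A k))).
  have muA k : w * fine (mu (A k.+1)) <= L (cut k.+1) - L (cut k).
    rewrite -ler_pdivlMl// -LB// -LZ//; last exact: CB.
    rewrite -lee_fin (fineK (outer_fin _)).
    apply: (@outer_le _ (fun _ x => w^-1 * (cut k.+1 x - cut k x))); split => //.
    - by move=> _; apply: CZ; exact: CB.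
    - move=> _ x Xx; rewrite lexx andbT mulr_ge0 ?invr_ge0 ?(ltW w0)//.
      by case: (cut_le k x) => // /andP[].
    - move=> x c [_ /=]; rewrite in_itv/= andbT => kp Xx c1; exists 0%N.
      have kw : k.+1%:R * w = k%:R * w + w by rewrite -natr1 mulrDl mul1r.
      rewrite /cut min_r ?min_r ?(ltW kp)//; last by apply: le_trans (ltW kp); rewrite kw lerDl ltW.
      by rewrite kw addrAC subrr add0r mulVf// gt_eqF.
  have muA0 : w * fine (mu (A 0%N)) <= w * L (fun=> 1).
    rewrite ler_pM2l// -lee_fin (fineK (outer_fin _)); exact: outer_le (covering1 _).
  have cut0 x : X x -> cut 0%N x = 0.
    by move=> Xx; rewrite /cut mul0r min_r//; case/andP: (phi01 x Xx).
  have I0 : I (cut 0%N) = 0.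
    rewrite -[RHS](mul0r (L (fun=> 1))) -(I_cst 0); apply: eq_Rintegral => x /set_mem Xx; exact: cut0.
  have LE f g : C f -> C g -> (forall x, X x -> f x = g x) -> L f = L g.
    by move=> cf cg fg; apply/le_anti; rewrite !Lmono// => x Xx; rewrite fg.
  have L0' : L (cut 0%N) = 0 by rewrite -L0; apply: LE => //; exact: (@C_cst 0).
  have ind k : I (cut k.+1) <= L (cut k) + w * L (fun=> 1).
    elim: k => [|k IH]; first by have := le_trans (step 0%N) muA0; rewrite I0 L0' subr0 add0r.
    exact: telescope_step (step k.+1) (muA k) IH.
  have -> : I phi = I (cut N.+1).
    apply: eq_Rintegral => x /set_mem Xx; rewrite /cut /w divff ?pnatr_eq0// min_l//.
    by case/andP: (phi01 x Xx).
  apply: le_trans (ind N) _; rewrite lerD2r; apply: Lmono => // x Xx.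
  by rewrite /cut ge_min lexx.
apply/ler_addgt0Pr => e e0; have [H|H] := eqVneq (L (fun=> 1)) 0.
  by apply: le_trans (Hw 0%N) _; rewrite H mulr0 lerD2l ltW.
have lp : 0 < L (fun=> 1) by rewrite lt_def H.
have [N HN] := exists_natSinv_lt (divr_gt0 e0 lp).
by apply: le_trans (Hw N) _; rewrite lerD2l -ler_pdivlMr// ltW.
Qed.

(** The reverse inequality is [I_le] for 1 - phi, since both functionals agree on constants. *)
Let I_eq01 phi : C phi -> (forall x, X x -> 0 <= phi x <= 1) -> I phi = L phi.
Proof.
move=> cphi phi01; apply/le_anti/andP; split; first exact: I_le.
have C1 := @C_cst 1.
have := I_le (CB C1 cphi); rewrite LB// (RintegralB mX (C_integrable C1) (C_integrable cphi)).
rewrite I_cst mul1r lerD2l lerN2; apply => x /phi01/andP[p0 p1].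
by rewrite subr_ge0 p1/= lerBlDr lerDl.
Qed.

Theorem riesz_representation : exists nu : {measure set V -> \bar R},
  nu (~` X) = 0%E /\ forall phi, C phi -> (\int[nu]_(x in X) (phi x)%:E)%E = (L phi)%:E.
Proof.
exists mu; split; first exact: mu_setT.
move=> phi cphi; have -> : (\int[mu]_(x in X) (phi x)%:E)%E = (I phi)%:E.
  by rewrite /Rintegral fineK//; apply: integrable_fin_num => //; exact: C_integrable.
congr EFin; have [M M0 HM] := within_cont_bounded cX cphi.
have M1 : 0 < 2 * (M + 1) by lra.
(* An affine change into values between 0 and 1; M + 1 instead of M keeps the divisor nonzero. *)
pose psi x := (2 * (M + 1))^-1 * (phi x + (M + 1)).
have cM := @C_cst (M + 1).
have cs : C (fun x => phi x + (M + 1)) by exact: CD.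
have cpsi : C psi by exact: CZ.
have psi01 x : X x -> 0 <= psi x <= 1.
  move=> Xx; have := HM x Xx; rewrite ler_norml => /andP[h1 h2].
  apply/andP; split.
    by apply: mulr_ge0; [rewrite invr_ge0 ltW|rewrite -lerBlDr sub0r; apply: le_trans h1; rewrite lerN2 lerDl].
  by rewrite /psi mulrC ler_pdivrMr// mul1r mulr_natl mulr2n lerD2r (le_trans h2)// lerDl.
have := I_eq01 cpsi psi01; rewrite /psi LZ// (RintegralZl _ mX (C_integrable cs)).
have n0 : (2 * (M + 1))^-1 != 0 by rewrite invr_eq0 gt_eqF.
move=> /(mulfI n0); rewrite LD// (RintegralD mX (C_integrable cphi) (C_integrable cM)).
have -> : L (fun=> M + 1) = (M + 1) * L (fun=> 1).
  by rewrite -LZ; [rewrite mulr1|exact: (@C_cst 1)].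
by rewrite I_cst => /addIr.
Qed.

End riesz.

(** * Averages over the Grassmannian *)

Section grassmannian_average.
Context {R : realType} {n m : nat}.
Local Notation Sn := (unitsphere R n).
Local Notation G := (grass R n m.+1).
Implicit Types (f g : 'rV[R]_n -> R).

Definition frames : set 'M[R]_(m.+1, n) := [set U | isframe U].

Let continuous_gram : continuous (fun U : 'M[R]_(m.+1, n) => U *m U^T).
Proof.
apply: continuous_mxP => i j; under eq_fun do rewrite mxE.
apply: continuous_rsum => k x; under eq_fun do rewrite mxE.
by apply: continuousM; exact: coord_continuous.
Qed.

Let continuous_proj : continuous (fun U : 'M[R]_(m.+1, n) => U^T *m U).
Proof.
apply: continuous_mxP => i j; under eq_fun do rewrite mxE.
apply: continuous_rsum => k x; under eq_fun do rewrite mxE.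
by apply: continuousM; exact: coord_continuous.
Qed.

(** The rows are unit vectors, so entries are at most 1 in absolute value; the compactness argument
    runs on the flattened matrices. *)
Lemma compact_frames : compact frames.
Proof.
have cv : continuous (@vec_mx R m.+1 n : 'rV[R]_(m.+1 * n) -> 'M[R]_(m.+1, n)).
  by apply: continuous_mxP => i j; under eq_fun do rewrite mxE; exact: coord_continuous.
have -> : frames = (@vec_mx R m.+1 n) @` (vec_mx @^-1` frames).
  apply/seteqP; split => [U fU|_ [v fv <-]//].
  by exists (mxvec U); rewrite /= ?mxvecK.
apply: continuous_compact; first exact: continuous_subspaceT.
apply: bounded_closed_compact.
  exists 1; split; first exact: num_real.
  move=> M M1 v /= fv; apply: le_trans (ltW M1); apply: mx_norm_le => // i j.
  have [p ->] : exists p : 'I_m.+1 * 'I_n, v i j = vec_mx v p.1 p.2.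
    by case/mxvec_indexP: j => k l; exists (k, l); rewrite ord1 mxE.
  have /matrixP/(_ p.1 p.1) := fv; rewrite !mxE eqxx /= => E.
  rewrite -(ler_pXn2r (n := 2))// ?nnegrE// expr1n -normrX ger0_norm ?sqr_ge0// -[leRHS]E.
  rewrite (bigD1 p.2)//= !mxE -expr2 lerDl sumr_ge0// => k _.
  by rewrite !mxE -expr2 sqr_ge0.
apply: closed_comp; first by move=> x _; exact: cv.
rewrite (_ : frames = (fun U => U *m U^T) @^-1` [set 1%:M])//.
apply: closed_comp; first by move=> x _; exact: continuous_gram.
by apply: compact_closed; [exact: norm_hausdorff|exact: compact_set1].
Qed.

Lemma grassE : G = (fun U : 'M[R]_(m.+1, n) => U^T *m U) @` frames.
Proof.
apply/seteqP; split => [P /grass_frame[U fU <-]|_ [U fU <-]]; first by exists U.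
exact: frame_grass.
Qed.

Lemma compact_grass : compact G.
Proof.
rewrite grassE; apply: continuous_compact; last exact: compact_frames.
exact: continuous_subspaceT.
Qed.

Definition favg f (U : 'M[R]_(m.+1, n)) : R := savg (fun y => hat f (y *m U)).

Definition gavg f (P : 'M[R]_n) : R := favg f (frame m.+1 P).

Lemma bmeas_favg f U : {within Sn, continuous f} -> bmeas (fun y : 'rV[R]_m.+1 => hat f (y *m U)).
Proof.
move=> cf; have mU := @measurable_mulmxr R 1 m.+1 n U; exact: (bmeas_comp mU (hat_bmeas cf)).
Qed.

Lemma gavgE f U : {within Sn, continuous f} -> isframe U -> gavg f (U^T *m U) = favg f U.
Proof.
move=> cf fU; have [fF FE] := frameP (frame_grass fU).
exact: savg_frame_indep fF fU FE (hat_bmeas cf).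
Qed.

Lemma radon_gavg f P : {within Sn, continuous f} -> G P -> radon m.+1 f P = (gavg f P)%:E.
Proof. by move=> cf /frameP[fF _]; rewrite /radon sphint_savg//; exact: hat_bmeas. Qed.

Lemma favg_continuous f : {within Sn, continuous f} -> {within frames, continuous (favg f)}.
Proof.
move=> cf; apply/within_contP => U fU e e0; have e20 : 0 < e / 2 by rewrite divr_gt0.
have [d d0 Hd] := compact_unif (@compact_unitsphere R n) cf e20.
(* For a unit y each entry of [y *m (U - W)] is a sum of m+1 terms, each at most the norm of U -
   W. *)
exists (d / m.+1%:R); first by rewrite divr_gt0.
move=> W fW UW; apply: (@le_lt_trans _ _ (e / 2)); last by rewrite ltr_pdivrMr// ltr_pMr// ltr1n.
have bU := bmeas_favg U cf; have bW := bmeas_favg W cf.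
rewrite /favg -savgB//.
have close y : enorm y = 1 -> `|hat f (y *m U) - hat f (y *m W)| <= e / 2.
  move=> y1; rewrite !hat_id ?enorm_frame//; apply/ltW/Hd; rewrite /unitsphere/= ?enorm_frame//.
  rewrite -mulmxBr; apply: le_lt_trans (_ : m.+1%:R * `|U - W| < d); last by rewrite mulrC -ltr_pdivlMr.
  apply: mx_norm_le => [|i j]; first by rewrite mulr_ge0.
  rewrite mxE; apply: le_trans (ler_norm_sum _ _ _) _.
  apply: le_trans (_ : \sum_(k < m.+1) `|U - W| <= _); last by rewrite sumr_const card_ord mulr_natl.
  apply: ler_sum => k _; rewrite normrM ord1 -[leRHS]mul1r; apply: ler_pM => //; last exact: coord_le_mx_norm.
  by rewrite -y1; exact: coord_le_enorm.
have bD := bmeasB bU bW; rewrite ler_norml; apply/andP; split.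
  by apply: savg_ge_cst => // y /close; rewrite ler_norml => /andP[].
rewrite -(@savg_cst R m.+1 (e / 2)); apply: le_savg => //; first exact: bmeas_cst.
by move=> y /close; rewrite ler_norml => /andP[].
Qed.

(** [frame] is an arbitrary choice and need not be continuous. Instead the map from frames to
    projections is closed, being continuous on a compact set, so continuity descends from [favg]. *)
Lemma gavg_continuous f : {within Sn, continuous f} -> {within G, continuous (gavg f)}.
Proof.
move=> cf; apply/continuous_closedP => A cA; apply/closed_subspaceP.
have /continuous_closedP/(_ A cA)/closed_subspaceP[W cW WE] := favg_continuous cf.
exists ((fun U : 'M[R]_(m.+1, n) => U^T *m U) @` (frames `&` W)).
  apply: compact_closed; first exact: norm_hausdorff.
  apply: continuous_compact; first exact: continuous_subspaceT.
  by apply: compact_closedI => //; exact: compact_frames.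
apply/seteqP; split => [_ [[U [fU WU] <-] GP]|P [AP GP]].
  split=> //; have [AU _] : (favg f @^-1` A `&` frames) U by rewrite -WE.
  by change (A (gavg f (U^T *m U))); rewrite gavgE.
have [U fU E] := grass_frame GP; split => //; exists U => //; split => //.
have [] : (W `&` frames) U; last by [].
by rewrite WE; split => //; change (A (favg f U)); rewrite -gavgE// E.
Qed.

Lemma gavgD f g P : {within Sn, continuous f} -> {within Sn, continuous g} ->
  gavg (fun x => f x + g x) P = gavg f P + gavg g P.
Proof. by move=> cf cg; rewrite /gavg /favg -savgD//; exact: bmeas_favg. Qed.

Lemma gavgZ c f P : {within Sn, continuous f} -> gavg (fun x => c * f x) P = c * gavg f P.
Proof. by move=> cf; rewrite /gavg /favg -savgZ//; exact: bmeas_favg. Qed.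

Lemma gavg_cst c P : gavg (fun=> c) P = c.
Proof. exact: savg_cst. Qed.

End grassmannian_average.

Section representing_measure.
Context {R : realType} {n m : nat}.
Variables (r b : R) (K : set 'rV[R]_n.+4).
Hypotheses (r0 : 0 < r) (bK : symbody r b K) (hm : m.+1 = 2 \/ m.+1 = 3).
Local Notation Sn := (unitsphere R n.+4).
Local Notation G := (grass R n.+4 m.+1).
Local Notation cts f := {within Sn, continuous f}.
Local Notation C phi := {within G, continuous phi}.
Implicit Types (f g : 'rV[R]_n.+4 -> R) (phi : 'M[R]_n.+4 -> R).

Let I f : R := savg (fun x => hat f x * hat (radial K) x).

Let bI f : cts f -> bmeas (fun x => hat f x * hat (radial K) x).
Proof. by move=> cf; apply: bmeasM; apply: hat_bmeas => //; exact: radial_continuous r0 bK. Qed.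

Let cD f g : cts f -> cts g -> cts (fun x => f x + g x).
Proof. by move=> cf cg x; apply: cvgD; [exact: cf|exact: cg]. Qed.

Let cC (c : R) : cts (fun=> c).
Proof. by move=> x; exact: cvg_cst. Qed.

Let cZ (c : R) f : cts f -> cts (fun x => c * f x).
Proof. by move=> cf; apply: within_contM => //; exact: (@cC c). Qed.

Let ID f g : cts f -> cts g -> I (fun x => f x + g x) = I f + I g.
Proof.
move=> cf cg; rewrite /I -savgD; [|exact: bI|exact: bI].
by congr savg; apply/funext => x; rewrite /hat mulrDl.
Qed.

Let IZ c f : cts f -> I (fun x => c * f x) = c * I f.
Proof.
move=> cf; rewrite /I -savgZ; last exact: bI.
by congr savg; apply/funext => x; rewrite /hat mulrA.
Qed.

Lemma savg_radial_gavg_ge0 f : cts f -> (forall P, G P -> 0 <= gavg (m := m) f P) ->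
  0 <= savg (fun x => hat f x * hat (radial K) x).
Proof.
move=> cf f0; apply: (savg_radial_ge0 r0 bK hm cf) => U fU.
by rewrite -[leRHS]/(favg f U) -gavgE//; apply: f0; exact: frame_grass.
Qed.

Let E (phi : 'M[R]_n.+4 -> R) : set R :=
  [set I g | g in [set g : 'rV[R]_n.+4 -> R |
    cts g /\ forall P : 'M[R]_n.+4, G P -> phi P <= gavg (m := m) g P]].

Let p phi := inf (E phi).

(** A constant bound M of phi is an admissible g; conversely any admissible g has g + M with
    nonnegative averages, so positivity bounds I(g) below by -M I(1). *)
Let E_inf phi : C phi -> has_inf (E phi).
Proof.
move=> cphi; have [M M0 HM] := within_cont_bounded compact_grass cphi; split.
  exists (I (fun=> M)); exists (fun=> M) => //; split; first exact: (@cC M).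
  by move=> P GP; rewrite gavg_cst (le_trans _ (HM P GP))// ler_norm.
exists (- M * I (fun=> 1)) => _ [g [cg gphi] <-].
have c1 := @cC 1; have cM1 := @cZ M _ c1.
have : 0 <= I (fun x => g x + M * 1).
  apply: savg_radial_gavg_ge0; first exact: cD.
  move=> P GP; rewrite gavgD// gavgZ// gavg_cst mulr1 -lerBlDr sub0r.
  by apply: le_trans (gphi P GP); have := HM P GP; rewrite ler_norml => /andP[].
by rewrite ID// IZ// mulNr -lerBlDr sub0r.
Qed.

Let p_le phi g : C phi -> cts g -> (forall P, G P -> phi P <= gavg (m := m) g P) -> p phi <= I g.
Proof. by move=> cphi cg gphi; apply: inf_lbound; [case: (E_inf cphi)|exists g]. Qed.

Let CD phi (psi : 'M[R]_n.+4 -> R) : C phi -> C psi -> C (fun x => phi x + psi x).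
Proof. by move=> cf cg x; apply: cvgD; [exact: cf|exact: cg]. Qed.

Let CZ (c : R) phi : C phi -> C (fun x => c * phi x).
Proof. by move=> cf; apply: within_contM => // x; exact: cvg_cst. Qed.

Let sublinear_p : sublinear (fun phi => C phi) p.
Proof.
split=> [phi psi cphi cpsi|c phi c0 cphi].
  apply/ler_addgt0Pl => e e0; have e20 : 0 < e / 2 by rewrite divr_gt0.
  have [_ [g [cg gphi] <-] hg] := inf_adherent e20 (E_inf cphi).
  have [_ [h [ch hpsi] <-] hh] := inf_adherent e20 (E_inf cpsi).
  have := p_le (CD cphi cpsi) (cD cg ch).
  move=> /(_ _)/le_trans; apply.
    by move=> P GP; rewrite gavgD// lerD ?gphi ?hpsi.
  rewrite ID//; apply: le_trans (ltW (ltrD hg hh)) _.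
  by rewrite -/(p phi) -/(p psi) addrACA -splitr addrC.
have le1 d (psi : 'M[R]_n.+4 -> R) : 0 < d -> C psi -> p (fun x => d * psi x) <= d * p psi.
  move=> d0 cpsi; rewrite -ler_pdivrMl//; apply: lb_le_inf; first by case: (E_inf cpsi).
  move=> _ [g [cg gpsi] <-]; rewrite ler_pdivrMl// -IZ//.
  apply: p_le; [exact: CZ|exact: cZ|].
  by move=> P GP; rewrite gavgZ// ler_pM2l// gpsi.
apply/le_anti; rewrite le1//=.
have ci : 0 < c^-1 by rewrite invr_gt0.
have := le1 _ _ ci (@CZ c phi cphi); rewrite ler_pdivlMl//.
rewrite (_ : (fun x => c^-1 * (c * phi x)) = phi)//.
by apply/funext => x; rewrite mulKf// gt_eqF.
Qed.

(** The minorant L is a positive functional because g = 0 is admissible for -phi when phi >= 0. It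
    extends I because L(gavg f) <= I(f) holds for f and for -f. *)
Lemma radial_representation : exists nu : {measure set 'M[R]_n.+4 -> \bar R},
  nu (~` G) = 0%E /\ forall f, cts f ->
  (\int[nu]_(P in G) (gavg (m := m) f P)%:E)%E = (savg (fun x => hat f x * hat (radial K) x))%:E.
Proof.
have [L [LD LZ Lp]] := sublinear_minorant CD CZ sublinear_p.
have Lpos phi : C phi -> (forall P, G P -> 0 <= phi P) -> 0 <= L phi.
  move=> cphi phi0; have cN := @CZ (-1) phi cphi.
  have c0 := @cC 0.
  have : L (fun x => -1 * phi x) <= I (fun=> 0).
    apply: le_trans (Lp _ cN) _; apply: p_le => // P GP.
    by rewrite gavg_cst mulN1r oppr_le0 phi0.
  have -> : I (fun=> 0) = 0.
    by rewrite /I -[RHS](@savg_cst R n.+4); congr savg; apply/funext => x; rewrite /hat mul0r.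
  by rewrite LZ// mulN1r oppr_le0.
have [nu [nu0 nuE]] := riesz_representation compact_grass LD LZ Lpos.
exists nu; split => // f cf; rewrite nuE; last exact: gavg_continuous.
have le1 g : cts g -> L (gavg (m := m) g) <= I g.
  by move=> cg; have cgg := gavg_continuous (m := m) cg; apply: le_trans (Lp _ cgg) _; exact: p_le.
congr EFin; apply/le_anti; rewrite le1//=.
have cN := @cZ (-1) f cf; have := le1 _ cN.
rewrite IZ// (_ : gavg _ = fun P => -1 * gavg (m := m) f P).
  by rewrite LZ ?mulN1r ?lerN2//; exact: gavg_continuous.
by apply/funext => P; rewrite gavgZ.
Qed.

End representing_measure.

(** * Busemann-Petty bodies *)

Section busemann_petty.
Context {R : realType}.

Lemma weighted_AGM (a b : nat) (x y : R) : 0 <= x -> 0 <= y ->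
  (a + b)%:R * (x ^+ a * y ^+ b) <= a%:R * x ^+ (a + b) + b%:R * y ^+ (a + b).
Proof.
move=> x0 y0; have [->|ab] := posnP (a + b)%N.
  by rewrite mul0r addr_ge0// mulr_ge0// exprn_ge0.
(* The unweighted inequality for a copies of x^(a+b) and b copies of y^(a+b); the exponent makes the
   geometric mean x^a y^b. *)
pose E (i : 'I_a + 'I_b) : R := if i is inl _ then x ^+ (a + b) else y ^+ (a + b).
have E0 : {in xpredT, forall i, 0 <= E i} by move=> [i|i] _; rewrite /E exprn_ge0.
have [+ _] := leif_AGM E0.
rewrite [X in _ ^+ X](_ : _ = (a + b)%N); last by rewrite cardT -cardE card_sum !card_ord.
rewrite [X in _ / X%:R](_ : _ = (a + b)%N); last by rewrite cardT -cardE card_sum !card_ord.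
rewrite !big_sumType /= !prodr_const !sumr_const !card_ord -!exprM.
rewrite mulnC exprM (mulnC _ b) (exprM y) -exprMn ler_pXn2r ?nnegrE; last 3 first.
- exact: ab.
- by rewrite mulr_ge0// exprn_ge0.
- by rewrite divr_ge0// addr_ge0// mulrn_wge0// exprn_ge0.
by rewrite ler_pdivlMr ?ltr0n// mulrC !mulr_natl.
Qed.

(** The midpoints of x0 + x and -(x0 - x), both in K by symmetry, fill a ball about the origin when
    x0 is an interior point. *)
Lemma convex_body_symbody n (K : set 'rV[R]_n) :
  convex_set (K : set (convex_lmodType 'rV[R]_n)) -> compact K -> (interior K) !=set0 ->
  (forall x, K x -> K (- x)) -> exists r b, 0 < r /\ symbody r b K.
Proof.
move=> vK cK [x0 /nbhs_ballP[e /= e0 He]] sK.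
have [M [_ HM]] := compact_bounded cK.
have cvx x y t : 0 <= t <= 1 -> K x -> K y -> K (t *: x + (1 - t) *: y).
  move=> /andP[t0 t1] /mem_set Kx /mem_set Ky.
  by have /set_mem := vK x y (Itv01 t0 t1) Kx Ky.
exists (e / 2), (n%:R * (`|M| + 1)); split; first by rewrite divr_gt0.
split => //.
- exact: compact_closed (@norm_hausdorff _ _) cK.
- move=> x xe; have sm y : enorm y <= e / 2 -> K (x0 + y).
    move=> ye; apply: He; rewrite -ball_normE /= opprD addNKr normrN.
    apply: le_lt_trans (mx_norm_le_enorm y) (le_lt_trans ye _).
    by rewrite ltr_pdivrMr// ltr_pMr// ltr1n.
  have K1 := sm _ xe; have K2 : K (- (x0 - x)) by apply/sK/sm; rewrite enormN.
  have h : 0 <= (2^-1 : R) <= 1 by apply/andP; split; lra.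
  have := cvx _ _ _ h K1 K2; rewrite (_ : 1 - 2^-1 = 2^-1 :> R); last lra.
  by rewrite (_ : 2^-1 *: (x0 + x) + 2^-1 *: - (x0 - x) = x)//; apply/rowP => i; rewrite !mxE; field.
- move=> x Kx; apply: enorm_le_coord => i; apply: le_trans (coord_le_mx_norm _ _ _) _.
  by apply: HM => //; rewrite ltr_pwDr// ler_norm.
Qed.

Lemma radial_starb n (rho : 'rV[R]_n -> R) th : enorm th = 1 -> 0 <= rho th ->
  radial (starb rho) th = rho th.
Proof.
move=> th1 rho0; have th0 : th != 0 by rewrite -enorm_gt0 th1.
rewrite /radial (_ : [set r | _] = `[0, rho th]%classic); first exact: sup_itvcc.
apply/seteqP; split => s /=; rewrite in_itv/=.
  move=> [s0 [/eqP|]]; first by rewrite scaler_eq0 (negPf th0) orbF => /eqP ->; rewrite lexx.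
  have [->|s1] := eqVneq s 0; first by rewrite lexx.
  have sp : 0 < s by rewrite lt_def s1.
  by rewrite enormZ th1 mulr1 ger0_norm// normalizeZ// normalize_id// s0 => ->.
move=> /andP[s0 sr]; split => //; have [->|s1] := eqVneq s 0; first by left; rewrite scale0r.
have sp : 0 < s by rewrite lt_def s1.
by right; rewrite enormZ th1 mulr1 ger0_norm// normalizeZ// normalize_id.
Qed.

Let powc n k (g : 'rV[R]_n -> R) : {within unitsphere R n, continuous g} ->
  {within unitsphere R n, continuous (fun x => g x ^+ k)}.
Proof.
move=> cg; elim: k => [|k IH].
  by under eq_fun do rewrite expr0; move=> x; exact: cvg_cst.
by under eq_fun do rewrite exprS; exact: within_contM.
Qed.

Lemma vol_starb_savg n (g : 'rV[R]_n.+1 -> R) : bmeas (hat g) -> (forall x, enorm x = 1 -> 0 <= g x) ->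
  (vol (starb g) = vol (unitball R n.+1) * (savg (fun x => hat g x ^+ n.+1))%:E)%E.
Proof.
move=> bg g0; have -> : starb g = starb (hat g).
  by apply/seteqP; split => x; rewrite /starb /= /hat normalize_idem.
rewrite vol_starb; [|by case: bg|by move=> x x1; rewrite hat_id// g0].
have bX k : bmeas (fun x => hat g x ^+ k).
  elim: k => [|k IH]; first by under eq_fun do rewrite expr0; exact: bmeas_cst.
  by under eq_fun do rewrite exprS; exact: bmeasM.
by congr (_ * _)%E; rewrite savg_fin.
Qed.

Lemma secvol_starb n m (g : 'rV[R]_n -> R) (P : 'M[R]_n) : {within unitsphere R n, continuous g} ->
  (forall x, enorm x = 1 -> 0 <= g x) -> grass R n m.+1 P ->
  (secvol m.+1 P (starb g) = vol (unitball R m.+1) * (gavg (m := m) (fun x => g x ^+ m.+1) P)%:E)%E.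
Proof.
move=> cg g0 /frameP[fF _]; rewrite /secvol; set U := frame m.+1 P in fF *.
have hU y : hat (fun y => g (y *m U)) y = hat g (y *m U) by rewrite /hat normalize_frame.
have -> : [set y : 'rV[R]_m.+1 | starb g (y *m U)] = starb (fun y => g (y *m U)).
  apply/seteqP; split => y; rewrite /starb /= enorm_frame// normalize_frame//.
    by move=> [/eqP|]; [rewrite -enorm_eq0 enorm_frame// enorm_eq0 => /eqP ->; left|right].
  by move=> [->|]; [left; rewrite mul0mx|right].
rewrite vol_starb_savg; last 2 first.
- rewrite (_ : hat _ = fun y => hat g (y *m U)); last by apply/funext => y; exact: hU.
  exact: bmeas_favg.
- by move=> y y1; apply: g0; rewrite enorm_frame.
by congr (_ * _%:E)%E; congr savg; apply/funext => y; rewrite hU.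
Qed.

Lemma within_cont_powR (T : topologicalType) (A : set T) (g : T -> R) (p : R) :
  {within A, continuous g} -> (forall x, A x -> 0 < g x) -> {within A, continuous (fun x => powR (g x) p)}.
Proof.
move=> /subspace_continuousP cg g0; apply/subspace_continuousP => x Ax.
have dp : derivable (fun t => powR t p) (g x) 1 by apply: derivable_powR; rewrite in_itv/= andbT g0.
have cp : {for g x, continuous (fun t => powR t p)}.
  exact: differentiable_continuous (iffLR (derivable1_diffP _ _) dp).
exact: (@cvg_comp _ _ _ g (fun t => powR t p) _ _ _ (cg x Ax) cp).
Qed.

Section main_step.
Variables (n m : nat) (r b : R) (K : set 'rV[R]_n.+4).
Hypotheses (r0 : 0 < r) (bK : symbody r b K) (hm : m.+1 = 2 \/ m.+1 = 3).
Local Notation N := n.+4.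
Local Notation a := m.+1.
Local Notation kappa := (fun th : 'rV[R]_N => powR (radial K th) (N - a)%N%:R^-1).
Local Notation Sn := (unitsphere R N).

Let a_lt : (a < N)%N. Proof. by case: hm => ->. Qed.

Let radial_gt0 th : enorm th = 1 -> 0 < radial K th.
Proof. by move=> th1; apply: lt_le_trans (radial_ge r0 bK th1). Qed.

Let kappaX th : enorm th = 1 -> powR (radial K th) (N - a)%N%:R^-1 ^+ (N - a) = radial K th.
Proof.
move=> th1; rewrite -powR_mulrn ?powR_ge0// -powRrM mulVf ?powRr1 ?ltW ?radial_gt0//.
by rewrite pnatr_eq0 subn_eq0 -ltnNge.
Qed.

Let kappa_cont : {within Sn, continuous kappa}.
Proof. by apply: within_cont_powR; [exact: radial_continuous r0 bK|exact: radial_gt0]. Qed.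

(** The exponent 1/(N-a) is made so that the density in the definition is rho_K itself. *)
Lemma BPbody_starb_radial : @BPbody R N (N - a)%N (starb kappa).
Proof.
have [nu [nu0 nuE]] := radial_representation r0 bK hm.
exists nu; rewrite (subKn (ltnW a_lt)); split; first exact: nu0.
move=> f cf; have cfR : {within Sn, continuous (fun x => f x * radial K x)}.
  by apply: within_contM => //; exact: radial_continuous r0 bK.
pose h th := f th * radial (starb kappa) th ^+ (N - a).
have hE th : enorm th = 1 -> h th = f th * radial K th.
  by move=> th1; rewrite /h radial_starb ?powR_ge0// kappaX.
have ch : {within Sn, continuous h}.
  apply/within_contP => x x1 e e0; have [d d0 Hd] := iffLR (within_contP _ _) cfR x x1 e e0.
  by exists d => // y y1 xy; rewrite !hE//; exact: Hd.
rewrite -[LHS]/(sphint 1%:M h) (sphint_savg (isframe1 _) (hat_bmeas ch)).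
have -> : savg (fun y => hat h (y *m 1%:M)) = savg (fun x => hat f x * hat (radial K) x).
  apply: eq_savg.
  - by under eq_fun do rewrite mulmx1; exact: hat_bmeas.
  - by apply: bmeasM; apply: hat_bmeas => //; exact: radial_continuous r0 bK.
  by move=> x x1; rewrite mulmx1 !hat_id// hE.
by rewrite -nuE//; apply: eq_integral => P /set_mem GP; rewrite radon_gavg.
Qed.

Lemma vol_starb_comparison (rhoL : 'rV[R]_N -> R) : {within Sn, continuous rhoL} ->
  (forall th, Sn th -> 0 <= rhoL th) ->
  (forall H, grass R N a H -> (secvol a H (starb kappa) <= secvol a H (starb rhoL))%E) ->
  (vol (starb kappa) <= vol (starb rhoL))%E.
Proof.
move=> cL L0 sec; have k0 th : enorm th = 1 -> 0 <= kappa th by rewrite powR_ge0.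
have cLa := @powc _ a _ cL; have cka := @powc _ a _ kappa_cont.
have cN : {within Sn, continuous (fun x => -1 * kappa x ^+ a)}.
  by apply: within_contM => // x; exact: cvg_cst.
pose f x := rhoL x ^+ a + -1 * kappa x ^+ a.
have cf : {within Sn, continuous f} by move=> x; apply: cvgD; [exact: cLa|exact: cN].
have vB (k : nat) : (0 < vol (unitball R k))%E /\ vol (unitball R k) \is a fin_num.
  by split; [exact: vol_unitball_gt0|exact: vol_unitball_fin].
have f0 : 0 <= savg (fun x => hat f x * hat (radial K) x).
  apply: (savg_radial_gavg_ge0 r0 bK hm cf) => P GP.
  rewrite gavgD// gavgZ// mulN1r subr_ge0 -lee_fin.
  have := sec P GP; rewrite !secvol_starb//.
  by have [v0 vf] := vB a; rewrite lee_pmul2l.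
have bL := hat_bmeas cL; have bk := hat_bmeas kappa_cont; have bR := hat_bmeas (radial_continuous r0 bK).
have bX (g : 'rV[R]_N -> R) i : bmeas g -> bmeas (fun x => g x ^+ i).
  move=> bg; elim: i => [|i IH]; first by under eq_fun do rewrite expr0; exact: bmeas_cst.
  by under eq_fun do rewrite exprS; exact: bmeasM.
have bfR : bmeas (fun x => hat f x * hat (radial K) x) by apply: bmeasM => //; exact: hat_bmeas.
have bD : bmeas (fun x => hat rhoL x ^+ N - hat kappa x ^+ N) by apply: bmeasB; exact: bX.
have aN : (a + (N - a) = N)%N by rewrite subnKC// ltnW.
(* Pointwise, with y = rho_L, k = rho_{K_a} and rho_K = k^(N-a): N (y^a - k^a) k^(N-a) <= a (y^N -
   k^N), which is the weighted inequality for y^a k^(N-a). *)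
have : N%:R * savg (fun x => hat f x * hat (radial K) x) <=
    a%:R * savg (fun x => hat rhoL x ^+ N - hat kappa x ^+ N).
  rewrite -!savgZ//; apply: le_savg => [||x x1]; [by apply: bmeasM => //; exact: bmeas_cst|by apply: bmeasM => //; exact: bmeas_cst|].
  rewrite !hat_id// /f /= -{2}(kappaX x1); set y := rhoL x; set k := powR _ _.
  have := weighted_AGM a (N - a) (L0 x x1) (k0 x x1 : 0 <= k); rewrite aN -/y.
  have -> : (y ^+ a + -1 * k ^+ a) * k ^+ (N - a) = y ^+ a * k ^+ (N - a) - k ^+ N.
    by rewrite -[in k ^+ N]aN exprD; ring.
  have -> : N%:R = a%:R + (N - a)%:R :> R by rewrite -natrD aN.
  by rewrite !mulrBr !mulrDl; lra.
have -> := savgB (bX _ N bL) (bX _ N bk) => H.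
rewrite !vol_starb_savg//; have [v0 vf] := vB N; rewrite lee_pmul2l// lee_fin.
have {}H := le_trans (mulr_ge0 (ler0n R N) f0) H.
by rewrite pmulr_rge0 ?ltr0n// subr_ge0 in H.
Qed.

End main_step.

End busemann_petty.

Theorem theorem1p1 (R : realType) (n : nat) (hn : (4 <= n)%N)
  (K : set 'rV[R]_n)
  (hKconv : convex_set (K : set (convex_lmodType 'rV[R]_n)))
  (hKcpt : compact K) (hKint : (interior K) !=set0)
  (hKsym : forall x, K x -> K (- x))
  (a : nat) (ha : a = 2%N \/ a = 3%N) :
  let Ka := @starb R n (fun th => powR (@radial R n K th) (n - a)%N%:R^-1) in
  @BPbody R n (n - a)%N Ka /\
  (forall rhoL : 'rV[R]_n -> R,
     {within unitsphere R n, continuous rhoL} ->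
     (forall th, unitsphere R n th -> 0 <= rhoL th) ->
     (forall th, unitsphere R n th -> rhoL (- th) = rhoL th) ->
     (forall H, grass R n a H -> (@secvol R n a H Ka <= @secvol R n a H (@starb R n rhoL))%E) ->
     (@vol R n Ka <= @vol R n (@starb R n rhoL))%E).
Proof.
have [r [b [r0 bK]]] := convex_body_symbody hKconv hKcpt hKint hKsym.
move: hn K hKconv hKcpt hKint hKsym bK.
case: n => [|[|[|[|n']]]]; [by []|by []|by []|by []|move=> _ K _ _ _ _ bK Ka; rewrite {}/Ka].
case: ha => ->; split.
- exact: (BPbody_starb_radial (m := 1) r0 bK (or_introl erefl)).
- by move=> rhoL cL L0 _ sec; exact: (vol_starb_comparison (m := 1) r0 bK (or_introl erefl) cL L0 sec).
- exact: (BPbody_starb_radial (m := 2) r0 bK (or_intror erefl)).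
- by move=> rhoL cL L0 _ sec; exact: (vol_starb_comparison (m := 2) r0 bK (or_intror erefl) cL L0 sec).
Qed.
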